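(* Let $\{\chi_k\}_{k=1}^\infty$ be the complete orthonormal system in $L^2_{[0,1]}$, with associated integers $\nu_j$ ($j\ge 0$), constructed as described in the context. Then for every real sequence $\{a_k\}_{k=1}^\infty\notin l^2$ the partial sums $$S_j(x)=\sum_{k=1}^{\nu_j+j}a_k\chi_k(x),\qquad j\in\mathbb{N},$$ diverge almost everywhere on $[0,1]$ as $j\to+\infty$ (i.e. for almost every $x$ the sequence $S_j(x)$ has no finite limit).
   Context: All functions are real-valued and considered up to finitely many points. $\mathbb{N}=\{1,2,\dots\}$. Spaces. $\mathcal{E}^k_{[a,b]}$ is the space of functions on $[a,b]$ that are constant on each interval $(a+(i-1)\frac{b-a}{2^k},a+i\frac{b-a}{2^k})$, $1\le i\le 2^k$. For $j>k$, $\mathcal{E}^{k,j}_{[a,b]}$ is the orthogonal complement of $\mathcal{E}^k_{[a,b]}$ in $\mathcal{E}^j_{[a,b]}$ with respect to the $L^2_{[a,b]}$ inner product. $I_E$ is the characteristic function of $E$. Rademacher and Haar functions. $r_n(t)=\mathrm{sgn}(\sin 2^{n+1}\pi t)$, $n\ge 0$. $h_1^{(k)}$ ($k\ge 0$) equals $2^{k/2}$ on $(0,2^{-k-1})$, $-2^{k/2}$ on $(2^{-k-1},2^{-k})$, and $0$ elsewhere on $[0,1]$. Menshov functions. For $k\ge 2$, $M_k$ is the $2$-periodic function on $\mathbb{R}$ with $M_k(x)=\frac{1}{8i}2^{k/2}$ for $x\in(\frac{i-1}{2^k},\frac{i}{2^k})$, $1\le|i|\le 2^k-1$, and $M_k(x)=0$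 for $x\in(-2^{-k},0)\cup(1-2^{-k},1)$. Put $M_{k,i}(x)=M_k(x-i2^{-k})$. For each $k$ fix an orthonormal system $\{f_k^i\}_{i=0}^{2^k-1}$ in $L^2_{[-2,2]}$ with $f_k^i=M_{k,i}$ on $[-1,1]$, $f_k^i=0$ on $[-2,-1)$, $f_k^i|_{[1,2]}\in\mathcal{E}^{k+1}_{[1,2]}$ and $\int_{-2}^2 f_k^i=0$ (such systems exist); extend each $f_k^i$ to $\mathbb{R}$ with period $4$. Functions $g_n^i$, $\psi_\nu$ and numbers $k_n,m_n$. For $0\le i\le 3$ let $g_1^i(x)=2f_2^i(8x-2)$ on $[0,\frac12]$ and $g_1^i(x)=r_{9+i}(x)$ on $(\frac12,1]$. Let $k_1$ be the smallest natural number with $g_1^i\in\mathcal{E}^{k_1}_{[0,1]}$ for all $i$. Let $m_0=0$, $m_1=2^{k_1+2}-6$, and let $\psi_1\equiv 1,\psi_2,\dots,\psi_{m_1}$ be an orthonormal basis of the orthogonal complement in $\mathcal{E}^{k_1+2}_{[0,1]}$ of $\{g_1^i\}_{i=0}^3\cup\{r_{k_1},h_1^{(k_1+1)}\}$. For $n\ge 2$ and $0\le i\le 2^{2n}-1$ define $\widehat g_n^i$ on $[0,1]$ by: $\widehat g_n^i(x)=n^{-1}2^{n^2}f_{2n}^i(2^{2n^2+2}(x-2^{-2n^2}))$ for $x\in[0,2^{-2n^2}]$; $\widehat g_n^i(x)=n^{-1}2^{k/2}f_{2n}^i(2^{k+2}(x-2^{-k}))$ for $x\in(2^{-k},2^{-k+1}]$,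 $2\le k\le 2n^2$; $\widehat g_n^i(x)=r_{k_{n-1}+4+i}(x)$ for $x\in(\frac12,1]$. Extend $\widehat g_n^i$ with period $1$ and set $g_n^i(x)=\widehat g_n^i(2^{k_{n-1}+2n^2+2}x)$. Let $k_n$ be the smallest natural number with $g_n^i\in\mathcal{E}^{k_n}_{[0,1]}$ for all $0\le i\le 2^{2n}-1$. Let $m_n=m_{n-1}+2^{k_n+2}-2^{k_{n-1}+2}-2^{2n}-2$ and let $\{\psi_\nu\}_{\nu=m_{n-1}+1}^{m_n}$ be an orthonormal basis of the orthogonal complement in $\mathcal{E}^{k_{n-1}+2,k_n+2}_{[0,1]}$ of $\{g_n^i\}_{i=0}^{2^{2n}-1}\cup\{r_{k_n},h_1^{(k_n+1)}\}$. Matrices. For $N\in\mathbb{N}$ let $\delta_N=\frac1N\left(1+\frac{1}{\sqrt{N+1}}\right)$ and let $(\kappa^{(N+1)}_{ij})_{1\le i,j\le N+1}$ be the orthogonal matrix with $\kappa^{(N+1)}_{1j}=\frac1{\sqrt{N+1}}$ for all $j$, and for $2\le i\le N+1$: $\kappa^{(N+1)}_{i,N+1}=\frac{1}{\sqrt{N+1}}$, $\kappa^{(N+1)}_{i,i-1}=1-\delta_N$, and $\kappa^{(N+1)}_{ij}=-\delta_N$ for $1\le j\le N$, $j\ne i-1$. Functions $\xi_l$. Let $p(n)=2^{2(k_n+1)}$, $q_n=(p(n)-1)(m_n-m_{n-1})$, and for $m_{n-1}+1\le\nu\le m_n$ let $q_\nu(n)=\sum_{i=1}^{n-1}q_i+(\nu-m_{n-1}-1)(p(n)-1)$.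 For such $\nu$ and $1\le j\le p(n)$ put $$\phi_j^\nu=\kappa_{1j}^{(p(n))}\psi_\nu+\sum_{i=2}^{p(n)}\kappa_{ij}^{(p(n))}h_1^{(k_{q_\nu(n)+i-1}+1)}.$$ Let $\rho_n=\sum_{j=1}^n p(j)(m_j-m_{j-1})$, $\rho_0=0$, $\rho_\nu(n)=\rho_{n-1}+(\nu-m_{n-1}-1)p(n)$, and $\xi_l=\phi^\nu_j$ for $l=\rho_\nu(n)+j$, $1\le j\le p(n)$, $m_{n-1}+1\le\nu\le m_n$. Functions $\Upsilon_k$. For $n\in\mathbb{N}$ and $1\le j\le 2^{2n}+1$ put $$\Upsilon_j^n=\kappa_{1j}^{(2^{2n}+1)}\xi_n+\sum_{i=2}^{2^{2n}+1}\kappa_{ij}^{(2^{2n}+1)}g_n^{i-2}.$$ Let $\mu_0=0$, $\mu_m=\mu_{m-1}+2^{2m}+1$, and $\Upsilon_k=\Upsilon_j^m$ for $k=\mu_{m-1}+j$, $1\le j\le 2^{2m}+1$. The system $\{\Upsilon_k\}_{k\ge 1}\cup\{r_{k_n}\}_{n\ge 1}$ is a complete orthonormal system in $L^2_{[0,1]}$. Functions $\chi_k$. Fix $M>1+\sqrt2$ and $l_0\in\mathbb{N}$ with $\sqrt{2^{-l_0}}<M-\sqrt2-1$. Choose $\nu_0\in\mathbb{N}$ and $n_j\in\mathbb{N}$ ($j\ge 1$), and put $\nu_j=\nu_{j-1}+2^{n_j}-1$, so that: $n_j\ge k_{\nu_{j-1}}+l_0$ for all $j\ge1$; $\Upsilon_{j+1}\in\mathcal{E}^{k_{\nu_j}}_{[0,1]}$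 for all $j\ge 0$; and for every $m\in\mathbb{N}$, $\Upsilon_j\in\mathcal{E}^{k_{\nu_{\mu_{m-1}}}}_{[0,1]}$ for all $\mu_{m-1}+1\le j\le\mu_m$. Put $\chi_0^{(i)}=r_{k_i}$ for $1\le i\le\nu_0$, and for $j\ge 1$: $\chi_j^{(1)}=\Upsilon_j$, $\chi_j^{(i)}=r_{k_{\nu_{j-1}+i-1}}$ for $1<i\le 2^{n_j}$. Enumerate: $\chi_k=\chi_0^{(k)}$ for $1\le k\le\nu_0$, and $\chi_k=\chi_j^{(i)}$ for $k=\nu_{j-1}+j+i-1$, $1\le i\le 2^{n_j}$, $j\ge1$. Thus $S_j$ is the sum of the first $j+1$ blocks: $\chi_0^{(i)}$, $1\le i\le \nu_0$, followed by the blocks $\chi_l^{(i)}$, $1\le i\le 2^{n_l}$, for $l=1,\dots,j$. *)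

(* Defs.v *)
(* MathComp-Analysis, over an abstract [R : realType]. *)
From HB Require Import structures.
From mathcomp Require Import all_boot all_order all_algebra.
From mathcomp Require Import all_classical all_reals all_analysis.

Set Implicit Arguments.
Unset Strict Implicit.
Unset Printing Implicit Defensive.

Import Order.TTheory GRing.Theory Num.Theory.
Import numFieldNormedType.Exports.

Local Open Scope classical_set_scope.
Local Open Scope ring_scope.

(* Families and sequences are indexed by [nat]; when the mathematical index
   starts at 1 the value at 0 is never used.  A function on an interval is
   represented by a function on [R] whose values elsewhere are never used. *)

Definition eq_upto_finite (R : realType) (D : set R) (f g : R -> R) : Prop :=
  finite_set [set x | D x /\ f x <> g x].

Definition inner (R : realType) (a b : R) (f g : R -> R) : R :=
  (\int[@lebesgue_measure R]_(x in `[a, b]) (f x * g x))%R.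

Definition orthonormal_family (R : realType) (a b : R) (P : pred nat)
    (F : nat -> R -> R) : Prop :=
  forall i j, P i -> P j -> inner a b (F i) (F j) = (i == j)%:R.

(* The space E^k on [a, b]. *)
Definition dyadic_step (R : realType) (a b : R) (k : nat) : set (R -> R) :=
  [set f | forall i : nat, (i < 2 ^ k)%N -> exists c : R,
     eq_upto_finite
       `]a + i%:R * ((b - a) / 2 ^+ k), a + i.+1%:R * ((b - a) / 2 ^+ k)[
       f (fun=> c)].

(* The space E^{k,j} on [a, b]. *)
Definition dyadic_step_compl (R : realType) (a b : R) (k j : nat) :
    set (R -> R) :=
  [set f | dyadic_step a b j f /\
     forall g, dyadic_step a b k g -> inner a b f g = 0].

(* [\psi_\nu], [lo < \nu <= hi], is an orthonormal basis of the subspace [W]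
   of L^2[0, 1]. *)
Record orthonormal_basis (R : realType) (W : set (R -> R)) (lo hi : nat)
    (psi : nat -> R -> R) : Prop := {
  onb_mem : forall nu, (lo < nu <= hi)%N -> W (psi nu);
  onb_orthonormal : orthonormal_family 0 1 (fun nu => (lo < nu <= hi)%N) psi;
  onb_span : forall w, W w -> exists c : nat -> R,
    eq_upto_finite `[0, 1] w
      (fun x => \sum_(lo.+1 <= nu < hi.+1) c nu * psi nu x)
}.

(* The extension with period [T] of the restriction of [f] to [c, c + T). *)
Definition periodize (R : realType) (c T : R) (f : R -> R) : R -> R :=
  fun x => f (x - T * (Num.floor ((x - c) / T))%:~R).

Definition rademacher (R : realType) (n : nat) : R -> R :=
  fun t => Num.sg (sin (2 ^+ n.+1 * pi * t)).

(* The Haar function h_1^{(k)}. *)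
Definition haar1 (R : realType) (k : nat) : R -> R :=
  fun x => if 0 < x < 2 ^- k.+1 then 2 `^ (k%:R / 2)
           else if 2 ^- k.+1 < x < 2 ^- k then - (2 `^ (k%:R / 2))
           else 0.

(* For [x] in the open interval ((i-1)/2^k, i/2^k), [floor (2^k x) + 1] is
   [i]. *)
Definition menshov (R : realType) (k : nat) : R -> R :=
  periodize (-1) 2 (fun x =>
    let i : int := Num.floor (2 ^+ k * x) + 1 in
    if (1 <= `|i|) && (`|i| <= 2 ^+ k - 1) then 2 `^ (k%:R / 2) / (8 * i%:~R)
    else 0).

Definition menshov_shift (R : realType) (k i : nat) : R -> R :=
  fun x => menshov k (x - i%:R * 2 ^- k).

Record menshov_extension (R : realType) (k : nat) (f : nat -> R -> R) :
    Prop := {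
  mext_orthonormal : orthonormal_family (-2) 2 (fun i => (i < 2 ^ k)%N) f;
  mext_menshov : forall i, (i < 2 ^ k)%N ->
    eq_upto_finite `[-1, 1] (f i) (menshov_shift k i);
  mext_zero : forall i, (i < 2 ^ k)%N ->
    eq_upto_finite `[-2, -1[ (f i) (fun=> 0);
  mext_step : forall i, (i < 2 ^ k)%N -> dyadic_step 1 2 k.+1 (f i);
  mext_mean0 : forall i, (i < 2 ^ k)%N ->
    \int[@lebesgue_measure R]_(x in `[-2, 2]) f i x = 0
}.

(* Here [f k i] stands for f_k^i on [-2, 2] and [f_per f k i] for its
   4-periodic extension. *)
Definition f_per (R : realType) (f : nat -> nat -> R -> R) (k i : nat) :
    R -> R :=
  periodize (-2) 4 (f k i).

(* [kp] stands for k_{n-1}.  In the sum at most one term is nonzero, as the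
   intervals (2^-k, 2^-(k-1)] are disjoint. *)
Definition g_hat (R : realType) (f : nat -> nat -> R -> R) (kp n i : nat) :
    R -> R :=
  fun x =>
    if x <= 2 ^- (2 * n ^ 2) then
      n%:R^-1 * 2 ^+ (n ^ 2) *
        f_per f (2 * n) i (2 ^+ (2 * n ^ 2 + 2) * (x - 2 ^- (2 * n ^ 2)))
    else if x <= 1 / 2 then
      \sum_(2 <= k < (2 * n ^ 2).+1 | 2 ^- k < x <= 2 ^- k.-1)
        n%:R^-1 * 2 `^ (k%:R / 2) *
          f_per f (2 * n) i (2 ^+ (k + 2) * (x - 2 ^- k))
    else rademacher (kp + 4 + i) x.

(* The function g_n^i, n >= 1, for the sequence [k] of the k_n. *)
Definition g (R : realType) (f : nat -> nat -> R -> R) (k : nat -> nat)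
    (n i : nat) : R -> R :=
  if (n == 1)%N then
    fun x => if x <= 1 / 2 then 2 * f_per f 2 i (8 * x - 2)
             else rademacher (9 + i) x
  else
    fun x => periodize 0 1 (g_hat f (k n.-1) n i)
               (2 ^+ (k n.-1 + 2 * n ^ 2 + 2) * x).

Record smallest_level (R : realType) (f : nat -> nat -> R -> R)
    (k : nat -> nat) (n : nat) : Prop := {
  level_gt0 : (0 < k n)%N;
  level_step : forall i, (i < 2 ^ (2 * n))%N ->
    dyadic_step 0 1 (k n) (g f k n i);
  level_min : forall k' : nat, (0 < k')%N ->
    (forall i, (i < 2 ^ (2 * n))%N -> dyadic_step 0 1 k' (g f k n i)) ->
    (k n <= k')%N
}.

Fixpoint m (k : nat -> nat) (n : nat) : nat :=
  match n with
  | 0 => 0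
  | n'.+1 =>
      if n' == 0 then 2 ^ (k 1 + 2) - 6
      else m k n' + (2 ^ (k n'.+1 + 2) - 2 ^ (k n' + 2) - 2 ^ (2 * n'.+1) - 2)
  end%N.

(* The space of which psi_nu, m_{n-1} < nu <= m_n, is an orthonormal basis. *)
Definition psi_space (R : realType) (f : nat -> nat -> R -> R)
    (k : nat -> nat) (n : nat) : set (R -> R) :=
  [set w | [/\ (if (n == 1)%N then dyadic_step 0 1 (k 1 + 2)%N w
                else dyadic_step_compl 0 1 (k n.-1 + 2)%N (k n + 2)%N w),
               (forall i, (i < 2 ^ (2 * n))%N -> inner 0 1 w (g f k n i) = 0),
               inner 0 1 w (rademacher (k n)) = 0 &
               inner 0 1 w (haar1 (k n).+1) = 0]].

Record psi_system (R : realType) (f : nat -> nat -> R -> R)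
    (k : nat -> nat) (psi : nat -> R -> R) : Prop := {
  psi_one : eq_upto_finite `[0, 1] (psi 1) (fun=> 1);
  psi_basis : forall n, (1 <= n)%N ->
    orthonormal_basis (psi_space f k n) (m k n.-1) (m k n) psi
}.

Definition delta (R : realType) (N : nat) : R :=
  1 / N%:R * (1 + 1 / Num.sqrt N.+1%:R).

(* The entry kappa_{ij}^{(P)}, 1 <= i, j <= P, where P = N + 1. *)
Definition kappa (R : realType) (P i j : nat) : R :=
  if (i == 1)%N || (j == P) then 1 / Num.sqrt P%:R
  else if (j == i.-1)%N then 1 - delta R P.-1
  else - delta R P.-1.

Definition p (k : nat -> nat) (n : nat) : nat := 2 ^ (2 * (k n + 1)).

Definition q (k : nat -> nat) (n : nat) : nat :=
  (p k n - 1) * (m k n - m k n.-1).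

(* The number q_nu(n), for m_{n-1} < nu <= m_n. *)
Definition q_at (k : nat -> nat) (n nu : nat) : nat :=
  \sum_(1 <= i < n) q k i + (nu - m k n.-1 - 1) * (p k n - 1).

(* The function phi_j^nu, for m_{n-1} < nu <= m_n. *)
Definition phi (R : realType) (k : nat -> nat) (psi : nat -> R -> R)
    (n nu j : nat) : R -> R :=
  fun x => kappa R (p k n) 1 j * psi nu x +
    \sum_(2 <= i < (p k n).+1)
      kappa R (p k n) i j * haar1 (k (q_at k n nu + i - 1)%N).+1 x.

Definition rho (k : nat -> nat) (n : nat) : nat :=
  \sum_(1 <= j < n.+1) p k j * (m k j - m k j.-1).

(* The number rho_nu(n), for m_{n-1} < nu <= m_n. *)
Definition rho_at (k : nat -> nat) (n nu : nat) : nat :=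
  rho k n.-1 + (nu - m k n.-1 - 1) * p k n.

Definition xi_system (R : realType) (k : nat -> nat) (psi : nat -> R -> R)
    (xi : nat -> R -> R) : Prop :=
  forall n nu j, (1 <= n)%N -> (m k n.-1 + 1 <= nu <= m k n)%N ->
    (1 <= j <= p k n)%N -> xi (rho_at k n nu + j)%N = phi k psi n nu j.

(* The function Upsilon_j^n, 1 <= j <= 2^(2n) + 1. *)
Definition Upsilon_block (R : realType) (f : nat -> nat -> R -> R)
    (k : nat -> nat) (xi : nat -> R -> R) (n j : nat) : R -> R :=
  fun x => kappa R (2 ^ (2 * n) + 1) 1 j * xi n x +
    \sum_(2 <= i < (2 ^ (2 * n) + 1).+1)
      kappa R (2 ^ (2 * n) + 1) i j * g f k n (i - 2) x.

Fixpoint mu (n : nat) : nat :=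
  match n with
  | 0 => 0
  | n'.+1 => mu n' + 2 ^ (2 * n'.+1) + 1
  end%N.

Definition Upsilon_system (R : realType) (f : nat -> nat -> R -> R)
    (k : nat -> nat) (xi Upsilon : nat -> R -> R) : Prop :=
  forall n j, (1 <= n)%N -> (1 <= j <= 2 ^ (2 * n) + 1)%N ->
    Upsilon (mu n.-1 + j)%N = Upsilon_block f k xi n j.

(* The conditions on l_0, nu_0, (n_j) and (nu_j). *)
Record chi_parameters (R : realType) (M : R) (l0 : nat) (k : nat -> nat)
    (Upsilon : nat -> R -> R) (n nu : nat -> nat) : Prop := {
  M_gt : M > 1 + Num.sqrt 2;
  l0_gt0 : (0 < l0)%N;
  l0_lt : Num.sqrt (2 ^- l0) < M - Num.sqrt 2 - 1;
  nu0_gt0 : (0 < nu 0)%N;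
  n_gt0 : forall j, (1 <= j)%N -> (0 < n j)%N;
  nuS : forall j, (1 <= j)%N -> nu j = (nu j.-1 + 2 ^ n j - 1)%N;
  n_large : forall j, (1 <= j)%N -> (k (nu j.-1) + l0 <= n j)%N;
  Upsilon_step : forall j, dyadic_step 0 1 (k (nu j)) (Upsilon j.+1);
  Upsilon_step_block : forall b, (1 <= b)%N ->
    forall j, (mu b.-1 + 1 <= j <= mu b)%N ->
    dyadic_step 0 1 (k (nu (mu b.-1))) (Upsilon j)
}.

Record chi_system (R : realType) (k : nat -> nat) (Upsilon : nat -> R -> R)
    (n nu : nat -> nat) (chi : nat -> R -> R) : Prop := {
  chi_block0 : forall i, (1 <= i <= nu 0)%N -> chi i = rademacher (k i);
  chi_block1 : forall j, (1 <= j)%N -> chi (nu j.-1 + j)%N = Upsilon j;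
  chi_block : forall j i, (1 <= j)%N -> (1 < i <= 2 ^ n j)%N ->
    chi (nu j.-1 + j + i - 1)%N = rademacher (k (nu j.-1 + i - 1)%N)
}.

(* Main.v *)
(* Group the terms of S_j by the blocks of Menshov functions.  The kappa-rotation
   turns the Upsilon-part of the s-th block into gam_s xi_s + sum_i bet_{s,i} g_s^i,
   with the same energy, and the remaining terms are lacunary Rademacher functions.
   Fix a dyadic cell of level l not containing 0: there xi_s is frozen on the cells
   of level k_{s-1} + 2 s^2 + 2 for large s.  As the coefficients are not in l^2,
   one of two things happens beyond any given block.

   - A window of the g- and Rademacher parts has energy at least 1 while the xi-part
     is frozen (a single block) or small in L^2 (by Bessel, when sum gam_s^2
     converges).  On the upper half of each cell the g_s^i are Rademacher functions,
     so the characteristic function of the normalised window is bounded away from 1,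
     and the window cannot be concentrated near one value.
   - sum gam_s^2 diverges while the bet-energies stay below 1.  Comparing two shifted
     copies of M_{2s}, the s-th block has a partial sum of size at least 1/4 with
     conditional probability of order min(gam_s^2, 1) up to a summable error, so
     this occurs for some s with probability near 1 (Borel-Cantelli); by symmetry
     the Rademacher functions inserted in the block cannot compensate it.

   Hence S_j oscillates by more than 1/10 on a fixed proportion of every such cell;
   iterating over finer and finer cells, it does so almost everywhere, infinitely
   often.  All averages are finite: functions are sampled at the points (i + z) / 2^K
   for a z avoiding the countably many exceptional translates. *)
Require Import Defs.
From HB Require Import structures.
From mathcomp Require Import all_boot all_order all_algebra.
From mathcomp Require Import all_classical all_reals all_analysis measurable_realfun.
From mathcomp Require Import zify ring lra.
Set Implicit Arguments.
Unset Strict Implicit.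
Unset Printing Implicit Defensive.
Import Order.TTheory GRing.Theory Num.Theory.
Import numFieldNormedType.Exports.
Local Open Scope classical_set_scope.
Local Open Scope ring_scope.

(** * Averages over dyadic cells and characteristic functions *)

(** Little is known about the lower half of a cell. Characteristic functions tolerate this: the
    unknown half costs a factor (1 + q)/2 in place of q, independent layers multiply, and
    concentration near one value forces a modulus near 1. Cells at 0 are excluded because the Haar
    terms of xi_s have uncontrolled frequencies; their supports shrink to 0, so they vanish on any
    other cell once s is large. In the Menshov alternative a jump of order gam_s 2^(kap/2) sits on a
    part of measure of order 2^-kap, for every kap from 2 to 2 s^2. Hence it exceeds 1 with
    probability of order min(gam_s^2, 1) however small gam_s is. The factor 1/s in g_s is offset by
    the harmonic sum of 4^s terms of the kernel. The bound on the bet-energy keeps the coefficients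
    of the block within distance 1 of a constant vector of norm |gam_s|, and this perturbs the gain
    by O(1/s) only: hence the summable error 1/s^2. The threshold 1/10 is tied to the jump 1/4: the
    factor bringing 1/4 to pi/2 is below 8, and 8/10 is small enough for the quadratic bound on the
    cosine. *)

Section Trigonometry.
Context {R : realType}.
Implicit Types x u : R.

Lemma sin_le_id x : 0 <= x -> sin x <= x.
Proof.
rewrite le_eqVlt => /predU1P[<-|x0]; first by rewrite sin0.
have [c _] : exists2 c, c \in `]0, x[%R & sin x - sin 0 = cos c * (x - 0).
  apply: (@MVT _ (@sin R) (@cos R)) => //.
  exact/continuous_subspaceT/continuous_sin.
rewrite sin0 !subr0 => ->; rewrite ler_piMl ?(ltW x0) //; exact: cos_le1.
Qed.

Lemma cos_ge_quadratic u : 1 - u ^+ 2 / 2 <= cos u.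
Proof.
rewrite -cos_norm -real_normK ?num_real//.
have := normr_ge0 u; move: `|u| => {}u u0.
rewrite {2}[u]splitr -mulr2n cos_mulr2n cos2sin2.
have [u4|u4] := leP u 2; last first.
  have := sin_le1 (u / 2); have := sin_geN1 (u / 2); nra.
have /sin_le_id : 0 <= u / 2 by lra.
have : 0 <= sin (u / 2) by apply: sin_ge0_pi; have := @pi_ge2 R; lra.
nra.
Qed.

Lemma sin_ge_half x : 0 <= x <= 1 -> x / 2 <= sin x.
Proof.
case/andP; rewrite le_eqVlt => /predU1P[<-|x0] x1; first by rewrite sin0 mul0r.
have [c cx] : exists2 c, c \in `]0, x[%R & sin x - sin 0 = cos c * (x - 0).
  apply: (@MVT _ (@sin R) (@cos R)) => //.
  exact/continuous_subspaceT/continuous_sin.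
rewrite sin0 !subr0 => ->.
have := cos_ge_quadratic c; move: cx; rewrite in_itv /= => /andP[? ?]; nra.
Qed.

Lemma cos_le_quadratic u : `|u| <= 1 -> cos u <= 1 - u ^+ 2 / 8.
Proof.
rewrite -cos_norm -[in X in _ -> _ <= X]real_normK ?num_real//.
have := normr_ge0 u; move: `|u| => {}u u0 u1.
rewrite {1}[u]splitr -mulr2n cos_mulr2n cos2sin2.
have : u / 2 / 2 <= sin (u / 2) by apply: sin_ge_half; lra.
nra.
Qed.

(** The reciprocal form lets [prod_inv1D_le] handle products over many angles. *)
Lemma norm_cos_le u : `|u| <= 1 -> `|cos u| <= (1 + u ^+ 2 / 8)^-1.
Proof.
move=> u1; have u2 : u ^+ 2 <= 1 by rewrite -real_normK ?num_real// expr_le1.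
have := sqr_ge0 u => u0.
rewrite ger0_norm; last by have := cos_ge_quadratic u; lra.
apply: (le_trans (cos_le_quadratic u1)).
rewrite -[leRHS]mul1r ler_pdivlMr; nra.
Qed.

End Trigonometry.

Section Averages.
Context {R : realType}.
Implicit Types (F H : nat -> R) (K l L c : nat).

Lemma sum_ord_mul (V : nmodType) a b (F : nat -> V) :
  \sum_(t < a * b) F t = \sum_(s < a) \sum_(r < b) F (s * b + r)%N.
Proof.
elim: a => [|a IH]; first by rewrite mul0n !big_ord0.
by rewrite mulSnr big_split_ord /= IH [RHS]big_ord_recr.
Qed.

(* A function on [0, 1] is sampled at one point of each dyadic cell of level
   [K] and becomes a function of the cell number; [avg K l c] averages over the
   cells of level [K] inside the cell [c] of level [l]. *)
Definition avg K l c F : R :=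
  (\sum_(t < 2 ^ (K - l)) F (c * 2 ^ (K - l) + t)%N) / 2 ^+ (K - l).

Lemma expn2_gt0 d : (0 < 2 ^ d)%N. Proof. by rewrite expn_gt0. Qed.

Lemma cell_divn K l c (t : 'I_(2 ^ (K - l))) :
  ((c * 2 ^ (K - l) + t) %/ 2 ^ (K - l) = c)%N.
Proof. by rewrite divnMDl ?expn2_gt0// divn_small ?addn0. Qed.

Lemma pow2_neq0 d : (2 : R) ^+ d != 0. Proof. by rewrite expf_neq0. Qed.
Lemma pow2_gt0 d : 0 < (2 : R) ^+ d. Proof. by rewrite exprn_gt0. Qed.
Hint Resolve pow2_neq0 pow2_gt0 expn2_gt0 : core.

Lemma avg_ext K l c F H :
  (forall i, (i %/ 2 ^ (K - l) = c)%N -> F i = H i) -> avg K l c F = avg K l c H.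
Proof.
by move=> FH; congr (_ / _); apply: eq_bigr => t _; rewrite FH// cell_divn.
Qed.

Lemma avg_le K l c F H :
  (forall i, (i %/ 2 ^ (K - l) = c)%N -> F i <= H i) -> avg K l c F <= avg K l c H.
Proof.
move=> FH; rewrite ler_wpM2r ?invr_ge0 ?(ltW (pow2_gt0 _))//.
by apply: ler_sum => t _; rewrite FH// cell_divn.
Qed.

Lemma avgD K l c F H : avg K l c (F \+ H) = avg K l c F + avg K l c H.
Proof. by rewrite /avg big_split mulrDl. Qed.

Lemma avgZ K l c a F : avg K l c (fun i => a * F i) = a * avg K l c F.
Proof. by rewrite /avg -mulr_sumr mulrA. Qed.

Lemma avgN K l c F : avg K l c (\- F) = - avg K l c F.
Proof. by rewrite /avg sumrN mulNr. Qed.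

Lemma avgB K l c F H : avg K l c (F \- H) = avg K l c F - avg K l c H.
Proof. by rewrite -avgN -avgD. Qed.

Lemma avg_cst K l c (a : R) : avg K l c (fun=> a) = a.
Proof.
by rewrite /avg sumr_const card_ord -[X in X / _]mulr_natr natrX mulfK.
Qed.

Lemma avg_sum (I : Type) (r : seq I) (P : pred I) (F : I -> nat -> R) K l c :
  avg K l c (fun i => \sum_(j <- r | P j) F j i) =
  \sum_(j <- r | P j) avg K l c (F j).
Proof. by rewrite /avg exchange_big mulr_suml. Qed.

Lemma avg_const K l c F (a : R) :
  (forall i, (i %/ 2 ^ (K - l) = c)%N -> F i = a) -> avg K l c F = a.
Proof. by move=> /avg_ext ->; rewrite avg_cst. Qed.

Lemma avg_ge0 K l c F :
  (forall i, (i %/ 2 ^ (K - l) = c)%N -> 0 <= F i) -> 0 <= avg K l c F.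
Proof. by move=> F0; rewrite -(avg_cst K l c 0); apply: avg_le. Qed.

Lemma avg_tower K L l c F : (l <= L <= K)%N ->
  avg K l c F = avg L l c (fun e => avg K L e F).
Proof.
move=> /andP[lL LK]; rewrite /avg -mulr_suml -mulrA -invfM -exprD.
have -> : (K - L + (L - l) = K - l)%N by lia.
have e : (2 ^ (K - l) = 2 ^ (L - l) * 2 ^ (K - L))%N by rewrite -expnD; congr expn; lia.
congr (_ / _); rewrite e (sum_ord_mul _ _
  (fun t => F (c * (2 ^ (L - l) * 2 ^ (K - L)) + t)%N)).
by apply: eq_bigr => s _; apply: eq_bigr => r _; congr F; lia.
Qed.

Lemma divn_pow2 (i K L l : nat) : (l <= L <= K)%N ->
  ((i %/ 2 ^ (K - L)) %/ 2 ^ (L - l) = i %/ 2 ^ (K - l))%N.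
Proof. by move=> lLK; rewrite -divnMA -expnD; congr (_ %/ 2 ^ _)%N; lia. Qed.

Lemma avg_le_sub K L l c F H : (l <= L <= K)%N ->
  (forall e, (e %/ 2 ^ (L - l) = c)%N -> avg K L e F <= avg K L e H) ->
  avg K l c F <= avg K l c H.
Proof. by move=> lLK FH; rewrite !(avg_tower _ _ lLK); apply: avg_le. Qed.

Lemma avg_eq_sub K L l c F H : (l <= L <= K)%N ->
  (forall e, (e %/ 2 ^ (L - l) = c)%N -> avg K L e F = avg K L e H) ->
  avg K l c F = avg K l c H.
Proof. by move=> lLK FH; rewrite !(avg_tower _ _ lLK); apply: avg_ext. Qed.

(** Measurability with respect to the cells of level [L], asked only inside the cell [c] of level
    [l]: the [xi] have the required level only away from 0. *)
Definition step_in K l c L F : Prop := forall i j,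
  (i %/ 2 ^ (K - l) = c)%N -> (i %/ 2 ^ (K - L) = j %/ 2 ^ (K - L))%N ->
  F i = F j.

Lemma step_in_cst K l c L F e : (l <= L <= K)%N -> step_in K l c L F ->
  (e %/ 2 ^ (L - l) = c)%N ->
  forall i, (i %/ 2 ^ (K - L) = e)%N -> F i = F (e * 2 ^ (K - L))%N.
Proof.
move=> lLK sF ec i ie; apply: sF; first by rewrite -(divn_pow2 i lLK) ie.
by rewrite ie mulnK.
Qed.

Lemma step_in_mono K l c L L' F : (L <= L' <= K)%N ->
  step_in K l c L F -> step_in K l c L' F.
Proof.
move=> LL' sF i j ic ij; apply: sF => //.
by rewrite -!(divn_pow2 _ LL') ij.
Qed.

Lemma avg_split K l c F : (l < K)%N ->
  avg K l c F = (avg K l.+1 (2 * c) F + avg K l.+1 (2 * c).+1 F) / 2.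
Proof.
move=> lK; rewrite (@avg_tower K l.+1) ?leqnSn// {1}/avg subSnn expr1 expn1.
by rewrite !big_ord_recl big_ord0 addr0 /= addn0 addn1 mulnC.
Qed.

Lemma avg_sqr K l c F : avg K l c F ^+ 2 <= avg K l c (fun i => F i ^+ 2).
Proof.
set a := avg K l c F.
have : 0 <= avg K l c (fun i => (F i - a) ^+ 2).
  by apply: avg_ge0 => i _; exact: sqr_ge0.
rewrite (@avg_ext _ _ _ _ ((fun i => F i ^+ 2) \+ (fun i => (- (2 * a)) * F i)
    \+ (fun=> a ^+ 2))); last by move=> i _ /=; ring.
by rewrite !avgD avgZ avg_cst -/a; nra.
Qed.

Definition rad K k i : R := if odd (i %/ 2 ^ (K - k.+1)) then -1 else 1.

Lemma rad_step K k l c L : (k < L <= K)%N -> step_in K l c L (rad K k).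
Proof.
move=> kL i j _ ij; rewrite /rad; have kL' : (k.+1 <= L <= K)%N by lia.
by rewrite -!(divn_pow2 _ kL') ij.
Qed.

Lemma rad_even K k c i : (k < K)%N ->
  (i %/ 2 ^ (K - k.+1) = 2 * c)%N -> rad K k i = 1.
Proof. by move=> kK ic; rewrite /rad ic mul2n odd_double. Qed.

Lemma rad_odd K k c i : (k < K)%N ->
  (i %/ 2 ^ (K - k.+1) = (2 * c).+1)%N -> rad K k i = -1.
Proof. by move=> kK ic; rewrite /rad ic mul2n /= odd_double. Qed.

(** Conditioning on level [k]: on each such cell [F] is constant and [rad K k] takes the values 1
    and -1 on the two halves. *)
Lemma avg_add_rad (h : R -> R) K k l c F (a : R) : (l <= k < K)%N ->
  step_in K l c k F ->
  avg K l c (fun i => h (F i + a * rad K k i)) =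
  avg K l c (fun i => (h (F i + a) + h (F i - a)) / 2).
Proof.
move=> /andP[lk kK] sF; have lkK : (l <= k <= K)%N by lia.
apply: (avg_eq_sub lkK) => e ec.
have cF := step_in_cst lkK sF ec.
rewrite avg_split//.
have -> : avg K k e (fun i => (h (F i + a) + h (F i - a)) / 2) =
  (h (F (e * 2 ^ (K - k))%N + a) + h (F (e * 2 ^ (K - k))%N - a)) / 2.
  by apply: avg_const => i ie; rewrite cF.
have kkK : (k <= k.+1 <= K)%N by lia.
congr ((_ + _) / _); apply: avg_const => i ie.
- rewrite (rad_even _ ie)// mulr1 cF// -(divn_pow2 _ kkK) ie subSnn; lia.
- rewrite (rad_odd _ ie)// mulrN1 cF// -(divn_pow2 _ kkK) ie subSnn; lia.
Qed.

Lemma avg_cos_rad K k l c F a : (l <= k < K)%N -> step_in K l c k F ->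
  avg K l c (fun i => cos (F i + a * rad K k i)) =
  cos a * avg K l c (fun i => cos (F i)).
Proof.
move=> lkK sF; rewrite avg_add_rad// -avgZ; apply: avg_ext => i _.
by rewrite cosD cosB; field.
Qed.

Lemma avg_sin_rad K k l c F a : (l <= k < K)%N -> step_in K l c k F ->
  avg K l c (fun i => sin (F i + a * rad K k i)) =
  cos a * avg K l c (fun i => sin (F i)).
Proof.
move=> lkK sF; rewrite avg_add_rad// -avgZ; apply: avg_ext => i _.
by rewrite sinD sinB; field.
Qed.

Lemma step_in_sum (I : Type) (r : seq I) (P : pred I) (F : I -> nat -> R)
    K l c L : (forall j, P j -> step_in K l c L (F j)) ->
  step_in K l c L (fun i => \sum_(j <- r | P j) F j i).
Proof. by move=> sF i j ic ij; apply: eq_bigr => s Ps; apply: sF. Qed.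

Lemma step_inD K l c L F H : step_in K l c L F -> step_in K l c L H ->
  step_in K l c L (fun i => F i + H i).
Proof. by move=> sF sH i j ic ij; rewrite (sF i j)// (sH i j). Qed.

Lemma step_inZ K l c L a F : step_in K l c L F ->
  step_in K l c L (fun i => a * F i).
Proof. by move=> sF i j ic ij; rewrite (sF i j). Qed.

Lemma avg_cos_rads K l c (k : nat -> nat) (b : nat -> R) n :
  (forall s, (s < n)%N -> (l <= k s < K)%N) ->
  (forall s t, (s < t < n)%N -> (k s < k t)%N) ->
  avg K l c (fun i => cos (\sum_(s < n) b s * rad K (k s) i)) =
    \prod_(s < n) cos (b s) /\
  avg K l c (fun i => sin (\sum_(s < n) b s * rad K (k s) i)) = 0.
Proof.
elim: n => [|n IH] klK kmono.
  by split; apply: avg_const => i _; rewrite !big_ord0 ?cos0 ?sin0.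
have [||IH1 IH2] := IH; [by move=> s sn; apply: klK; lia|by move=> s t stn; apply: kmono; lia|].
have st : step_in K l c (k n) (fun i => \sum_(s < n) b s * rad K (k s) i).
  apply: step_in_sum => s _; apply: step_inZ; apply: rad_step.
  by have := klK n (ltnSn n); have := kmono s n; rewrite ltn_ord ltnSn => /(_ isT); lia.
split.
- rewrite big_ord_recr /= -IH1 mulrC -(@avg_cos_rad _ (k n))//; last exact: klK.
  by apply: avg_ext => i _; rewrite big_ord_recr.
- transitivity (cos (b n) * avg K l c (fun i => sin (\sum_(s < n) b s * rad K (k s) i))).
    rewrite -(@avg_sin_rad _ (k n))//; last exact: klK.
    by apply: avg_ext => i _; rewrite big_ord_recr.
  by rewrite IH2 mulr0.
Qed.

(* |E e^{i(T+D)}| = |E e^{iT}| |E e^{iD}| when D is independent of T. *)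
Lemma avg_char_add K l c L (T D : nat -> R) (A B : R) : (l <= L <= K)%N ->
  step_in K l c L T ->
  (forall e, (e %/ 2 ^ (L - l) = c)%N ->
     avg K L e (fun i => cos (D i)) = A /\ avg K L e (fun i => sin (D i)) = B) ->
  avg K l c (fun i => cos (T i + D i)) ^+ 2 +
  avg K l c (fun i => sin (T i + D i)) ^+ 2 =
  (A ^+ 2 + B ^+ 2) *
  (avg K l c (fun i => cos (T i)) ^+ 2 + avg K l c (fun i => sin (T i)) ^+ 2).
Proof.
move=> lLK sT AB.
have -> : avg K l c (fun i => cos (T i + D i)) =
    A * avg K l c (fun i => cos (T i)) - B * avg K l c (fun i => sin (T i)).
  rewrite -!avgZ -avgB; apply: (avg_eq_sub lLK) => e ec.
  have cT := step_in_cst lLK sT ec; have [<- <-] := AB e ec.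
  rewrite [RHS](@avg_const _ _ _ _ (avg K L e (fun i => cos (D i)) * cos (T (e * 2 ^ (K - L))%N)
    - avg K L e (fun i => sin (D i)) * sin (T (e * 2 ^ (K - L))%N))); last first.
    by move=> i ie /=; rewrite cT.
  rewrite mulrC [X in _ - X]mulrC -!avgZ -avgB; apply: avg_ext => i ie /=.
  by rewrite cosD cT.
have -> : avg K l c (fun i => sin (T i + D i)) =
    A * avg K l c (fun i => sin (T i)) + B * avg K l c (fun i => cos (T i)).
  rewrite -!avgZ -avgD; apply: (avg_eq_sub lLK) => e ec.
  have cT := step_in_cst lLK sT ec; have [<- <-] := AB e ec.
  rewrite [RHS](@avg_const _ _ _ _ (avg K L e (fun i => cos (D i)) * sin (T (e * 2 ^ (K - L))%N)
    + avg K L e (fun i => sin (D i)) * cos (T (e * 2 ^ (K - L))%N))); last first.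
    by move=> i ie /=; rewrite cT.
  rewrite mulrC [X in _ + X]mulrC -!avgZ -avgD; apply: avg_ext => i ie /=.
  by rewrite sinD cT.
by ring.
Qed.

Lemma avg_char_le1 K l c F :
  avg K l c (fun i => cos (F i)) ^+ 2 + avg K l c (fun i => sin (F i)) ^+ 2 <= 1.
Proof.
apply: (le_trans (lerD (avg_sqr _ _ _ _) (avg_sqr _ _ _ _))).
by rewrite -avgD (@avg_const _ _ _ _ 1)// => i _ /=; rewrite cos2Dsin2.
Qed.

Lemma avg_norm_cos_le1 K l c F : `|avg K l c (fun i => cos (F i))| <= 1.
Proof.
have le1 := avg_char_le1 K l c F; rewrite -(@ler_pXn2r _ 2) ?nnegrE//.
rewrite real_normK ?num_real// expr1n; apply: le_trans le1.
by rewrite lerDl sqr_ge0.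
Qed.

(** On the upper half the signs are symmetric and independent, so the characteristic function is the
    real product of cosines. On the lower half only the bound 1 is available, and the two bounds are
    averaged. *)
Lemma avg_char_half K l c G (k : nat -> nat) (b : nat -> R) n :
  (l < K)%N ->
  (forall s, (s < n)%N -> (l < k s < K)%N) ->
  (forall s t, (s < t < n)%N -> (k s < k t)%N) ->
  (forall i, (i %/ 2 ^ (K - l.+1) = (2 * c).+1)%N ->
     G i = \sum_(s < n) b s * rad K (k s) i) ->
  avg K l c (fun i => cos (G i)) ^+ 2 + avg K l c (fun i => sin (G i)) ^+ 2 <=
  ((1 + \prod_(s < n) `|cos (b s)|) / 2) ^+ 2.
Proof.
move=> lK klK kmono GR; rewrite !(@avg_split K l)//.
have [c1 c2] := @avg_cos_rads K l.+1 (2 * c).+1 k b n klK kmono.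
have -> : avg K l.+1 (2 * c).+1 (fun i => cos (G i)) = \prod_(s < n) cos (b s).
  by rewrite -c1; apply: avg_ext => i ic; rewrite GR.
have -> : avg K l.+1 (2 * c).+1 (fun i => sin (G i)) = 0.
  by rewrite -c2; apply: avg_ext => i ic; rewrite GR.
rewrite -normr_prod.
have := avg_char_le1 K l.+1 (2 * c) G.
have := avg_norm_cos_le1 K l.+1 (2 * c) G.
set A := avg _ _ _ _; set B := avg _ _ _ _; set P := \prod_(s < n) _.
move=> A1 AB; have : A * P <= `|P|.
  by rewrite (le_trans (ler_norm _))// normrM ler_piMl.
have : P ^+ 2 = `|P| ^+ 2 by rewrite real_normK ?num_real.
rewrite addr0; move: `|P| => Q PQ APQ.
have -> : ((A + P) / 2) ^+ 2 + (B / 2) ^+ 2 = (A ^+ 2 + B ^+ 2 + 2 * (A * P) + P ^+ 2) / 4 by field.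
have -> : ((1 + Q) / 2) ^+ 2 = (1 + 2 * Q + Q ^+ 2) / 4 by field.
by rewrite PQ; lra.
Qed.

End Averages.

(** * Independent layers and their characteristic functions *)

Section CharacteristicFunctions.
Context {R : realType}.

Lemma avg_periodic K L e (F : nat -> R) : (L <= K)%N ->
  (forall i j, (i = j %[mod 2 ^ (K - L)])%N -> F i = F j) ->
  avg K L e F = avg K L 0 F.
Proof.
move=> LK per; congr (_ / _); apply: eq_bigr => t _; apply: per.
by rewrite modnMDl mul0n add0n.
Qed.

Lemma rad_periodic K L k i j : (L <= k < K)%N ->
  (i = j %[mod 2 ^ (K - L)])%N -> rad K k i = rad K k j :> R.
Proof.
move=> Lk; have e : (2 ^ (K - L) = 2 ^ (k.+1 - L) * 2 ^ (K - k.+1))%N.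
  by rewrite -expnD; congr expn; lia.
have o x : odd (x %/ 2 ^ (K - k.+1)) = odd ((x %% 2 ^ (K - L)) %/ 2 ^ (K - k.+1)).
  rewrite {1}(divn_eq x (2 ^ (K - L))) e mulnA divnMDl ?expn_gt0// oddD oddM.
  by rewrite oddX subn_eq0 (_ : (k.+1 <= L)%N = false) ?andbF//; lia.
by rewrite /rad (o i) (o j) => ->.
Qed.

(* Abstract form of the functions g_s^j, sampled at level [K]: they are step
   functions of level [k s], depend only on the position inside the cell of
   level [L s], and are Rademacher functions on the upper half of that cell. *)
Record layers (K : nat) (L k N : nat -> nat) (kap : nat -> nat -> nat)
    (gd : nat -> nat -> nat -> R) (s0 : nat) : Prop := {
  lay_L : forall s, (s0 <= s)%N -> (L s < k s)%N;
  lay_k : forall s, (s0 <= s)%N -> (k s < L s.+1)%N;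
  lay_step : forall s j l c, (s0 <= s)%N -> (k s < K)%N -> (j < N s)%N ->
    step_in K l c (k s) (gd s j);
  lay_per : forall s j x y, (s0 <= s)%N -> (k s < K)%N -> (j < N s)%N ->
    (x = y %[mod 2 ^ (K - L s)])%N -> gd s j x = gd s j y;
  lay_half : forall s j x, (s0 <= s)%N -> (k s < K)%N -> (j < N s)%N ->
    odd (x %/ 2 ^ (K - (L s).+1)) -> gd s j x = rad K (kap s j) x;
  lay_kap : forall s j, (s0 <= s)%N -> (j < N s)%N -> (L s < kap s j < k s)%N;
  lay_kap_mono : forall s i j, (s0 <= s)%N -> (i < j < N s)%N ->
    (kap s i < kap s j)%N
}.

Section Layers.
Variables (K : nat) (L k N : nat -> nat) (kap : nat -> nat -> nat).
Variables (gd : nat -> nat -> nat -> R) (s0 : nat).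
Hypothesis lay : layers K L k N kap gd s0.

Definition layer (b : nat -> nat -> R) (c : nat -> R) s i : R :=
  \sum_(j < N s) b s j * gd s j i + c s * rad K (k s) i.

Variables (b : nat -> nat -> R) (c : nat -> R).

Lemma avg_char_layer s e : (s0 <= s)%N -> (k s < K)%N ->
  avg K (L s) e (fun i => cos (layer b c s i)) ^+ 2 +
  avg K (L s) e (fun i => sin (layer b c s i)) ^+ 2 <=
  (`|cos (c s)| * ((1 + \prod_(j < N s) `|cos (b s j)|) / 2)) ^+ 2.
Proof.
move=> s0s ksK; have Lk := lay_L lay s0s.
have st : step_in K (L s) e (k s) (fun i => \sum_(j < N s) b s j * gd s j i).
  by apply: step_in_sum => j _; apply: step_inZ; apply: (lay_step lay).
rewrite avg_cos_rad ?(ltnW Lk)// avg_sin_rad ?(ltnW Lk)//.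
rewrite ![(cos _ * _) ^+ 2]exprMn [leRHS]exprMn -mulrDr real_normK ?num_real//.
rewrite ler_wpM2l ?sqr_ge0//.
apply: (@avg_char_half _ K (L s) e _ (kap s) (b s)) => [|j jN|i j ijN|i ie].
- lia.
- by have := lay_kap lay s0s jN; lia.
- exact: (lay_kap_mono lay).
- apply: eq_bigr => j _; rewrite (lay_half lay)// ie /= mul2n odd_double//.
Qed.

Lemma layer_periodic s x y : (s0 <= s)%N -> (k s < K)%N ->
  (x = y %[mod 2 ^ (K - L s)])%N -> layer b c s x = layer b c s y.
Proof.
move=> s0s ksK xy; congr (_ + _ * _).
  by apply: eq_bigr => j _; congr (_ * _); exact: (lay_per lay).
by apply: (@rad_periodic _ (L s)) => //; have := lay_L lay s0s; lia.
Qed.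

Lemma layer_step s l e : (s0 <= s)%N -> (k s < K)%N ->
  step_in K l e (k s).+1 (layer b c s).
Proof.
move=> s0s ksK; apply: step_inD.
  apply: (step_in_mono (L := k s)); first lia.
  by apply: step_in_sum => j _; apply: step_inZ; apply: (lay_step lay).
by apply: step_inZ; apply: rad_step; lia.
Qed.

Lemma lay_mono s t : (s0 <= s < t)%N -> (k s < L t)%N.
Proof.
case/andP=> s0s; elim: t => // t IH; rewrite ltnS leq_eqVlt => /predU1P[<-|st].
  exact: (lay_k lay).
have := IH st; have tk : (s0 <= t)%N by lia.
have := lay_L lay tk; have := lay_k lay tk; lia.
Qed.

(** The layers before [s1] are constant on the cells of level [L s1], while layer [s1] depends only
    on the position inside such a cell. They are therefore independent and the moduli multiply. *)
Lemma avg_char_layers s1 l e : (s0 <= s1)%N -> (l <= L s0)%N ->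
  (forall s, (s0 <= s < s1)%N -> (k s < K)%N) ->
  avg K l e (fun i => cos (\sum_(s0 <= s < s1) layer b c s i)) ^+ 2 +
  avg K l e (fun i => sin (\sum_(s0 <= s < s1) layer b c s i)) ^+ 2 <=
  (\prod_(s0 <= s < s1)
     (`|cos (c s)| * ((1 + \prod_(j < N s) `|cos (b s j)|) / 2))) ^+ 2.
Proof.
elim: s1 => [|s1 IH] s01 lL kK.
  rewrite big_geq; last by lia.
  by rewrite expr1n; exact: avg_char_le1.
have [s01'|s01'] := leqP s0 s1; last first.
  rewrite big_geq; last by lia.
  by rewrite expr1n; exact: avg_char_le1.
have ks1 : (k s1 < K)%N by apply: kK; lia.
have lL1 : (l <= L s1)%N.
  move: s01'; rewrite leq_eqVlt => /predU1P[<-//|s01'].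
  have := lay_L lay (leqnn s0); have := @lay_mono s0 s1; lia.
have Lk1 := lay_L lay s01'.
rewrite big_nat_recr//= [leRHS]exprMn [leRHS]mulrC.
have -> : (fun i => cos (\sum_(s0 <= s < s1.+1) layer b c s i)) =
  (fun i => cos (\sum_(s0 <= s < s1) layer b c s i + layer b c s1 i)).
  by apply/funext => i; rewrite big_nat_recr.
have -> : (fun i => sin (\sum_(s0 <= s < s1.+1) layer b c s i)) =
  (fun i => sin (\sum_(s0 <= s < s1) layer b c s i + layer b c s1 i)).
  by apply/funext => i; rewrite big_nat_recr.
rewrite (@avg_char_add _ _ _ _ (L s1) _ _
  (avg K (L s1) 0 (fun i => cos (layer b c s1 i)))
  (avg K (L s1) 0 (fun i => sin (layer b c s1 i)))); first last.
- move=> f fe; split; apply: avg_periodic; [lia| |lia|].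
    by move=> i j ij; rewrite (layer_periodic (y := j)).
  by move=> i j ij; rewrite (layer_periodic (y := j)).
- move=> i j ie ij; rewrite !big_nat; apply: eq_bigr => s ss.
  have ksL : (k s < L s1)%N by apply: lay_mono; lia.
  apply: (@step_in_mono _ K l e (k s).+1 (L s1)) ie ij; first lia.
  by apply: layer_step; [lia | apply: kK; lia].
- lia.
apply: ler_pM; rewrite ?addr_ge0 ?sqr_ge0//; first exact: avg_char_layer.
by apply: IH => // s ss; apply: kK; lia.
Qed.

Lemma prod_inv1D_le (I : Type) (r : seq I) (P : pred I) (u : I -> R) :
  (forall i, P i -> 0 <= u i) ->
  \prod_(i <- r | P i) (1 + u i)^-1 <= (1 + \sum_(i <- r | P i) u i)^-1.
Proof.
move=> u0; pose Q (y x : R) := y <= (1 + x)^-1 /\ 0 <= x.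
suff [] : Q (\prod_(i <- r | P i) (1 + u i)^-1) (\sum_(i <- r | P i) u i) by [].
apply: big_rec2 => [|i x y Pi [yx x0]]; first by rewrite /Q addr0 invr1.
have ui := u0 i Pi; split; last by rewrite addr_ge0.
apply: (@le_trans _ _ ((1 + u i)^-1 * (1 + y)^-1)).
  by rewrite ler_wpM2l// invr_ge0 addr_ge0.
rewrite -invfM lef_pV2 ?posrE; nra.
Qed.

(** Averaging with the trivial bound 1 of the lower half weakens [V / 8] to [V / 32], which is
    legitimate as long as [V] stays bounded. *)
Lemma char_layer_le n (v : nat -> R) (w : R) :
  (forall j, (j < n)%N -> `|v j| <= 1) -> `|w| <= 1 ->
  \sum_(j < n) v j ^+ 2 <= 1 ->
  `|cos w| * ((1 + \prod_(j < n) `|cos (v j)|) / 2) <=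
  (1 + (\sum_(j < n) v j ^+ 2 + w ^+ 2) / 32)^-1.
Proof.
move=> v1 w1 V1; set V := \sum_(j < n) _ in V1 *.
have V0 : 0 <= V by apply: sumr_ge0 => j _; exact: sqr_ge0.
have w0 : 0 <= w ^+ 2 := sqr_ge0 w.
have PV : \prod_(j < n) `|cos (v j)| <= (1 + V / 8)^-1.
  apply: (@le_trans _ _ (\prod_(j < n) (1 + v j ^+ 2 / 8)^-1)).
    by apply: ler_prod => j _; rewrite normr_ge0 norm_cos_le// v1.
  rewrite (le_trans (prod_inv1D_le _ _))//; last by rewrite -mulr_suml.
  by move=> j _; rewrite mulr_ge0 ?sqr_ge0// invr_ge0.
have P2 : (1 + \prod_(j < n) `|cos (v j)|) / 2 <= (1 + V / 32)^-1.
  apply: (@le_trans _ _ ((1 + (1 + V / 8)^-1) / 2)); first by lra.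
  rewrite -[leRHS]mul1r ler_pdivlMr; last by lra.
  have : (1 + V / 8)^-1 * (1 + V / 8) = 1 by rewrite mulVf//; lra.
  have : 0 <= (1 + V / 8)^-1 by rewrite invr_ge0; lra.
  by move: (_^-1) => z; nra.
apply: (@le_trans _ _ ((1 + w ^+ 2 / 8)^-1 * (1 + V / 32)^-1)).
  apply: ler_pM => //; last exact: norm_cos_le.
  by rewrite mulr_ge0// addr_ge0// prodr_ge0.
rewrite -invfM lef_pV2 ?posrE; nra.
Qed.

Lemma layerZ (t : R) s i : t * layer b c s i =
  \sum_(j < N s) (t * b s j) * gd s j i + (t * c s) * rad K (k s) i.
Proof.
by rewrite /layer mulrDr mulr_sumr mulrA; congr (_ + _); apply: eq_bigr => j _; rewrite mulrA.
Qed.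

End Layers.

(** The factor [t] normalises the energy to 1, so the product of the layer bounds is at most
    [(1 + 1 / 32)^-1]. The shift [v] merely rotates the characteristic function. *)
Lemma avg_cos_layers K (L k N : nat -> nat) kap (gd : nat -> nat -> nat -> R) s0
    (b : nat -> nat -> R) (c : nat -> R) s1 l e (v t : R) :
  layers K L k N kap gd s0 ->
  (s0 <= s1)%N -> (l <= L s0)%N ->
  (forall s, (s0 <= s < s1)%N -> (k s < K)%N) ->
  t ^+ 2 * \sum_(s0 <= s < s1) (\sum_(j < N s) b s j ^+ 2 + c s ^+ 2) = 1 ->
  `|avg K l e (fun i => cos (v + t * \sum_(s0 <= s < s1) layer K k N gd b c s i))| <= 32 / 33.
Proof.
move=> lay s01 lL kK V1.
set tb := fun s j => t * b s j; set tc := fun s => t * c s.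
have {}V1 : \sum_(s0 <= s < s1) (\sum_(j < N s) tb s j ^+ 2 + tc s ^+ 2) = 1.
  rewrite -V1 mulr_sumr; apply: eq_bigr => s _; rewrite mulrDr mulr_sumr exprMn.
  by congr (_ + _); apply: eq_bigr => j _; rewrite exprMn.
have -> : (fun i => cos (v + t * \sum_(s0 <= s < s1) layer K k N gd b c s i)) =
  (fun i => cos (v + \sum_(s0 <= s < s1) layer K k N gd tb tc s i)).
  apply/funext => i; congr (cos (_ + _)); rewrite mulr_sumr; apply: eq_bigr => s _.
  exact: layerZ.
set T := fun i => \sum_(s0 <= s < s1) layer K k N gd tb tc s i.
have char : avg K l e (fun i => cos (T i)) ^+ 2 + avg K l e (fun i => sin (T i)) ^+ 2
    <= (32 / 33) ^+ 2.
  apply: (le_trans (avg_char_layers lay tb tc e s01 lL kK)).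
  have term0 s : 0 <= \sum_(j < N s) tb s j ^+ 2 + tc s ^+ 2.
    by rewrite addr_ge0 ?sumr_ge0 ?sqr_ge0// => j _; exact: sqr_ge0.
  have term1 s : (s0 <= s < s1)%N -> \sum_(j < N s) tb s j ^+ 2 + tc s ^+ 2 <= 1.
    move=> ss; rewrite -V1 (big_cat_nat (n := s)) /=; [|lia|lia].
    rewrite (big_ltn (m := s)) /=; last lia.
    by rewrite [leRHS]addrCA lerDl addr_ge0//; apply: sumr_ge0 => i _; exact: term0.
  have sq1 (x : R) : x ^+ 2 <= 1 -> `|x| <= 1.
    by move=> x1; rewrite -(@ler_pXn2r _ 2) ?nnegrE// expr1n real_normK ?num_real.
  rewrite ler_pXn2r ?nnegrE//; last first.
    by apply: prodr_ge0 => s _; rewrite mulr_ge0// mulr_ge0// addr_ge0// prodr_ge0.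
  apply: (@le_trans _ _ (\prod_(s0 <= s < s1)
      (1 + (\sum_(j < N s) tb s j ^+ 2 + tc s ^+ 2) / 32)^-1)); last first.
    rewrite (le_trans (prod_inv1D_le _ _))//.
      by move=> s _; rewrite mulr_ge0.
    by rewrite -mulr_suml V1 (_ : 1 + 1 / 32 = 33 / 32 :> R) ?invf_div//; field.
  rewrite !big_nat; apply: ler_prod => s ss.
  rewrite mulr_ge0 ?mulr_ge0 ?addr_ge0 ?prodr_ge0//=.
  have := term1 s ss; have w0 := sqr_ge0 (tc s); have := w0 => _ s1s.
  have V0 : 0 <= \sum_(j < N s) tb s j ^+ 2 by apply: sumr_ge0 => j _; exact: sqr_ge0.
  apply: char_layer_le => [j jN||]; last by lra.
    apply: sq1; apply: le_trans s1s; rewrite (bigD1 (Ordinal jN))//= -addrA lerDl.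
    by rewrite addr_ge0// sumr_ge0// => i _; exact: sqr_ge0.
  by apply: sq1; lra.
have -> : avg K l e (fun i => cos (v + T i)) =
    cos v * avg K l e (fun i => cos (T i)) - sin v * avg K l e (fun i => sin (T i)).
  by rewrite -!avgZ -avgB; apply: avg_ext => i _; rewrite cosD.
move: char; set A := avg _ _ _ _; set B := avg _ _ _ _ => AB.
rewrite -(@ler_pXn2r _ 2) ?nnegrE// real_normK ?num_real//; apply: le_trans AB.
rewrite -[leRHS]mulr1 -[X in _ <= _ * X](cos2Dsin2 v) -subr_ge0.
suff -> : (A ^+ 2 + B ^+ 2) * (cos v ^+ 2 + sin v ^+ 2) -
    (cos v * A - sin v * B) ^+ 2 = (sin v * A + cos v * B) ^+ 2 by exact: sqr_ge0.
by ring.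
Qed.

(** Average [1 + cos F], which is nonnegative everywhere and at least [2 - d ^+ 2 / 2] on [P]. A
    mean cosine away from 1 thus keeps [P] from filling the cell. *)
Lemma avg_small_le K l c (F : nat -> R) (P : pred nat) (r d : R) :
  (forall i, (i %/ 2 ^ (K - l) = c)%N -> P i -> `|F i| <= d) ->
  avg K l c (fun i => cos (F i)) <= r ->
  (2 - d ^+ 2 / 2) * avg K l c (fun i => (P i)%:R) <= 1 + r.
Proof.
move=> Pd Fr; rewrite -avgZ; apply: le_trans (lerD (lexx 1) Fr).
apply: (@le_trans _ _ (avg K l c ((fun=> 1) \+ (fun i => cos (F i))))); last first.
  by rewrite avgD avg_cst.
apply: avg_le => i ic /=.
case: (boolP (P i)) => Pi; last by rewrite mulr0; have := cos_geN1 (F i); lra.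
have := cos_ge_quadratic (F i); have := Pd i ic Pi => Fd.
have : F i ^+ 2 <= d ^+ 2.
  by rewrite -real_normK ?num_real// ler_pXn2r ?nnegrE ?(le_trans _ Fd).
by rewrite mulr1; lra.
Qed.

End CharacteristicFunctions.

(** * The discrete Menshov oscillation *)

Section DiscreteMenshov.
Context {R : realType}.

Lemma sum_sqr_CS (n : nat) (b : nat -> R) :
  (\sum_(i < n) `|b i|) ^+ 2 <= n%:R * \sum_(i < n) b i ^+ 2.
Proof.
elim: n => [|n IH]; first by rewrite !big_ord0 expr0n mul0r.
rewrite !big_ord_recr /= -natr1.
set S := \sum_(i < n) `|b i| in IH *; set Q := \sum_(i < n) b i ^+ 2 in IH *.
have S0 : 0 <= S by apply: sumr_ge0.
have n0 : 0 <= n%:R :> R by [].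
have Q0 : 0 <= Q by apply: sumr_ge0 => i _; exact: sqr_ge0.
rewrite -(@real_normK _ (b n)) ?num_real//; have := normr_ge0 (b n).
move: `|b n| (n%:R : R) n0 IH => x r r0 IH x0.
have : 2 * S * x <= Q + r * x ^+ 2.
  have [r1|r1] := eqVneq r 0.
    move: IH; rewrite r1 mul0r => S2; have -> : S = 0.
      by apply/eqP; rewrite -sqrf_eq0 eq_le sqr_ge0 S2.
    by rewrite mulr0 !mul0r addr0.
  have rp : 0 < r by rewrite lt_def r1.
  apply: (@le_trans _ _ (S ^+ 2 / r + r * x ^+ 2)).
    rewrite -subr_ge0 (_ : _ - _ = (S - r * x) ^+ 2 / r); last by field.
    by rewrite mulr_ge0 ?sqr_ge0// invr_ge0.
  by rewrite lerD2r ler_pdivrMr// mulrC.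
by nra.
Qed.

(** The term [d = 0] is harmless, since [0^-1 = 0]. *)
Lemma harmonic_pow2 k :
  k%:R / 2 <= \sum_(0 <= d < 2 ^ k) (d%:R : R)^-1 <= k%:R.
Proof.
elim: k => [|k IH]; first by rewrite expn0 big_nat1 invr0 mul0r lexx.
rewrite (@big_cat_nat _ _ _ (2 ^ k)) //=; last by rewrite leq_exp2l.
set h := \sum_(0 <= i < 2 ^ k) _ in IH *.
have p0 : 0 < (2 : R) ^+ k by rewrite exprn_gt0.
have lo : 1 / 2 <= \sum_(2 ^ k <= i < 2 ^ k.+1) (i%:R : R)^-1.
  apply: (@le_trans _ _ (\sum_(2 ^ k <= i < 2 ^ k.+1) (2 ^+ k.+1)^-1)).
    rewrite big_const_nat iter_addr_0 expnS mul2n -addnn addnK -[leRHS]mulr_natr natrX.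
    by rewrite exprS invfM -mulrA mulVf ?mulr1 ?gt_eqF// div1r.
  rewrite !big_nat; apply: ler_sum => i /andP[i1 i2].
  rewrite lef_pV2 ?posrE ?exprn_gt0// ?ltr0n; last by rewrite (leq_trans _ i1)// expn_gt0.
  by rewrite -natrX ler_nat ltnW.
have hi : \sum_(2 ^ k <= i < 2 ^ k.+1) (i%:R : R)^-1 <= 1.
  apply: (@le_trans _ _ (\sum_(2 ^ k <= i < 2 ^ k.+1) (2 ^+ k)^-1)).
    rewrite !big_nat; apply: ler_sum => i /andP[i1 i2].
    rewrite lef_pV2 ?posrE ?exprn_gt0// ?ltr0n; last by rewrite (leq_trans _ i1)// expn_gt0.
    by rewrite -natrX ler_nat.
  rewrite big_const_nat iter_addr_0 expnS mul2n -addnn addnK -[leLHS]mulr_natr natrX.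
  by rewrite mulVf ?gt_eqF.
by rewrite -natr1; lra.
Qed.

Variables (n N : nat).
Hypotheses (n_gt0 : (0 < n)%N) (NE : N = (2 ^ (2 * n))%N).
Let N_gt0 : (0 < N)%N. Proof. by rewrite NE expn_gt0. Qed.

(* [8 2^(-k/2)] times the jump of M_k between two points at distance 1. *)
Definition lam (N d : nat) : R :=
  if (0 < d < N)%N then d%:R^-1 + (N - d)%:R^-1 else 0.

Lemma lam_sym d : (d <= N)%N -> lam N (N - d) = lam N d.
Proof.
move=> dN; rewrite /lam; have [d0|d0] := posnP d; first by rewrite d0 subn0 !ltnn andbF.
have [->|dN'] := eqVneq d N; first by rewrite subnn !ltnn andbF.
by rewrite !ifT ?subKn// 1?addrC//; lia.
Qed.

Lemma lam_ge0 d : 0 <= lam N d.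
Proof. by rewrite /lam; case: ifP => // _; rewrite addr_ge0. Qed.

Definition lam_sum (N : nat) : R := \sum_(0 <= d < N) lam N d.
Local Notation H := (lam_sum N).

Lemma lam_sumE : H = 2 * \sum_(0 <= d < N) d%:R^-1.
Proof.
rewrite /lam_sum big_ltn// [in RHS]big_ltn// /lam ltnn invr0 /= !add0r.
rewrite (eq_big_nat _ _ (F2 := fun d => d%:R^-1 + (N - d)%:R^-1)); last first.
  by move=> d dN; rewrite ifT.
rewrite big_split /= mulr_natl mulr2n; congr (_ + _).
rewrite [LHS]big_nat_rev /= !big_nat; apply: eq_bigr => d dN; congr (_%:R^-1); lia.
Qed.

(** As [N = 2 ^ (2 * n)], the harmonic sum is of order [n]; this is what offsets the factor [1 / n]
    in [g_n^i]. *)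
Lemma lam_sum_bounds : 2 * n%:R <= H <= 4 * n%:R.
Proof.
rewrite lam_sumE; have := harmonic_pow2 (2 * n); rewrite -NE natrM; lra.
Qed.

(* The value at the [p]-th cell of [0, 1] minus the value at the [p]-th cell
   of [-1, 0] of M_{k,i}, up to the factor [2^(k/2) / 8]. *)
Definition slam (N p i : nat) : R := if (i <= p)%N then lam N (p.+1 - i) else - lam N (i - p.+1).
(** The signs of a head minus a tail of the block, cut exactly where [slam] changes sign, so that
    nothing cancels. *)
Definition sgn_le (p i : nat) : R := if (i <= p)%N then 1 else -1.
Definition wlam (N p i : nat) : R := if (i <= p)%N then lam N (p.+1 - i) else lam N (i - p.+1).

Lemma sgn_slam p i : sgn_le p i * slam N p i = wlam N p i.
Proof. by rewrite /sgn_le /slam /wlam; case: ifP; rewrite ?mul1r ?mulN1r ?opprK. Qed.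

Lemma wlam_ge0 p i : 0 <= wlam N p i.
Proof. by rewrite /wlam; case: ifP => _; exact: lam_ge0. Qed.

Lemma big_lam_tail a : (a <= N)%N ->
  \sum_(a <= d < N) lam N d = \sum_(0 <= d < N - a) lam N d.+1.
Proof.
move=> aN; have := big_addn 0 N a xpredT (lam N); rewrite add0n => ->.
rewrite big_nat_rev /= !big_nat.
by apply: eq_bigr => d dN; rewrite -lam_sym; [congr lam; lia | lia].
Qed.

(** By the reflection [d -> N - d], the two pieces together run once over one period. The same value
    for the sums over [i] in [sum_wlam_r] prepares the Schur test in [menshov_gain_sqr]. *)
Lemma sum_wlam_l i : (i < N)%N -> \sum_(p < N) wlam N p i = H.
Proof.
move=> iN; rewrite -(big_mkord xpredT (wlam N ^~ i)) (@big_cat_nat _ _ _ i)//=; last exact: ltnW.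
rewrite /lam_sum [RHS](@big_cat_nat _ _ _ i)//=; last exact: ltnW.
congr (_ + _).
  rewrite big_nat_rev /= !big_nat; apply: eq_bigr => d di.
  by rewrite /wlam ifF; [congr lam; lia | lia].
rewrite (big_lam_tail (ltnW iN)).
have := big_addn 0 N i xpredT (wlam N ^~ i); rewrite add0n => ->; rewrite !big_nat.
by apply: eq_bigr => d di; rewrite /wlam ifT; [congr lam; lia | lia].
Qed.

Lemma sum_wlam_split p (f : bool -> R -> R) : (p < N)%N ->
  \sum_(i < N) f (i <= p)%N (wlam N p i) =
  \sum_(0 <= d < p.+1) f true (lam N d.+1) + \sum_(0 <= d < N - p.+1) f false (lam N d).
Proof.
move=> pN; rewrite -(big_mkord xpredT (fun i => f (i <= p)%N (wlam N p i))).
rewrite (@big_cat_nat _ _ _ p.+1)//=; congr (_ + _).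
  rewrite big_nat_rev /= !big_nat; apply: eq_bigr => d di.
  have dp : (0 + p.+1 - d.+1 <= p)%N by lia.
  by rewrite /wlam dp; congr (f _ (lam _ _)); lia.
have := big_addn 0 N p.+1 xpredT (fun i => f (i <= p)%N (wlam N p i)).
rewrite add0n => ->; rewrite !big_nat; apply: eq_bigr => d di.
have dp : (d + p.+1 <= p)%N = false by lia.
by rewrite /wlam dp; congr (f _ (lam _ _)); lia.
Qed.

Lemma sum_wlam_r p : (p < N)%N -> \sum_(i < N) wlam N p i = H.
Proof.
move=> pN; rewrite (sum_wlam_split (fun _ x => x) pN) addrC.
rewrite /lam_sum [RHS](@big_cat_nat _ _ _ (N - p.+1))//=; last exact: leq_subr.
congr (_ + _); rewrite big_lam_tail ?leq_subr// subKn//.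
Qed.

(** Up to scale, the jump of the sum of all [g_n^j], which enters through the entries [- delta] of
    kappa. Here the signs of [slam] do cancel. *)
Definition slam_sum (N p : nat) : R := \sum_(i < N) slam N p i.

Lemma slam_sumE p : (p < N)%N ->
  slam_sum N p = \sum_(0 <= d < p.+2) lam N d - \sum_(0 <= d < N - p.+1) lam N d.
Proof.
move=> pN; have -> : slam_sum N p = \sum_(i < N) (if (i <= p)%N then 1 else -1) * wlam N p i.
  by apply: eq_bigr => i _; rewrite /slam /wlam; case: ifP; rewrite ?mul1r ?mulN1r.
rewrite (sum_wlam_split (fun (c : bool) x => (if c then 1 else -1) * x) pN).
congr (_ + _).
  rewrite [RHS]big_ltn// (_ : lam N 0 = 0)// add0r big_add1 /=.
  by apply: eq_bigr => d _; rewrite mul1r.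
by rewrite -sumrN; apply: eq_bigr => d _; rewrite mulN1r.
Qed.

Lemma slam_sum_le p : (p < N)%N -> `|slam_sum N p| <= H.
Proof.
move=> pN; apply: (le_trans (ler_norm_sum _ _ _)).
rewrite -(sum_wlam_r pN); apply: ler_sum => i _.
by rewrite /slam /wlam; case: ifP => _; rewrite ?normrN ger0_norm// lam_ge0.
Qed.

Lemma slam_sum_le_ind p : (p < N)%N ->
  `|slam_sum N p| <= \sum_(0 <= d < N) lam N d *
     (((d <= p.+1) && (N - p.+1 <= d))%N%:R + ((p.+1 < d) && (d < N - p.+1))%N%:R).
Proof.
move=> pN.
have E k : (k <= N.+1)%N -> \sum_(0 <= d < k) lam N d = \sum_(0 <= d < N) lam N d * (d < k)%N%:R.
  move=> kN; have [kN'|kN'] := leqP k N.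
    rewrite [RHS](@big_cat_nat _ _ _ k)//= [X in _ + X]big_nat [X in _ + X]big1 ?addr0.
      by rewrite !big_nat; apply: eq_bigr => d /= ->; rewrite mulr1.
    by move=> d kd; rewrite (_ : (d < k)%N = false) ?mulr0//; lia.
  have -> : k = N.+1 by lia.
  rewrite big_nat_recr//= [X in _ + X](_ : _ = 0) ?addr0; last by rewrite /lam ltnn andbF.
  rewrite !big_nat; apply: eq_bigr => d dN; rewrite (_ : (d < N.+1)%N = true) ?mulr1//; lia.
rewrite slam_sumE// E// (E (N - p.+1)%N); last by lia.
rewrite -sumrB (le_trans (ler_norm_sum _ _ _))// !big_nat ler_sum// => d dN.
rewrite -mulrBr normrM ger0_norm ?lam_ge0// ler_wpM2l ?lam_ge0//.
have -> : (p.+1 < d)%N = ~~ (d < p.+2)%N by rewrite -leqNgt.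
rewrite (leqNgt (N - p.+1) d) -(ltnS d p.+1); case: (d < p.+2)%N; case: (d < N - p.+1)%N;
  by rewrite /= ?mulr1n ?mulr0n ?subrr ?normr0 ?subr0 ?sub0r ?normrN ?normr1 ?addr0 ?add0r.
Qed.

Lemma sum_le_bool a k : (\sum_(p < k) (a <= p)%N = k - a)%N.
Proof. by elim: k => [|k IH]; rewrite ?big_ord0// big_ord_recr /= IH; lia. Qed.

Lemma sum_gt_bool a k : (\sum_(p < k) (p < a)%N <= a)%N.
Proof.
suff -> : (\sum_(p < k) (p < a)%N = minn k a)%N by rewrite geq_minr.
by elim: k => [|k IH]; rewrite ?big_ord0 ?min0n// big_ord_recr /= IH; lia.
Qed.

(** After the cancellation in [slam_sumE], the term [lam N d] survives only for O(min(d, N - d))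
    values of [p], which balances its size [1/d + 1/(N - d)]. So there is no logarithm on average
    over [p]. *)
Lemma sum_slam_sum : \sum_(p < N) `|slam_sum N p| <= 6 * N%:R.
Proof.
apply: (@le_trans _ _ (\sum_(p < N) \sum_(0 <= d < N) lam N d *
     (((d <= p.+1) && (N - p.+1 <= d))%N%:R + ((p.+1 < d) && (d < N - p.+1))%N%:R))).
  by apply: ler_sum => p _; exact: slam_sum_le_ind.
rewrite exchange_big /=; have -> : 6 * N%:R = \sum_(0 <= d < N) (6 : R).
  by rewrite big_const_nat subn0 iter_addr_0 -[RHS]mulr_natr.
rewrite !big_nat; apply: ler_sum => d /= dN; rewrite -mulr_sumr.
have [d0|d0] := posnP d; first by rewrite {1}/lam d0 ltnn mul0r.
rewrite big_split /=.
have nb (P : nat -> bool) : \sum_(i < N) (P i)%:R = (\sum_(i < N) P i)%N%:R :> R.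
  by rewrite natr_sum.
rewrite (nb (fun i => (d <= i.+1) && (N - i.+1 <= d))%N) (nb (fun i => (i.+1 < d) && (d < N - i.+1))%N).
set A := (\sum_(i < N) _)%N; set B := (\sum_(i < N) _)%N.
have A1 : (A <= d + 1)%N.
  apply: (@leq_trans (\sum_(p < N) (N - d - 1 <= p))%N); last by rewrite sum_le_bool; lia.
  by apply: leq_sum => p _; case: andP => // -[? ?]; rewrite (_ : (_ <= _)%N = true)//; lia.
have A2 : (A <= N - d + 1)%N.
  apply: (@leq_trans (\sum_(p < N) (d - 1 <= p))%N); last by rewrite sum_le_bool; lia.
  by apply: leq_sum => p _; case: andP => // -[? ?]; rewrite (_ : (_ <= _)%N = true)//; lia.
have B1 : (B <= d)%N.
  apply: leq_trans (sum_gt_bool d N).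
  by apply: leq_sum => p _; case: andP => // -[? ?]; rewrite (_ : (_ < _)%N = true)//; lia.
have B2 : (B <= N - d)%N.
  apply: leq_trans (sum_gt_bool (N - d) N).
  by apply: leq_sum => p _; case: andP => // -[? ?]; rewrite (_ : (_ < _)%N = true)//; lia.
rewrite /lam d0 dN mulrDl -natrD.
have inv (x y : nat) : (0 < x)%N -> (y <= 3 * x)%N -> x%:R^-1 * y%:R <= 3 :> R.
  by move=> x0 yx; rewrite mulrC ler_pdivrMr ?ltr0n// -natrM ler_nat.
have -> : 6 = 3 + 3 :> R by rewrite -natrD.
by apply: lerD; apply: inv; lia.
Qed.

Variables (b : nat -> R) (dl : R).
Hypothesis dl_bounds : 0 <= dl <= 2 / N%:R.

Let B2 := \sum_(i < N) b i ^+ 2.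
Let Bn := Num.sqrt B2.
Let A' p := \sum_(i < N) sgn_le p i * b i.
(** The jump of the signed sum of [b i] times [g^i] minus [dl] times the sum of all [g^j], without
    its scaling. [menshov_gain] restores the scaling except for the factor 2^(kap/2) of the
    scale. *)
Definition menshov_jump p : R := \sum_(i < N) b i * wlam N p i - dl * A' p * slam_sum N p.
Definition menshov_gain p : R := 2 ^+ n / (8 * n%:R) * menshov_jump p.

Let B2_ge0 : 0 <= B2. Proof. by apply: sumr_ge0 => i _; exact: sqr_ge0. Qed.
Let BnK : Bn ^+ 2 = B2. Proof. by rewrite sqr_sqrtr. Qed.
Let NR : N%:R = (2 ^+ n) ^+ 2 :> R.
Proof. by rewrite NE natrX mulnC exprM. Qed.
Let P2 : 0 < (2 : R) ^+ n. Proof. by rewrite exprn_gt0. Qed.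
Let nR : 1 <= n%:R :> R. Proof. by rewrite ler1n. Qed.

Let A'_le p : `|A' p| <= 2 ^+ n * Bn.
Proof.
have Bn0 : 0 <= Bn := sqrtr_ge0 _.
apply: (@le_trans _ _ (\sum_(i < N) `|b i|)).
  apply: (le_trans (ler_norm_sum _ _ _)); apply: ler_sum => i _.
  by rewrite normrM /sgn_le; case: ifP; rewrite ?normrN normr1 mul1r.
rewrite -(@ler_pXn2r _ 2) ?nnegrE ?sumr_ge0 ?mulr_ge0 ?(ltW P2)//.
by rewrite exprMn BnK -NR sum_sqr_CS.
Qed.

(** Summation over [p] turns each weight into [H >= 2 n], which cancels the [n] in the
    normalisation. The [dl] term remains an error of order [Bn / n] thanks to [sum_slam_sum]. *)
Lemma menshov_gain_mean :
  `|\sum_(i < N) b i| / (4 * 2 ^+ n) - 3 / 2 * Bn / n%:R <=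
  `|\sum_(p < N) menshov_gain p| / N%:R.
Proof.
have Bn0 : 0 <= Bn := sqrtr_ge0 _.
set s := \sum_(i < N) b i.
have S1 : \sum_(p < N) \sum_(i < N) b i * wlam N p i = H * s.
  rewrite exchange_big mulr_sumr /=; apply: eq_bigr => i _.
  by rewrite -mulr_sumr sum_wlam_l// mulrC.
have S2 : `|\sum_(p < N) dl * A' p * slam_sum N p| <= 12 * 2 ^+ n * Bn.
  apply: (le_trans (ler_norm_sum _ _ _)).
  apply: (@le_trans _ _ (\sum_(p < N) (2 / N%:R * (2 ^+ n * Bn)) * `|slam_sum N p|)).
    apply: ler_sum => p _; rewrite 2!normrM; apply: ler_wpM2r => //.
    by apply: ler_pM => //; rewrite ger0_norm; case/andP: dl_bounds.
  rewrite -mulr_sumr; apply: (@le_trans _ _ (2 / N%:R * (2 ^+ n * Bn) * (6 * N%:R))).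
    apply: ler_wpM2l; last exact: sum_slam_sum.
    by rewrite !mulr_ge0// ltW.
  have N0 : N%:R != 0 :> R by rewrite pnatr_eq0 -lt0n.
  by rewrite le_eqVlt; apply/orP; left; apply/eqP; field.
rewrite -mulr_sumr sumrB S1 normrM ger0_norm; last first.
  by rewrite divr_ge0 ?mulr_ge0// ltW.
set T := \sum_(p < N) _ in S2 *.
have /andP[H1 _] := lam_sum_bounds; have n1 := nR.
have HT : 2 * n%:R * `|s| - 12 * 2 ^+ n * Bn <= `|H * s - T|.
  have := lerB_dist (H * s) T; rewrite normrM ger0_norm; last by lra.
  have := ler_wpM2r (normr_ge0 s) H1; lra.
have c0 : 0 <= 2 ^+ n / (8 * n%:R) / N%:R :> R.
  by rewrite !divr_ge0 ?mulr_ge0// ltW.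
rewrite [leRHS]mulrAC; apply: le_trans (ler_wpM2l c0 HT).
rewrite le_eqVlt; apply/orP; left; apply/eqP; rewrite NR; field.
by rewrite !gt_eqF//; lra.
Qed.

(** Schur's test: row and column sums equal to [H] bound the norm of the matrix [wlam] by
    [H <= 4 n]. For the correction term the pointwise bound is enough, because [dl <= 2 / N]. *)
Lemma menshov_gain_sqr : (\sum_(p < N) menshov_gain p ^+ 2) / N%:R <= 3 * B2.
Proof.
have Bn0 : 0 <= Bn := sqrtr_ge0 _.
have /andP[H1 H2] := lam_sum_bounds; have n1 := nR.
have S1 : \sum_(p < N) (\sum_(i < N) b i * wlam N p i) ^+ 2 <= H ^+ 2 * B2.
  apply: (@le_trans _ _ (\sum_(p < N) H * \sum_(i < N) b i ^+ 2 * wlam N p i)).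
    apply: ler_sum => p _; rewrite -(sum_wlam_r (ltn_ord p)).
    (* Cauchy-Schwarz with weights *)
    set W := \sum_(i < N) wlam N p i; set x := \sum_(i < N) b i * wlam N p i.
    have W0 : 0 < W by rewrite /W sum_wlam_r//; lra.
    have : 0 <= \sum_(i < N) wlam N p i * (b i - x / W) ^+ 2.
      by apply: sumr_ge0 => i _; rewrite mulr_ge0 ?sqr_ge0 ?wlam_ge0.
    rewrite (eq_bigr (fun i : 'I_N => b i ^+ 2 * wlam N p i -
        2 * (x / W) * (b i * wlam N p i) + (x / W) ^+ 2 * wlam N p i)); last first.
      by move=> i _; ring.
    rewrite big_split /= sumrB -!mulr_sumr -/x -/W => h.
    rewrite -ler_pdivrMl//; rewrite -subr_ge0; apply: le_trans h _.
    rewrite le_eqVlt; apply/orP; left; apply/eqP; field; rewrite gt_eqF//.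
  rewrite -mulr_sumr exchange_big /= expr2 -mulrA ler_wpM2l//; first lra.
  rewrite mulr_sumr; apply: ler_sum => i _; rewrite -mulr_sumr sum_wlam_l//.
  by rewrite mulrC.
have S2 : \sum_(p < N) (dl * A' p * slam_sum N p) ^+ 2 <= 64 * n%:R ^+ 2 * B2.
  apply: (@le_trans _ _ (\sum_(p < N) (2 / N%:R * (2 ^+ n * Bn) * (4 * n%:R)) ^+ 2)).
    apply: ler_sum => p _; rewrite -real_normK ?num_real// ler_pXn2r ?nnegrE//; last first.
      by rewrite !mulr_ge0// ltW.
    rewrite 2!normrM; apply: ler_pM => //; last by rewrite (le_trans (slam_sum_le _)).
    by apply: ler_pM => //; rewrite ger0_norm; case/andP: dl_bounds.
  rewrite sumr_const card_ord -[_ *+ N]mulr_natr -BnK NR.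
  rewrite le_eqVlt; apply/orP; left; apply/eqP; field; rewrite gt_eqF//.
have n0 : n%:R != 0 :> R by rewrite gt_eqF//; lra.
rewrite ler_pdivrMr ?ltr0n//.
apply: (@le_trans _ _ (\sum_(p < N) (2 ^+ n / (8 * n%:R)) ^+ 2 * (2 *
   ((\sum_(i < N) b i * wlam N p i) ^+ 2 + (dl * A' p * slam_sum N p) ^+ 2)))).
  apply: ler_sum => p _; rewrite /menshov_gain exprMn ler_wpM2l ?sqr_ge0//.
  rewrite /menshov_jump; set x := \sum_(i < N) _; set y := _ * slam_sum N p.
  by have := sqr_ge0 (x + y); nra.
rewrite -!mulr_sumr big_split /=.
apply: (@le_trans _ _ ((2 ^+ n / (8 * n%:R)) ^+ 2 * (2 * (H ^+ 2 * B2 + 64 * n%:R ^+ 2 * B2)))).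
  by rewrite ler_wpM2l ?sqr_ge0// ler_pM2l// lerD.
apply: (@le_trans _ _ ((2 ^+ n / (8 * n%:R)) ^+ 2 *
    (2 * ((4 * n%:R) ^+ 2 * B2 + 64 * n%:R ^+ 2 * B2)))).
  rewrite ler_wpM2l ?sqr_ge0// ler_pM2l// lerD2r ler_wpM2r//.
  by rewrite ler_pXn2r ?nnegrE//; lra.
rewrite NR -subr_ge0 (_ : _ - _ = 2^-1 * B2 * (2 ^+ n) ^+ 2); last by field.
by rewrite !mulr_ge0 ?sqr_ge0// invr_ge0.
Qed.

(** A Paley-Zygmund argument: a lower bound for the mean and an upper bound for the second moment
    leave a definite share after truncation at 1. The weight [tau] is the natural choice when
    averaging the pointwise inequality [pw]. *)
Lemma menshov_gain_min (y : R) : 0 <= y ->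
  y <= `|\sum_(i < N) b i| / (4 * 2 ^+ n) - 3 / 2 * Bn / n%:R ->
  y ^+ 2 / (1 + 3 * B2) <=
  (\sum_(p < N) Num.min (menshov_gain p ^+ 2) 1) / N%:R.
Proof.
rewrite le_eqVlt => /predU1P[<- _|y0 /le_trans/(_ menshov_gain_mean) yX].
  rewrite expr0n mul0r divr_ge0// sumr_ge0// => p _.
  by rewrite le_min sqr_ge0 ler01.
have N0 : 0 < N%:R :> R by rewrite ltr0n.
set Q := 1 + 3 * B2; have Q0 : 0 < Q by rewrite /Q; have := B2_ge0; lra.
pose tau := y / Q; have tau0 : 0 < tau by rewrite divr_gt0.
have pw x : `|x| <= Num.min (x ^+ 2) 1 / (2 * tau) + tau * (1 + x ^+ 2) / 2.
  rewrite -[x ^+ 2]real_normK ?num_real//; have := normr_ge0 x; move: `|x| => {}x x0.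
  rewrite -subr_ge0; have [x1|x1] := leP (x ^+ 2) 1.
    rewrite (_ : _ - _ = ((x - tau) ^+ 2 + tau ^+ 2 * x ^+ 2) / (2 * tau)); last first.
      by field; rewrite gt_eqF.
    apply: divr_ge0; last by rewrite mulr_ge0 ?(ltW tau0).
    by rewrite addr_ge0 ?sqr_ge0// -exprMn sqr_ge0.
  rewrite (_ : _ - _ = ((1 - tau * x) ^+ 2 + tau ^+ 2) / (2 * tau)); last first.
    by field; rewrite gt_eqF.
  by apply: divr_ge0; [rewrite addr_ge0 ?sqr_ge0|rewrite mulr_ge0 ?(ltW tau0)].
have : y <= (\sum_(p < N) Num.min (menshov_gain p ^+ 2) 1) / N%:R / (2 * tau) + tau * Q / 2.
  apply: (le_trans yX).
  apply: (@le_trans _ _ ((\sum_(p < N) (Num.min (menshov_gain p ^+ 2) 1 / (2 * tau) +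
      tau * (1 + menshov_gain p ^+ 2) / 2)) / N%:R)).
    rewrite ler_pM2r ?invr_gt0// (le_trans (ler_norm_sum _ _ _))//.
    by apply: ler_sum => p _; exact: pw.
  set A := \sum_(p < N) Num.min _ _.
  have S2 : \sum_(p < N) tau * (1 + menshov_gain p ^+ 2) / 2 =
      tau / 2 * (N%:R + \sum_(p < N) menshov_gain p ^+ 2).
    transitivity (\sum_(p < N) tau / 2 * (1 + menshov_gain p ^+ 2)).
      by apply: eq_bigr => p _; field.
    by rewrite -mulr_sumr big_split /= sumr_const card_ord.
  rewrite big_split /= S2 -mulr_suml -/A.
  have -> : (A / (2 * tau) + tau / 2 * (N%:R + \sum_(p < N) menshov_gain p ^+ 2)) / N%:R =
      A / N%:R / (2 * tau) + tau / 2 * (1 + (\sum_(p < N) menshov_gain p ^+ 2) / N%:R).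
    by field; rewrite !gt_eqF.
  rewrite lerD2l [leRHS]mulrAC; apply: ler_wpM2l; first by rewrite divr_ge0 ?(ltW tau0).
  by rewrite lerD2l menshov_gain_sqr.
set Z := _ / N%:R => yZ.
have tQ : tau * Q = y by rewrite /tau divfK ?gt_eqF.
rewrite tQ in yZ.
have -> : y ^+ 2 / Q = y / 2 * (2 * tau) by rewrite /tau; field; rewrite gt_eqF.
rewrite -ler_pdivlMr ?mulr_gt0 ?invr_gt0//; move: yZ; move: (Z / _) => w; lra.
Qed.

End DiscreteMenshov.

(** * Sampling at generic points *)

Section GenericPoints.
Context {R : realType}.
Implicit Types (z x y : R) (K i l : nat) (Z : set R).

Definition pt z K i : R := (i%:R + z) / 2 ^+ K.

(** The translates are by integers, not only by naturals, because Menshov functions are also sampled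
    at [pt z d q - 1]. *)
Definition generic Z z : Prop :=
  0 < z < 1 /\ forall (q : int) (d : nat), ~ Z ((q%:~R + z) / 2 ^+ d).

Let pow2gt0 d : 0 < (2 : R) ^+ d. Proof. by rewrite exprn_gt0. Qed.
Let pow2neq0 d : (2 : R) ^+ d != 0. Proof. by rewrite gt_eqF. Qed.
Hint Resolve pow2gt0 pow2neq0 : core.

Lemma exists_generic Z : countable Z -> exists z, generic Z z.
Proof.
move=> cZ; pose B := \bigcup_(q : int) \bigcup_(d : nat) ((fun y : R => 2 ^+ d * y - q%:~R) @` Z).
have cB : countable B.
  apply: bigcup_countable => [|q _]; first exact: countableP.
  apply: bigcup_countable => [|d _]; first exact: countableP.
  by apply: sub_countable cZ; exact: card_image_le.
have : exists2 z, 0 < z < 1 & ~ B z.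
  apply: contrapT => noz.
  have sub : `]0%R, 1%R[%classic `<=` B.
    move=> z /=; rewrite in_itv /= => z01; apply: contrapT => Bz; apply: noz; by exists z.
  have : (lebesgue_measure (`]0%R, 1%R[%classic : set R) <= lebesgue_measure B)%E.
    apply: le_measure => //; rewrite ?inE//.
    by apply: countable_measurable => // t; exact: measurable_set1.
  rewrite (countable_lebesgue_measure0 cB) lebesgue_measure_itv /= lte_fin ltr01.
  by rewrite sube0 lee_fin; lra.
move=> [z z01 Bz]; exists z; split=> // q d Zq; apply: Bz.
exists q => //; exists d => //; exists ((q%:~R + z) / 2 ^+ d) => //.
by rewrite mulrC divfK// addrC addKr.
Qed.

Lemma generic_pt Z z K i : generic Z z -> ~ Z (pt z K i).
Proof. by move=> [_ /(_ i%:Z K)]. Qed.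

Definition step_off Z l (F : R -> R) : Prop := forall i x y, (i < 2 ^ l)%N ->
    i%:R / 2 ^+ l < x < i.+1%:R / 2 ^+ l -> i%:R / 2 ^+ l < y < i.+1%:R / 2 ^+ l ->
    ~ Z x -> ~ Z y -> F x = F y.

(** One countable set serves all levels: a candidate constant is fixed on each cell of each level,
    and its exceptional set is collected only when finite. *)
Lemma dyadic_step_exc (F : R -> R) : exists Z : set R, countable Z /\
  forall l, dyadic_step 0 1 l F -> step_off Z l F.
Proof.
pose I l i : set R := `]i%:R / 2 ^+ l, i.+1%:R / 2 ^+ l[%classic.
have /choice[c cP] : forall li : nat * nat, exists c : R,
    (exists c', eq_upto_finite (I li.1 li.2) F (fun=> c')) ->
    eq_upto_finite (I li.1 li.2) F (fun=> c).
  move=> li; have [[c' c'P]|nc] := pselect (exists c', eq_upto_finite (I li.1 li.2) F (fun=> c')).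
    by exists c'.
  by exists 0 => /nc.
pose A li : set R := [set x | I li.1 li.2 x /\ F x <> c li].
exists (\bigcup_(li in [set li | finite_set (A li)]) A li); split.
  by apply: bigcup_countable => [|li fA]; [exact: countableP|exact: finite_set_countable].
move=> l stF i x y il xi yi Zx Zy.
have fA : finite_set (A (l, i)).
  apply: (cP (l, i)); have [c' c'P] := stF i il; exists c'.
  by move: c'P; rewrite /eq_upto_finite /I /= !add0r !subr0 !mul1r.
have Fc w : i%:R / 2 ^+ l < w < i.+1%:R / 2 ^+ l ->
    ~ (\bigcup_(li in [set li | finite_set (A li)]) A li) w -> F w = c (l, i).
  move=> wi Zw; apply: contrapT => Fw; apply: Zw.
  have Aw : A (l, i) w by split; [rewrite /I /= in_itv | exact: Fw].
  by exists (l, i).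
exact: etrans (Fc x xi Zx) (esym (Fc y yi Zy)).
Qed.

Lemma dyadic_step_excs (F : nat -> R -> R) : exists Z : set R, countable Z /\
  forall n l, dyadic_step 0 1 l (F n) -> step_off Z l (F n).
Proof.
have /choice[Z ZP] := fun n => dyadic_step_exc (F n).
exists (\bigcup_n Z n); split.
  by apply: bigcup_countable => // n _; have [] := ZP n.
move=> n l sF i x y il xi yi Zx Zy; have [_ /(_ l sF i x y)] := ZP n; apply => // Zn.
- by apply: Zx; exists n.
- by apply: Zy; exists n.
Qed.

Section Point.
Variables (z : R) (z01 : 0 < z < 1).

Lemma pt_cell K l i : (l <= K)%N ->
  (i %/ 2 ^ (K - l))%N%:R / 2 ^+ l < pt z K i < (i %/ 2 ^ (K - l)).+1%:R / 2 ^+ l.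
Proof.
move=> lK; set c := (i %/ 2 ^ (K - l))%N; have /andP[z0 z1] := z01; rewrite /pt.
have -> : (2 : R) ^+ K = 2 ^+ (K - l) * 2 ^+ l by rewrite -exprD subnK.
rewrite invfM mulrA !ltr_pM2r ?invr_gt0// ltr_pdivlMr// ltr_pdivrMr//.
have i1 : (c * 2 ^ (K - l) <= i)%N by exact: leq_trunc_div.
have i2 : (i.+1 <= c.+1 * 2 ^ (K - l))%N by rewrite ltn_ceil// expn_gt0.
move: i1 i2; rewrite -!(ler_nat R) !natrM natrX -!natr1; lra.
Qed.

Lemma pt_gt0 K i : 0 < pt z K i.
Proof. by have /andP[z0 z1] := z01; rewrite divr_gt0// ltr_wpDl. Qed.

Lemma pt_lt1 K i : (i < 2 ^ K)%N -> pt z K i < 1.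
Proof.
move=> iK; have /andP[z0 z1] := z01; rewrite ltr_pdivrMr// mul1r.
by move: iK; rewrite -(ler_nat R) natrX -natr1; lra.
Qed.

Lemma floor_pt d i : Num.floor (pt z d i) = (i %/ 2 ^ d)%N%:Z.
Proof.
apply: floor_def; have := pt_cell i (leq0n d); rewrite subn0 expr0 !divr1.
by rewrite rmorphD /= rmorph1 natr1 => /andP[/ltW -> ->].
Qed.

Lemma pt_modn d i : pt z d i - (i %/ 2 ^ d)%:R = pt z d (i %% 2 ^ d).
Proof.
rewrite /pt {1}(divn_eq i (2 ^ d)) natrD natrM natrX; field; exact: pow2neq0.
Qed.

Lemma pt_shift K L i : (L <= K)%N -> 2 ^+ L * pt z K i = pt z (K - L) i.
Proof.
move=> LK; rewrite /pt; have -> : (2 : R) ^+ K = 2 ^+ (K - L) * 2 ^+ L by rewrite -exprD subnK.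
by field; rewrite !pow2neq0.
Qed.

Lemma rademacher_pt K k i : (k < K)%N -> rademacher k (pt z K i) = rad K k i.
Proof.
move=> kK; rewrite /rademacher mulrAC pt_shift// /rad.
set d := (K - k.+1)%N; have := pt_modn d i; set c := (i %/ 2 ^ d)%N => e.
have -> : pt z d i * pi = pt z d (i %% 2 ^ d) * pi + pi *+ c.
  by rewrite -e mulrBl -[pi *+ c]mulr_natl subrK.
rewrite (alternatingn (@sinDpi R)).
have s0 : 0 < sin (pt z d (i %% 2 ^ d) * pi).
  have p0 := @pi_gt0 R; apply: sin_gt0_pi; rewrite mulr_gt0 ?pt_gt0//=.
  by rewrite -[ltRHS]mul1r ltr_pM2r// pt_lt1// ltn_mod expn_gt0.
rewrite -signr_odd; case: (odd c); rewrite ?expr1 ?expr0 ?mul1r ?mulN1r.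
  by rewrite sgrN gtr0_sg.
by rewrite gtr0_sg.
Qed.

End Point.

Lemma step_pt Z (F : R -> R) l z K i j :
  step_off Z l F -> generic Z z -> (l <= K)%N -> (i < 2 ^ K)%N ->
  (i %/ 2 ^ (K - l) = j %/ 2 ^ (K - l))%N ->
  F (pt z K i) = F (pt z K j).
Proof.
move=> sF gz lK iK ij; have z01 := gz.1.
apply: (sF (i %/ 2 ^ (K - l))%N); [|exact: pt_cell|rewrite ij; exact: pt_cell| exact: generic_pt..].
by rewrite ltn_divLR ?expn_gt0// -expnD subnKC.
Qed.

Lemma menshov_cell k (t : int) (w : R) : 0 < w < 1 ->
  - (2 ^+ k) < t <= 2 ^+ k ->
  menshov k ((t%:~R - 1 + w) / 2 ^+ k) =
  if (1 <= `|t|) && (`|t| <= 2 ^+ k - 1) then 2 `^ (k%:R / 2) / (8 * t%:~R) else 0 :> R.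
Proof.
move=> /andP[w0 w1] /andP[t1 t2].
have t1' : - 2 ^+ k + 1 <= (t%:~R : R).
  have : (- 2 ^+ k + 1 <= t)%R by lia.
  by rewrite -(ler_int R) rmorphD rmorphN rmorphXn /= rmorph1.
have t2' : (t%:~R : R) <= 2 ^+ k by move: t2; rewrite -(ler_int R) rmorphXn.
have P0 := pow2gt0 k.
rewrite /menshov /periodize.
have -> : Num.floor (((t%:~R - 1 + w) / 2 ^+ k - -1) / 2 : R) = 0.
  apply: floor_def; rewrite add0r; apply/andP; split.
    rewrite divr_ge0// subr_ge0 ler_pdivlMr//; lra.
  rewrite ltr_pdivrMr// ltrBlDr ltr_pdivrMr//; lra.
rewrite mulr0 subr0 [2 ^+ k * _]mulrC divfK//.
have -> : Num.floor (t%:~R - 1 + w : R) = t - 1.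
  by apply: floor_def; rewrite subrK rmorphB /= rmorph1; lra.
by rewrite subrK.
Qed.

Lemma menshov_cell2 k (t : int) (w : R) : 0 < w < 1 ->
  - (2 ^+ k) *+ 3 < t <= - (2 ^+ k) ->
  menshov k ((t%:~R - 1 + w) / 2 ^+ k) =
  menshov k (((t + 2 ^+ k *+ 2)%:~R - 1 + w) / 2 ^+ k) :> R.
Proof.
move=> /andP[w0 w1] /andP[t1 t2].
have P0 := pow2gt0 k; rewrite /menshov /periodize.
have e : ((t + 2 ^+ k *+ 2)%:~R : R) = t%:~R + 2 ^+ k *+ 2 by rewrite rmorphD rmorphMn rmorphXn.
have t1' : - 2 ^+ k *+ 3 + 1 <= (t%:~R : R).
  have : (- 2 ^+ k *+ 3 + 1 <= t)%R by lia.
  by rewrite -(ler_int R) rmorphD rmorphMn rmorphN rmorphXn /= rmorph1.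
have t2' : (t%:~R : R) <= - 2 ^+ k by move: t2; rewrite -(ler_int R) rmorphN rmorphXn.
have -> : Num.floor (((t%:~R - 1 + w) / 2 ^+ k - -1) / 2 : R) = -1.
  apply: floor_def; rewrite addNr; apply/andP; split.
    rewrite ler_pdivlMr// lerBrDr ler_pdivlMr//; lra.
  rewrite ltr_pdivrMr// ltrBlDr ltr_pdivrMr//; lra.
have -> : Num.floor ((((t + 2 ^+ k *+ 2)%:~R - 1 + w) / 2 ^+ k - -1) / 2 : R) = 0.
  rewrite e; apply: floor_def; rewrite add0r; apply/andP; split.
    rewrite divr_ge0// subr_ge0 ler_pdivlMr//; lra.
  rewrite ltr_pdivrMr// ltrBlDr ltr_pdivrMr//; lra.
have -> : (t%:~R - 1 + w) / 2 ^+ k - 2 * (-1)%:~R = ((t + 2 ^+ k *+ 2)%:~R - 1 + w) / 2 ^+ k - 2 * 0%:~R :> R.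
  by rewrite e; field.
by [].
Qed.

(** Two points at distance 1 lie on opposite sides of the singularity of [1/i], for [i > p] after a
    shift by the period 2. Their values have opposite signs, so the reciprocals add up; in the
    border cases both values are 0, as [lam] is. *)
Lemma menshov_shift_jump n p i (w : R) : 0 < w < 1 ->
  (p < 2 ^ n)%N -> (i < 2 ^ n)%N ->
  menshov_shift n i ((p%:R + w) / 2 ^+ n) -
  menshov_shift n i ((p%:R + w) / 2 ^+ n - 1) =
  2 `^ (n%:R / 2) / 8 * slam (2 ^ n) p i :> R.
Proof.
move=> w01 pn i_n; rewrite /menshov_shift.
set N := (2 ^ n)%N in pn i_n *.
have NZ : (2 : int) ^+ n = N%:Z by rewrite -natrX natz.
have NR : (2 : R) ^+ n = N%:R by rewrite natrX.
have N0 : N%:R != 0 :> R by rewrite pnatr_eq0 -lt0n expn_gt0.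
have e1 : (p%:R + w) / 2 ^+ n - i%:R * 2 ^- n =
    ((p%:Z - i%:Z + 1)%:~R - 1 + w) / 2 ^+ n :> R.
  by rewrite rmorphD rmorphB /=; field; rewrite NR.
have e2 : (p%:R + w) / 2 ^+ n - 1 - i%:R * 2 ^- n =
    ((p%:Z - i%:Z + 1 - N%:Z)%:~R - 1 + w) / 2 ^+ n :> R.
  by rewrite rmorphB rmorphD rmorphB /= NR; field.
rewrite e1 e2 menshov_cell// ?NZ; last by lia.
rewrite /slam /lam; case: (leqP i p) => ip.
  rewrite menshov_cell// ?NZ; last by lia.
  have [d dE] : exists d, p.+1 = (i + d.+1)%N by exists (p - i)%N; lia.
  have -> : (p.+1 - i)%N = d.+1 by lia.
  have -> : p%:Z - i%:Z + 1 = d.+1%:Z by lia.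
  have [dN|dN] := eqVneq d.+1 N.
    by rewrite dN ltnn andbF !ifF ?subrr ?mulr0//; lia.
  rewrite !ifT; [|lia..].
  have -> : (d.+1%:Z - N%:Z)%:~R = - (N - d.+1)%:R :> R.
    by rewrite natrB ?rmorphB ?opprB//=; lia.
  have a0 : (d.+1%:R : R) != 0 by rewrite pnatr_eq0.
  have b0 : ((N - d.+1)%:R : R) != 0 by rewrite pnatr_eq0; lia.
  rewrite -!pmulrn; move: (d.+1%:R : R) ((N - d.+1)%:R : R) a0 b0 => a b a0 b0.
  by field; rewrite ?oppr_eq0 a0 ?b0.
rewrite menshov_cell2// ?NZ; last by lia.
rewrite menshov_cell// ?NZ; last by lia.
have [d dE] : exists d, i = (p.+1 + d)%N by exists (i - p.+1)%N; lia.
have -> : (i - p.+1)%N = d by lia.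
have -> : p%:Z - i%:Z + 1 = - d%:Z by lia.
have -> : - d%:Z - N%:Z + N%:Z *+ 2 = (N - d)%:Z by lia.
have [->|d0] := posnP d.
  by rewrite /= !ifF ?subr0 ?oppr0 ?mulr0//; lia.
rewrite !ifT; [|lia..].
have a0 : (d%:R : R) != 0 by rewrite pnatr_eq0; lia.
have b0 : ((N - d)%:R : R) != 0 by rewrite pnatr_eq0; lia.
rewrite rmorphN /= -!pmulrn; move: (d%:R : R) ((N - d)%:R : R) a0 b0 => a b a0 b0.
by field; rewrite ?oppr_eq0 a0 ?b0.
Qed.

End GenericPoints.

(** * The functions g_s^j at sample points *)

Section LayerFunctions.
Context {R : realType}.
Variables (f : nat -> nat -> R -> R) (k : nat -> nat) (Z : set R) (z : R).
Hypothesis gz : generic Z z.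
Hypothesis Zf : forall n i u, (2 <= n)%N -> (i < 2 ^ n)%N -> -1 <= u <= 1 -> ~ Z u ->
  f n i u = menshov_shift n i u.
Hypothesis Zg : forall s j, (1 <= s)%N -> (j < 2 ^ (2 * s))%N -> step_off Z (k s) (g f k s j).

Let z01 : 0 < z < 1 := gz.1.
Let pow2gt0 d : 0 < (2 : R) ^+ d. Proof. by rewrite exprn_gt0. Qed.
Let pow2neq0 d : (2 : R) ^+ d != 0. Proof. by rewrite gt_eqF. Qed.

(** [g_s^j] repeats itself on the cells of this level. On their upper halves it is the Rademacher
    function of index [gkap s j], the dilation having raised the index by [glevel s]. *)
Definition glevel s := (k s.-1 + 2 * s ^ 2 + 2)%N.
Definition gkap s j := (glevel s + (k s.-1 + 4 + j))%N.
Definition gval K s j i : R := g f k s j (pt z K i).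

Lemma g_pt s j K i : (2 <= s)%N -> (glevel s <= K)%N ->
  gval K s j i = g_hat f (k s.-1) s j (pt z (K - glevel s) (i %% 2 ^ (K - glevel s))).
Proof.
move=> s2 LK; rewrite /gval /g ifF; last by lia.
rewrite /periodize -/(glevel s) pt_shift// subr0 divr1 mul1r floor_pt//.
by rewrite -pmulrn pt_modn.
Qed.

Lemma g_half s j K i : (2 <= s)%N -> (gkap s j < K)%N ->
  odd (i %/ 2 ^ (K - (glevel s).+1)) -> gval K s j i = rad K (gkap s j) i.
Proof.
move=> s2 kK oi; have LK : (glevel s < K)%N by move: kK; rewrite /gkap; lia.
rewrite g_pt ?(ltnW LK)//; set d := (K - glevel s)%N; set t := (i %% 2 ^ d)%N.
have dK : (K - (glevel s).+1)%N = d.-1 by rewrite /d; lia.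
have e2 : (2 ^ d = 2 * 2 ^ d.-1)%N by rewrite -expnS prednK// /d; lia.
have ht : (2 ^ d.-1 <= t)%N.
  have : (t %/ 2 ^ d.-1)%N = 1%N.
    by rewrite /t e2 -modn_divl modn2 -dK oi.
  by move=> t1; have := leq_trunc_div t (2 ^ d.-1); rewrite t1 mul1n.
have y2 : 1 / 2 < pt z d t.
  have := pt_cell z01 t (_ : (1 <= d)%N); rewrite /d subn_gt0 LK => /(_ isT) /andP[+ _].
  rewrite -/d expr1; apply: le_lt_trans; rewrite ler_pM2r ?invr_gt0// ler1n.
  by rewrite divn_gt0 ?expn_gt0// subn1.
rewrite /g_hat ifF; last first.
  apply: negbTE; rewrite -ltNge; apply: le_lt_trans y2; rewrite div1r lef_pV2 ?posrE//.
  rewrite -[leLHS]expr1; apply: ler_weXn2l; first by rewrite ler1n.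
  by rewrite muln_gt0 expn_gt0; lia.
rewrite ifF; last by apply: negbTE; rewrite -ltNge.
have ltd : (k s.-1 + 4 + j < d)%N by rewrite /d ltn_subRL.
rewrite (rademacher_pt z01 _ ltd).
rewrite (@rad_periodic _ K (glevel s) (gkap s j) i t); [|rewrite /gkap; lia|by rewrite /t modn_mod].
rewrite /rad /gkap; congr (if odd (_ %/ 2 ^ _) then _ else _).
by rewrite /d; clear; lia.
Qed.

Lemma g_periodic s j K x y : (2 <= s)%N -> (glevel s <= K)%N ->
  (x = y %[mod 2 ^ (K - glevel s)])%N -> gval K s j x = gval K s j y.
Proof. by move=> s2 LK xy; rewrite !g_pt// xy. Qed.

Lemma lt_pow2_div a b e : (a <= b)%N -> (0 < e <= 2 ^ a)%N ->
  ((2 ^ b - e) %/ 2 ^ a = 2 ^ (b - a) - 1)%N.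
Proof.
move=> ab ea; have p0 : (0 < 2 ^ (b - a))%N by rewrite expn_gt0.
have -> : (2 ^ b - e = (2 ^ (b - a) - 1) * 2 ^ a + (2 ^ a - e))%N.
  have : (2 ^ b = 2 ^ (b - a) * 2 ^ a)%N by rewrite -expnD subnK.
  by rewrite mulnBl mul1n => ->; nia.
by rewrite divnMDl ?expn_gt0// divn_small ?addn0//; lia.
Qed.

(** The last two sample cells of level [gkap s j + 1] lie in an upper half, and [g_s^j] has opposite
    signs there; a step function of level at most [gkap s j] would take equal values. This is the
    source of all growth of [k]. *)
Lemma gkap_lt s j : (2 <= s)%N -> (j < 2 ^ (2 * s))%N -> (gkap s j < k s)%N.
Proof.
move=> s2 js; rewrite ltnNge; apply/negP => kk.
set K := (gkap s j).+1.
have LK : (glevel s < K)%N by rewrite /K /gkap; lia.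
have p2 : (2 <= 2 ^ (K - k s))%N by rewrite -[X in (X <= _)%N]expn1 leq_exp2l// /K; lia.
have p3 : (2 <= 2 ^ (K - (glevel s).+1))%N.
  by rewrite -[X in (X <= _)%N]expn1 leq_exp2l// /K /gkap; lia.
have p4 : (2 <= 2 ^ K)%N by rewrite -[X in (X <= _)%N]expn1 leq_exp2l.
have o c : (0 < c <= 2)%N -> odd ((2 ^ K - c) %/ 2 ^ (K - (glevel s).+1)).
  move=> c2; rewrite lt_pow2_div; [|lia|lia].
  by rewrite oddB ?expn_gt0// oddX subn_eq0 leqNgt; case: ltnP => //; lia.
have kKs : (k s <= K)%N by rewrite /K; lia.
have := @step_pt _ Z (g f k s j) (k s) z K (2 ^ K - 1) (2 ^ K - 2) (Zg (ltnW s2) js) gz kKs.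
rewrite ltn_subrL expn_gt0 !lt_pow2_div; [|lia..] => /(_ isT erefl).
rewrite -[LHS]/(gval _ _ _ _) -[RHS]/(gval _ _ _ _) !g_half ?o//.
rewrite /rad subnn !divn1 !oddB//; last exact: ltnW.
by rewrite oddX /= => h; lra.
Qed.

Lemma gval_step s j K l c : (2 <= s)%N -> (j < 2 ^ (2 * s))%N -> (k s <= K)%N ->
  step_in K l c (k s) (gval K s j).
Proof.
move=> s2 js kK x y _ xy.
have LK : (glevel s <= K)%N by have := gkap_lt s2 js; rewrite /gkap; lia.
have dm w : (w %% 2 ^ K = w %[mod 2 ^ (K - glevel s)])%N.
  by apply: modn_dvdm; rewrite dvdn_exp2l// leq_subr.
rewrite -(g_periodic _ s2 LK (dm x)) -(g_periodic _ s2 LK (dm y)).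
apply: (step_pt (Zg (ltnW s2) js) gz kK); first by rewrite ltn_mod expn_gt0.
have dv w : ((w %% 2 ^ K) %/ 2 ^ (K - k s) = (w %/ 2 ^ (K - k s)) %% 2 ^ k s)%N.
  by rewrite modn_divl -expnD subnKC.
by rewrite !dv xy.
Qed.

Lemma layers_g K s0 : (2 <= s0)%N ->
  layers K glevel k (fun s => 2 ^ (2 * s))%N gkap (gval K) s0.
Proof.
move=> s02.
have lt s : (s0 <= s)%N -> (glevel s < k s)%N.
  move=> s0s; have := @gkap_lt s 0 (leq_trans s02 s0s); rewrite expn_gt0 /gkap => /(_ isT); lia.
split.
- exact: lt.
- by move=> s _; rewrite /glevel /=; lia.
- by move=> s j l c s0s kK js; apply: gval_step => //; lia.
- by move=> s j x y s0s kK js; apply: g_periodic; [lia|have := lt s s0s; lia].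
- move=> s j x s0s kK js ox; apply: g_half => //; first lia.
  by apply: ltn_trans kK; apply: gkap_lt => //; lia.
- move=> s j s0s js; rewrite gkap_lt//; last lia.
  by rewrite /gkap; lia.
- by move=> s i j s0s ij; rewrite /gkap; lia.
Qed.

Lemma f_per_pt n i d q : (2 <= n)%N -> (i < 2 ^ n)%N -> (q < 2 ^ d)%N ->
  f_per f n i (pt z d q) = menshov_shift n i (pt z d q).
Proof.
move=> n2 i_n qd; have u0 := pt_gt0 z01 d q; have u1 := pt_lt1 z01 qd.
rewrite /f_per /periodize (_ : Num.floor _ = 0) ?mulr0 ?subr0.
  apply: Zf => //; last exact: generic_pt.
  by apply/andP; split; lra.
by apply: floor_def; rewrite add0r; apply/andP; split; lra.
Qed.

(** The last quarter of a copy of [f] corresponds to [[3, 4]], hence by the period 4 to [[-1, 0]],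
    where [f] is again a Menshov function. *)
Lemma f_per_pt3 n i d q : (2 <= n)%N -> (i < 2 ^ n)%N -> (q < 2 ^ d)%N ->
  f_per f n i (pt z d (q + 3 * 2 ^ d)) = menshov_shift n i (pt z d q - 1).
Proof.
move=> n2 i_n qd; have u0 := pt_gt0 z01 d q; have u1 := pt_lt1 z01 qd.
have -> : pt z d (q + 3 * 2 ^ d) = pt z d q + 3.
  by rewrite /pt natrD natrM natrX; field.
rewrite /f_per /periodize (_ : Num.floor _ = 1).
  have -> : pt z d q + 3 - 4 * 1%:~R = pt z d q - 1 by rewrite rmorph1; ring.
  apply: Zf => //; first by apply/andP; split; lra.
  have -> : pt z d q - 1 = ((q%:Z - (2 ^ d)%N%:Z)%:~R + z) / 2 ^+ d.
    by rewrite rmorphB /= /pt -!pmulrn natrX; field.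
  exact: gz.2.
apply: floor_def; apply/andP; split; first lra.
by rewrite (_ : (1 + 1)%:~R = 2)//; lra.
Qed.

Lemma g_hat_scale kp s j d kap q : (2 <= kap <= 2 * s ^ 2)%N -> (kap + 2 <= d)%N ->
  (q < 2 ^ (d - kap))%N ->
  g_hat f kp s j (pt z d (2 ^ (d - kap) + q)) =
  s%:R^-1 * 2 `^ (kap%:R / 2) * f_per f (2 * s) j (pt z (d - kap - 2) q).
Proof.
move=> /andP[k2 ks] kd qd; set y := pt z d _.
have yE : y = 2 ^- kap + (q%:R + z) / 2 ^+ d.
  rewrite /y /pt natrD natrX.
  have -> : (2 : R) ^+ d = 2 ^+ (d - kap) * 2 ^+ kap by rewrite -exprD; congr (_ ^+ _); lia.
  by field; rewrite !pow2neq0.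
have [y1 y2] : 2 ^- kap < y /\ y < 2 ^- kap.-1.
  have := pt_cell z01 (2 ^ (d - kap) + q) (_ : (kap <= d)%N); rewrite -/y.
  have -> : ((2 ^ (d - kap) + q) %/ 2 ^ (d - kap) = 1)%N.
    by rewrite -[X in (X + _)%N]mul1n divnMDl ?expn_gt0// divn_small.
  move=> /(_ (leq_trans (leq_addr _ _) kd)) /andP[a1 a2].
  split; first by rewrite -[ltLHS]mul1r.
  apply: (lt_le_trans a2); rewrite -[kap in 2 ^+ kap]prednK; last by lia.
  by rewrite exprS invfM mulrA divff// mul1r.
have mono a b : (a <= b)%N -> (2 : R) ^- b <= 2 ^- a.
  by move=> ab; rewrite lef_pV2 ?posrE// ler_weXn2l// ler1n.
rewrite /g_hat ifF; last first.
  by apply: negbTE; rewrite -ltNge; apply: le_lt_trans y1; apply: mono.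
rewrite ifT; last first.
  apply: (le_trans (ltW y2)); rewrite div1r -[X in _ <= X^-1]expr1; apply: mono; lia.
rewrite big_mkcond (bigD1_seq kap) ?iota_uniq//=; last by rewrite mem_index_iota; lia.
rewrite ifT; last by rewrite y1 ltW.
rewrite big1 ?addr0 => [|i /negP ik].
  congr (_ * f_per _ _ _ _); rewrite yE addrC addKr /pt.
  have -> : (2 : R) ^+ d = 2 ^+ (d - kap - 2) * 2 ^+ (kap + 2).
    by rewrite -exprD; congr (_ ^+ _); lia.
  by field; rewrite !pow2neq0.
rewrite ifF//; apply/negP => /andP[i1 i2]; apply: ik; apply/eqP.
have [ik|ik|//] := ssrnat.ltngtP i kap.
  have := lt_trans i1 y2; rewrite ltNge mono//; lia.
have := lt_le_trans y1 i2; rewrite ltNge mono//; lia.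
Qed.

(** At scale [kap] there is one full period of [f]; [x] lies in its first quarter and [y] at the
    corresponding place of the last. The surplus depth [r] makes [q %/ 2 ^ r] the cell of the
    Menshov function. *)
Lemma g_jump s j K kap r q x y : (2 <= s)%N -> (j < 2 ^ (2 * s))%N ->
  (2 <= kap <= 2 * s ^ 2)%N -> (K - glevel s = kap + 2 + 2 * s + r)%N ->
  (glevel s <= K)%N -> (q < 2 ^ (2 * s) * 2 ^ r)%N ->
  (x = 2 ^ (K - glevel s - kap) + q %[mod 2 ^ (K - glevel s)])%N ->
  (y = 2 ^ (K - glevel s - kap) + (q + 3 * 2 ^ (2 * s + r)) %[mod 2 ^ (K - glevel s)])%N ->
  gval K s j x - gval K s j y =
  s%:R^-1 * 2 `^ (kap%:R / 2) * (2 ^+ s / 8) * slam (2 ^ (2 * s)) (q %/ 2 ^ r) j.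
Proof.
move=> s2 js ks dE LK qN xE yE; rewrite (g_periodic _ s2 LK xE) (g_periodic _ s2 LK yE) {xE yE}.
set d := (K - glevel s)%N in dE *.
have dk : (d - kap = 2 * s + r + 2)%N by lia.
have e4 : (2 ^ (d - kap) = 4 * 2 ^ (2 * s + r))%N by rewrite dk expnD mulnC.
have d2 : (2 ^ d = 2 ^ kap * 2 ^ (d - kap))%N by rewrite -expnD; congr expn; lia.
have kap4 : (4 <= 2 ^ kap)%N by rewrite (@leq_exp2l 2 2)//; lia.
have d16 : (16 * 2 ^ (2 * s + r) <= 2 ^ d)%N.
  by rewrite d2 e4 mulnA; apply: leq_mul => //; exact: (leq_mul kap4 (leqnn 4)).
rewrite -expnD in qN.
rewrite !g_pt// -/d !modn_small; [|lia..].
rewrite !g_hat_scale; [|lia..].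
have -> : (d - kap - 2 = 2 * s + r)%N by lia.
have s22 : (2 <= 2 * s)%N by lia.
rewrite f_per_pt// f_per_pt3// -mulrBr.
set w := pt z r (q %% 2 ^ r).
have w01 : 0 < w < 1 by rewrite pt_gt0//= pt_lt1// ltn_mod expn_gt0.
have -> : pt z (2 * s + r) q = ((q %/ 2 ^ r)%:R + w) / 2 ^+ (2 * s).
  by rewrite /w -pt_modn addrC subrK /pt exprD; field; rewrite !pow2neq0.
rewrite menshov_shift_jump//; last by rewrite ltn_divLR ?expn_gt0// -expnD.
have -> : 2 `^ ((2 * s)%:R / 2) = (2 : R) ^+ s.
  by rewrite natrM mulrAC divff// mul1r powR_mulrn.
by rewrite -!mulrA.
Qed.

End LayerFunctions.

(** * Splitting a cell into dyadic scales *)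

Section ScaleDecomposition.
Context {R : realType}.

(** The cells are the upper half, the upper half of the lower half, and so on: disjoint, of relative
    measure [2 ^- kap], and matching the pieces in [g_hat]. *)
Lemma avg_scales K M l c (F : nat -> R) : (forall i, 0 <= F i) -> (l + M <= K)%N ->
  \sum_(1 <= kap < M.+1) 2 ^- kap * avg K (l + kap) (c * 2 ^ kap).+1 F <= avg K l c F.
Proof.
move=> F0; elim: M l c => [|M IH] l c lMK.
  by rewrite big_geq//; apply: avg_ge0.
rewrite big_nat_recl//= [leRHS]avg_split; last by lia.
have := IH l.+1 (2 * c)%N; rewrite addSnnS => /(_ lMK) IH'.
have -> : \sum_(1 <= i < M.+1) 2 ^- i.+1 * avg K (l + i.+1) (c * 2 ^ i.+1).+1 F =
    2^-1 * \sum_(1 <= kap < M.+1) 2 ^- kap * avg K (l.+1 + kap) (2 * c * 2 ^ kap).+1 F.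
  rewrite mulr_sumr; apply: eq_bigr => i _; rewrite addSnnS exprS invfM -mulrA expnS.
  by rewrite mulnA (mulnC c).
rewrite expn1 addn1 (mulnC c) expr1; lra.
Qed.

(** The condition holds from some scale on, whose measure is comparable to [min X 1]. The squared
    amplitude doubles when the measure is halved, and this converts size into probability; [2 ^- M]
    pays for the missing scales. *)
Lemma sum_scales_ge (X : R) M : 0 <= X -> (2 <= M)%N ->
  Num.min X 1 / 4 - 2 ^- M <=
  \sum_(2 <= kap < M.+1) 2 ^- kap * (1 <= 2 ^+ kap * X)%R%:R.
Proof.
move=> X0 M2; set h := \sum_(2 <= kap < M.+1) _.
have mX : Num.min X 1 <= X by rewrite ge_min lexx.
have P0 n : 0 < (2 : R) ^+ n by rewrite exprn_gt0.
have h0 : 0 <= h.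
  by apply: sumr_ge0 => i _; rewrite mulr_ge0// invr_ge0 ltW.
have [X1|X1] := ltP (2 ^+ M * X) 1.
  have XM : X < 2 ^- M by rewrite -[ltRHS]mul1r ltr_pdivlMr// mulrC.
  by apply: (le_trans _ h0); have := P0 M; have := mX; lra.
have PM : 0 < (2 : R) ^- M by rewrite invr_gt0.
suff : Num.min X 1 / 4 <= h by lra.
rewrite {}/h in h0 *; move=> {h0 PM}; elim: M M2 X1 => // -[//|[|M]] IH M2 X1.
  rewrite big_nat1 X1 mulr1.
  have : Num.min X 1 <= 1 by rewrite ge_min lexx orbT.
  by rewrite expr2; lra.
rewrite big_nat_recr//= X1 mulr1.
have S0 : 0 <= \sum_(2 <= i < M.+2.+1) (2 : R) ^- i * (1 <= 2 ^+ i * X)%R%:R.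
  by apply: sumr_ge0 => i _; rewrite mulr_ge0// invr_ge0 ltW.
have [X2|X2] := ltP (2 ^+ M.+2 * X) 1; last first.
  have := IH isT X2; have : 0 < (2 : R) ^- M.+3 by rewrite invr_gt0.
  by lra.
have XM : X < 2 ^- M.+2 by rewrite -[ltRHS]mul1r ltr_pdivlMr// mulrC.
have -> : (2 : R) ^- M.+3 = 2 ^- M.+2 / 2 by rewrite exprS invfM mulrC.
by lra.
Qed.

(** The first and last quarters are paired point by point; the two middle ones only add a
    nonnegative amount. *)
Lemma avg_quarters K l c n r (F : nat -> R) (B : nat -> R) :
  (forall i, 0 <= F i) -> (K - l = n + r + 2)%N ->
  (forall q, (q < 2 ^ n * 2 ^ r)%N -> B (q %/ 2 ^ r)%N <=
     F (c * 2 ^ (K - l) + q)%N + F (c * 2 ^ (K - l) + (q + 3 * 2 ^ (n + r)))%N) ->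
  (\sum_(p < 2 ^ n) B p) / (4 * 2 ^+ n) <= avg K l c F.
Proof.
move=> F0 e FB; rewrite /avg e.
have -> : (2 ^ (n + r + 2) = 2 ^ (n + r) + (2 ^ (n + r) + 2 ^ (n + r)) + 2 ^ (n + r))%N.
  by rewrite !expnD; lia.
rewrite !big_split_ord /=.
set D := (2 ^ (n + r) + _ + _)%N.
have D0 : 0 < (2 : R) ^+ (n + r) by rewrite exprn_gt0.
have p0 : 0 < (2 : R) ^+ n by rewrite exprn_gt0.
have r0 : 0 < (2 : R) ^+ r by rewrite exprn_gt0.
apply: (@le_trans _ _ ((\sum_(q < 2 ^ (n + r)) (F (c * D + q)%N +
    F (c * D + (q + 3 * 2 ^ (n + r)))%N)) / 2 ^+ (n + r + 2))); last first.
  rewrite ler_pM2r ?invr_gt0 ?exprn_gt0// big_split /=.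
  set S2 := \sum_(i < 2 ^ (n + r)) F (c * D + (2 ^ (n + r) + i))%N.
  set S3 := \sum_(i < 2 ^ (n + r)) F (c * D + (2 ^ (n + r) + (2 ^ (n + r) + i)))%N.
  have S20 : 0 <= S2 by apply: sumr_ge0.
  have S30 : 0 <= S3 by apply: sumr_ge0.
  rewrite -[leRHS]addrA lerD2l -[leLHS]add0r; apply: lerD; first exact: addr_ge0.
  rewrite le_eqVlt; apply/orP; left; apply/eqP.
  by apply: eq_bigr => i _; congr F; lia.
apply: (@le_trans _ _ ((\sum_(q < 2 ^ (n + r)) B (q %/ 2 ^ r)%N) / 2 ^+ (n + r + 2))).
  have -> : (\sum_(q < 2 ^ (n + r)) B (q %/ 2 ^ r)%N) = 2 ^+ r * \sum_(p < 2 ^ n) B p.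
    rewrite expnD (sum_ord_mul _ _ (fun q => B (q %/ 2 ^ r)%N)) mulr_sumr.
    apply: eq_bigr => p _; rewrite (eq_bigr (fun=> B p)); last first.
      by move=> t _; rewrite divnMDl ?expn_gt0// divn_small ?addn0.
    by rewrite sumr_const card_ord -[LHS]mulr_natl natrX.
  rewrite le_eqVlt; apply/orP; left; apply/eqP; rewrite !exprD; field.
  by rewrite !gt_eqF.
rewrite ler_pM2r ?invr_gt0 ?exprn_gt0//; apply: ler_sum => q _.
have := FB q; rewrite e; have -> : (2 ^ (n + r + 2))%N = D.
  by rewrite /D !expnD; lia.
by apply; rewrite -expnD.
Qed.

End ScaleDecomposition.

(** * Oscillation inside one block *)

Section Oscillation.
Context {R : realType}.
Variables (f : nat -> nat -> R -> R) (k : nat -> nat) (Z : set R) (z : R).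
Hypothesis gz : generic Z z.
Hypothesis Zf : forall n i u, (2 <= n)%N -> (i < 2 ^ n)%N -> -1 <= u <= 1 -> ~ Z u ->
  f n i u = menshov_shift n i u.
Local Notation gval := (gval f k z).

Lemma menshov_osc s K e (b : nat -> R) (u : nat -> nat -> R) (v dl : R) (A : pred nat) :
  (2 <= s)%N -> (glevel k s + 2 * s ^ 2 + 2 + 2 * s <= K)%N ->
  (forall i x, (i < 2 ^ (2 * s))%N -> (x %/ 2 ^ (K - glevel k s) = e)%N ->
    u i x = v + gval K s i x - dl * \sum_(j < 2 ^ (2 * s)) gval K s j x) ->
  (forall x J, (x %/ 2 ^ (K - glevel k s) = e)%N -> (J <= 2 ^ (2 * s))%N ->
    1 / 4 <= `|\sum_(i < J) b i * u i x| \/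
    1 / 4 <= `|\sum_(J <= i < 2 ^ (2 * s)) b i * u i x| -> A x) ->
  ((\sum_(p < 2 ^ (2 * s)) Num.min (menshov_gain s (2 ^ (2 * s)) b dl p ^+ 2) 1) /
      (2 ^ (2 * s))%:R / 4 - 2 ^- (2 * s ^ 2)) / 4 <=
  avg K (glevel k s) e (fun x => (A x)%:R).
Proof.
move=> s2 LK uE PA.
set N := (2 ^ (2 * s))%N in uE PA *.
set gain := menshov_gain s N b dl.
have N0 : (0 < N)%N by rewrite expn_gt0.
have NR : 0 < N%:R :> R by rewrite ltr0n.
have sq4 : (4 <= s ^ 2)%N by rewrite -[4%N]/(2 ^ 2)%N leq_exp2r.
(* The signed sum [V] differs by at least 1 between [x] and [y], so it is at least 1/2 in size at
   one of them. Being a head minus a tail, it then has one of these at least 1/4 in size. *)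
have pair x y p : (p < N)%N -> (x %/ 2 ^ (K - glevel k s) = e)%N ->
    (y %/ 2 ^ (K - glevel k s) = e)%N -> forall kap,
    (forall j, (j < N)%N -> gval K s j x - gval K s j y =
      s%:R^-1 * 2 `^ (kap%:R / 2) * (2 ^+ s / 8) * slam N p j) ->
    1 <= 2 ^+ kap * gain p ^+ 2 -> A x || A y.
  move=> pN xe ye kap gxy big.
  have uxy i : (i < N)%N -> u i x - u i y =
      2 `^ (kap%:R / 2) * (2 ^+ s / (8 * s%:R)) * (slam N p i - dl * slam_sum N p).
    move=> iN; rewrite !uE// /slam_sum.
    have gS : \sum_(j < N) gval K s j x - \sum_(j < N) gval K s j y =
        s%:R^-1 * 2 `^ (kap%:R / 2) * (2 ^+ s / 8) * \sum_(j < N) slam N p j.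
      by rewrite -sumrB mulr_sumr; apply: eq_bigr => j _; rewrite gxy.
    have gi := gxy i iN.
    have -> : v + gval K s i x - dl * \sum_(j < N) gval K s j x -
      (v + gval K s i y - dl * \sum_(j < N) gval K s j y) =
      (gval K s i x - gval K s i y) - dl * (\sum_(j < N) gval K s j x - \sum_(j < N) gval K s j y).
      by ring.
    rewrite gi gS; field; rewrite pnatr_eq0; lia.
  pose V w := \sum_(i < N) sgn_le p i * (b i * u i w).
  have Vxy : V x - V y = 2 `^ (kap%:R / 2) * gain p.
    rewrite /V -sumrB (eq_bigr (fun i : 'I_N => 2 `^ (kap%:R / 2) * (2 ^+ s / (8 * s%:R)) *
      (b i * (sgn_le p i * slam N p i) - dl * (sgn_le p i * b i) * slam_sum N p))); last first.
      by move=> i _; rewrite -mulrBr -mulrBr uxy//; ring.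
    rewrite -mulr_sumr /gain /menshov_gain /menshov_jump -[LHS]mulrA; congr (_ * (_ * _)).
    rewrite sumrB -mulr_suml -mulr_sumr; congr (_ - _).
    by apply: eq_bigr => i _; rewrite sgn_slam.
  have Vge : 1 <= `|V x - V y|.
    rewrite -(@ler_pXn2r _ 2) ?nnegrE// expr1n real_normK ?num_real// Vxy exprMn.
    have -> : (2 : R) `^ (kap%:R / 2) ^+ 2 = 2 ^+ kap.
      by rewrite -powR_mulrn ?powR_ge0// -powRrM divfK// powR_mulrn.
    by [].
  have VA w : (w %/ 2 ^ (K - glevel k s) = e)%N -> 1 / 2 <= `|V w| -> A w.
    move=> we Vw; apply: (PA w p.+1 we pN).
    have VE : V w = \sum_(i < p.+1) b i * u i w - \sum_(p.+1 <= i < N) b i * u i w.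
      rewrite /V -(big_mkord xpredT (fun i => sgn_le p i * (b i * u i w))).
      rewrite (@big_cat_nat _ _ _ p.+1)//= big_mkord; congr (_ + _).
        by apply: eq_bigr => i _; rewrite /sgn_le -ltnS ltn_ord mul1r.
      rewrite -sumrN !big_nat; apply: eq_bigr => i /andP[pi _].
      by rewrite /sgn_le leqNgt pi mulN1r.
    have [|] := leP (1 / 4) `|\sum_(i < p.+1) b i * u i w|; first by left.
    move=> lt4; right; move: Vw; rewrite VE => Vw.
    have := ler_normB (\sum_(i < p.+1) b i * u i w) (\sum_(p.+1 <= i < N) b i * u i w).
    by move: Vw lt4; lra.
  have [Vx|Vx] := leP (1 / 2) `|V x|; first by rewrite VA.
  rewrite [X in _ || X]VA ?orbT//.
  by have := ler_normB (V x) (V y); move: Vge Vx; lra.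
apply: (le_trans _ (@avg_scales _ K (2 * s ^ 2) (glevel k s) e _ _ _)); last first.
- lia.
- by [].
(* Scale 1 is the upper half, where the [g_s^j] are Rademacher functions; it is given up. *)
rewrite big_ltn; last lia.
apply: (@le_trans _ _ (\sum_(2 <= kap < (2 * s ^ 2).+1) 2 ^- kap *
    ((\sum_(p < N) (1 <= 2 ^+ kap * gain p ^+ 2)%R%:R) / (4 * 2 ^+ (2 * s))))); last first.
  apply: (@le_trans _ _ (\sum_(2 <= kap < (2 * s ^ 2).+1) 2 ^- kap *
     avg K (glevel k s + kap) (e * 2 ^ kap).+1 (fun x => (A x)%:R))); last first.
    by rewrite lerDr mulr_ge0 ?invr_ge0 ?exprn_ge0// avg_ge0.
  rewrite !big_nat; apply: ler_sum => kap /andP[k2 kM].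
  rewrite ler_wpM2l ?invr_ge0 ?exprn_ge0//.
  have ks : (2 <= kap <= 2 * s ^ 2)%N by rewrite k2.
  pose r := (K - glevel k s - kap - 2 - 2 * s)%N.
  have dE : (K - glevel k s = kap + 2 + 2 * s + r)%N by rewrite /r; lia.
  have d2E : (K - (glevel k s + kap) = 2 * s + r + 2)%N by lia.
  apply: (@avg_quarters _ _ _ _ (2 * s) r _
    (fun p => (1 <= 2 ^+ kap * gain p ^+ 2)%R%:R)) => // q qN.
  set x := (_ + q)%N; set y := (_ + (q + _))%N.
  have pN : (q %/ 2 ^ r < N)%N by rewrite ltn_divLR ?expn_gt0.
  have [small|big] := boolP (1 <= 2 ^+ kap * gain (q %/ 2 ^ r)%N ^+ 2); last first.
    by rewrite addr_ge0.
  have e4 : (2 ^ (2 * s + r + 2) = 4 * 2 ^ (2 * s + r))%N by rewrite expnD mulnC.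
  have dk : (K - glevel k s - kap = 2 * s + r + 2)%N by move: dE; clear; lia.
  have e5 : (2 ^ (K - glevel k s) = 2 ^ kap * 2 ^ (2 * s + r + 2))%N by rewrite -expnD dE; congr expn; clear; lia.
  have kap2 : (2 <= 2 ^ kap)%N by rewrite -[X in (X <= _)%N]expn1 leq_exp2l//; lia.
  have loc q' : (q' < 2 ^ (2 * s + r + 2))%N ->
      ((e * 2 ^ kap).+1 * 2 ^ (K - (glevel k s + kap)) + q' =
      e * 2 ^ (K - glevel k s) + (2 ^ (2 * s + r + 2) + q'))%N
      /\ (2 ^ (2 * s + r + 2) + q' < 2 ^ (K - glevel k s))%N.
    move=> q'4; rewrite d2E e5 mulSn mulnA; split; first lia.
    by apply: (@leq_trans (2 * 2 ^ (2 * s + r + 2))); [lia|rewrite leq_mul2r kap2 orbT].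
  move: qN; rewrite -expnD => qN.
  have q1 : (q < 2 ^ (2 * s + r + 2))%N by rewrite e4; move: qN; clear; lia.
  have q2 : (q + 3 * 2 ^ (2 * s + r) < 2 ^ (2 * s + r + 2))%N.
    by rewrite e4; move: qN; clear; lia.
  have [x1 x2] := loc q q1; have [y1 y2] := loc (q + 3 * 2 ^ (2 * s + r))%N q2.
  have cell q' : (q' < 2 ^ (2 * s + r + 2))%N ->
      ((e * 2 ^ (K - glevel k s) + (2 ^ (2 * s + r + 2) + q')) %/ 2 ^ (K - glevel k s) = e)%N.
    by move=> /loc[_ lt]; rewrite divnMDl ?expn_gt0// divn_small ?addn0.
  have : A x || A y.
    apply: (pair x y _ pN _ _ kap _ small).
    - by rewrite /x x1 cell.
    - by rewrite /y y1 cell.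
    - move=> j jN; apply: (g_jump gz Zf _ jN ks dE (r := r)) => //.
      + by move: LK; clear; lia.
      + by rewrite -expnD.
      + by rewrite /x x1 dk modnMDl.
      + by rewrite /y y1 dk modnMDl.
  by case: (A x) => /=; case: (A y) => //= _; rewrite ?addr0 ?add0r ?lerDl// mulr1n lerDl.
rewrite (eq_bigr (fun kap => (4 * 2 ^+ (2 * s))^-1 *
    \sum_(p < N) 2 ^- kap * (1 <= 2 ^+ kap * gain p ^+ 2)%R%:R)); last first.
  by move=> kap _; rewrite -mulr_sumr mulrA [RHS]mulrC.
rewrite -mulr_sumr exchange_big /=.
apply: (@le_trans _ _ ((4 * 2 ^+ (2 * s))^-1 *
   \sum_(p < N) (Num.min (gain p ^+ 2) 1 / 4 - 2 ^- (2 * s ^ 2)))); last first.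
  rewrite ler_wpM2l ?invr_ge0 ?mulr_ge0 ?exprn_ge0//; apply: ler_sum => p _.
  by apply: sum_scales_ge; [exact: sqr_ge0|lia].
rewrite sumrB sumr_const card_ord -mulr_suml -[_ *+ N]mulr_natl.
rewrite le_eqVlt; apply/orP; left; apply/eqP.
have -> : (2 : R) ^+ (2 * s) = N%:R by rewrite natrX.
by field; rewrite gt_eqF//= pnatr_eq0 -lt0n expn_gt0.
Qed.

End Oscillation.

(** * Null sets from averages *)

Lemma countable_setU {T : Type} (A B : set T) :
  countable A -> countable B -> countable (A `|` B).
Proof.
move=> cA cB; rewrite -bigcup2E; apply: bigcup_countable; first exact: countableP.
by move=> [|[|i]] _ //=.
Qed.

Section StepIntegral.
Context {R : realType}.
Local Notation mu := (@lebesgue_measure R).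
Implicit Types (F : R -> R) (Z : set R) (z : R).

Definition dcell K i : set R := `](i%:R / 2 ^+ K), (i.+1%:R / 2 ^+ K)[%classic.

Definition dyadics : set R := [set x | exists i K : nat, x = i%:R / 2 ^+ K].

Lemma countable_dyadics : countable dyadics.
Proof.
suff -> : dyadics = (fun iK : nat * nat => iK.1%:R / 2 ^+ iK.2 : R) @` setT.
  by apply: sub_countable (card_image_le _ _) _; exact: countableP.
apply/seteqP; split => [x [i [K ->]]|x [[i K] _ <-]]; first by exists (i, K).
by exists i, K.
Qed.

Lemma countable_measurableR (A : set R) : countable A -> measurable A.
Proof. by apply: countable_measurable => t; exact: measurable_set1. Qed.

Lemma mu_dcell K i : mu (dcell K i) = (2 ^- K)%:E.
Proof.
rewrite /dcell lebesgue_measure_itv /= lte_fin ltr_pM2r ?invr_gt0 ?exprn_gt0//.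
by rewrite ltr_nat ltnSn -EFinB -mulrBl -natr1 addrAC subrr add0r mul1r.
Qed.

Lemma dcellP K x : 0 <= x <= 1 -> ~ dyadics x ->
  exists2 i, (i < 2 ^ K)%N & dcell K i x.
Proof.
move=> /andP[x0 x1] nx; have P0 : 0 < (2 : R) ^+ K by rewrite exprn_gt0.
have [i iE] : exists i : nat, Num.floor (2 ^+ K * x) = i%:Z.
  have : 0 <= Num.floor (2 ^+ K * x) by rewrite floor_ge0 mulr_ge0// ltW.
  by move=> fl0; exists `|Num.floor (2 ^+ K * x)|%N; rewrite gez0_abs.
have := real_floor_itv (num_real (2 ^+ K * x)); rewrite iE rmorphD /= rmorph1 => /andP[ix xi].
have ne : i%:R / 2 ^+ K != x by apply/eqP => e; apply: nx; exists i, K.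
have cx : dcell K i x.
  rewrite /dcell /= in_itv /= lt_neqAle ne /= ler_pdivrMr// mulrC ix /=.
  by rewrite ltr_pdivlMr// mulrC -[ltRHS]natr1.
exists i => //; rewrite ltnNge; apply/negP => Ki.
move: cx; rewrite /dcell /= in_itv /= => /andP[+ _]; rewrite ltNge => /negP; apply.
by rewrite (le_trans x1)// ler_pdivlMr// mul1r -natrX ler_nat.
Qed.

Lemma dcell_inj K i j x : dcell K i x -> dcell K j x -> i = j.
Proof.
have P0 : 0 < (2 : R) ^- K by rewrite invr_gt0 exprn_gt0.
have H a b : dcell K a x -> dcell K b x -> (a <= b)%N.
  rewrite /dcell /= !in_itv /= => /andP[a1 _] /andP[_ b2].
  by have := lt_trans a1 b2; rewrite ltr_pM2r// ltr_nat ltnS.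
by move=> xi xj; apply/eqP; rewrite eqn_leq !H.
Qed.

Lemma integral_step F Z z K : countable Z -> generic Z z -> step_off Z K F ->
  \int[mu]_(x in `[0, 1]) F x = avg K 0 0 (fun i => F (pt z K i)).
Proof.
move=> cZ gz sF; have z01 := gz.1.
pose h x := \sum_(i < 2 ^ K) F (pt z K i) * \1_(dcell K i) x.
pose N := Z `|` dyadics.
have cN : countable N by exact: countable_setU cZ countable_dyadics.
have mN := countable_measurableR cN.
have mD : measurable (`[0, 1]%classic : set R) by exact: measurable_itv.
have Fh x : (0 <= x <= 1) -> ~ N x -> F x = h x.
  move=> x01 nN.
  have nZ : ~ Z x by move=> Zx; apply: nN; left.
  have nd : ~ dyadics x by move=> Zx; apply: nN; right.
  have [i iK xi] := dcellP K x01 nd.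
  rewrite /h (bigD1 (Ordinal iK))//= indicE mem_set// mulr1 big1 ?addr0; last first.
    move=> j ji; rewrite indicE memNset ?mulr0// => xj.
    by move/eqP: ji; apply; apply/val_inj/(dcell_inj xj xi).
  apply: (sF i) => //.
    by have := pt_cell z01 i (leqnn K); rewrite subnn expn0 divn1.
  exact: generic_pt.
have mc i : measurable (dcell K i) by exact: measurable_itv.
have mh : measurable_fun setT h.
  apply: measurable_sum => i; apply: measurable_funM => //; exact: measurable_indic.
have mF : measurable_fun (`[0, 1]%classic : set R) F.
  have -> : `[0, 1]%classic = (`[0, 1]%classic `\` N) `|` (`[0, 1]%classic `&` N) :> set R.
    by rewrite setUC setUIDK.
  apply/measurable_funU; [exact: measurableD|exact: measurableI|split].
    apply: (eq_measurable_fun h); last exact: measurable_funS mh.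
    move=> x; rewrite inE => -[/= + nN]; rewrite in_itv /= => x01; exact/esym/Fh.
  move=> _ B mB; apply: countable_measurableR.
  by apply: sub_countable cN; apply: subset_card_le => x [[]].
rewrite /Rintegral.
have -> : (\int[mu]_(x in `[0%R, 1%R]) (F x)%:E = \int[mu]_(x in `[0%R, 1%R]) (h x)%:E)%E.
  apply: ae_eq_integral => //.
  - exact/measurable_EFinP.
  - apply/measurable_EFinP; exact: measurable_funS mh.
  exists N; split => //; first exact: countable_lebesgue_measure0.
  move=> x /= nF; apply: contrapT => nN; apply: nF => /=; rewrite in_itv /= => x01.
  by rewrite (Fh x).
transitivity (fine (\int[mu]_(x in `[0%R, 1%R])
    (\sum_(i < 2 ^ K) (F (pt z K i))%:E * (\1_(dcell K i) x)%:E)))%E.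
  congr fine; apply: eq_integral => x _; rewrite /h -sumEFin.
  by apply: eq_bigr => i _; rewrite EFinM.
have iI i : mu.-integrable `[0, 1] (fun x => (\1_(dcell K i) x)%:E).
  by apply: (@integrableS _ _ _ mu setT) => //; exact: integrable_indic_itv.
rewrite integral_sum//; last by move=> i; exact: integrableZl.
rewrite (eq_bigr (fun i : 'I_(2 ^ K) => (F (pt z K i) * 2 ^- K)%:E)) => [|i _].
  rewrite sumEFin /= /avg subn0 mulr_suml; apply: eq_bigr => i _.
  by rewrite mul0n add0n.
rewrite integralZl//= integral_indic//; last exact: mc.
rewrite EFinM; congr (_ * _)%E.
rewrite setIidl; first exact: mu_dcell.
move=> x; rewrite /dcell /= !in_itv /= => /andP[xi ix].
rewrite (le_trans _ (ltW xi)) ?divr_ge0 ?exprn_ge0//= (le_trans (ltW ix))//.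
by rewrite ler_pdivrMr ?exprn_gt0// mul1r -natrX ler_nat.
Qed.

(** No measurability of [E] is assumed: off a countable set it is covered by the cells whose sample
    point lies in [W], and their total length is the average. *)
Lemma null_of_small_averages (E Z : set R) z : 0 < z < 1 -> countable Z ->
  E `<=` `[0, 1] ->
  (forall e : R, 0 < e -> exists K (W : set R),
    [/\ avg K 0 0 (fun i => (`[< W (pt z K i) >])%:R) <= e,
        E `\` Z `<=` W &
        forall i x, (i < 2 ^ K)%N -> dcell K i x -> ~ Z x -> W x -> W (pt z K i)]) ->
  mu.-negligible E.
Proof.
move=> z01 cZ E01 small.
have /choice[B BP] : forall n : nat, exists B : set R,
    [/\ measurable B, (mu B <= (n.+1%:R^-1)%:E)%E & E `\` (Z `|` dyadics) `<=` B].
  move=> n; have [|K [W [We EW WC]]] := small n.+1%:R^-1.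
    by rewrite invr_gt0 ltr0n.
  exists (\big[setU/set0]_(i < 2 ^ K | `[< W (pt z K i) >]) dcell K i); split.
  - by apply: bigsetU_measurable => i _; exact: measurable_itv.
  - rewrite big_mkcond /=.
    pose C i : set R := if `[< W (pt z K i) >] then dcell K i else set0.
    apply: (le_trans (@Boole_inequality _ _ _ mu C (2 ^ K) _)).
      by move=> i _; rewrite /C; case: ifP => // _; exact: measurable_itv.
    apply: (@le_trans _ _ (\sum_(i < 2 ^ K) (((`[< W (pt z K i) >])%:R / 2 ^+ K)%:E))).
      apply: lee_sum => i _; rewrite /C; case: ifP => _.
        by rewrite mul1r -(mu_dcell K i).
      by rewrite measure0 mul0r.
    rewrite sumEFin lee_fin; apply: le_trans We; rewrite /avg subn0 mulr_suml.
    by apply: ler_sum => i _; rewrite mul0n add0n.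
  - move=> x [Ex nZ].
    have nZ' : ~ Z x by move=> Zx; apply: nZ; left.
    have nd : ~ dyadics x by move=> Zx; apply: nZ; right.
    have [|i iK xi] := @dcellP K x _ nd; first by have := E01 x Ex; rewrite /= in_itv.
    rewrite -bigcup_seq_cond; exists (Ordinal iK) => //=.
    rewrite mem_index_enum /=; apply/asboolP.
    by apply: (WC i x) => //; apply: EW.
pose N := Z `|` dyadics.
have cN : countable N by exact: countable_setU cZ countable_dyadics.
have mN := countable_measurableR cN.
have mB : measurable (\bigcap_n B n) by apply: bigcap_measurable => // n _; have [] := BP n.
exists ((\bigcap_n B n) `|` N); split; first exact: measurableU.
- apply/eqP; rewrite eq_le measure_ge0 andbT.
  have U2 : (mu ((\bigcap_n B n) `|` N) <= mu (\bigcap_n B n) + mu N)%E.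
    exact: measureU2.
  apply: (le_trans U2); rewrite (countable_lebesgue_measure0 cN) adde0.
  apply/lee_addgt0Pr => e e0; rewrite add0e.
  have [n ne] : exists n : nat, n.+1%:R^-1 <= e.
    by have [n nE] := ltr_add_invr e0; exists n; move: (ltW nE); rewrite add0r.
  have [mBn Bn _] := BP n; apply: (le_trans _ (le_trans Bn _)); last by rewrite lee_fin.
  by apply: le_measure; rewrite ?inE// => x; exact.
- move=> x Ex; have [Nx|Nx] := pselect (N x); first by right.
  by left => n _; have [_ _] := BP n; apply.
Qed.

End StepIntegral.

(** * Indices, energy and the block decomposition *)

Section Indices.
Variable k : nat -> nat.
Hypothesis k1_gt0 : (0 < k 1)%N.
Hypothesis k_growth : forall s, (2 <= s)%N ->
  (glevel k s + k s.-1 + 4 + 2 ^ (2 * s) <= k s)%N.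

Lemma k_lt s t : (1 <= s < t)%N -> (k s < k t)%N.
Proof.
move=> /andP[s1]; elim: t => // t IH; rewrite ltnS leq_eqVlt => /predU1P[<-|st].
  by have := @k_growth s.+1; rewrite /glevel /= => /(_ s1); lia.
have t1 : (2 <= t.+1)%N by lia.
by have := IH st; have := k_growth t1; rewrite /glevel /=; lia.
Qed.

Lemma k_le s t : (1 <= s <= t)%N -> (k s <= k t)%N.
Proof.
move=> /andP[s1]; rewrite leq_eqVlt => /predU1P[->//|st].
by apply: ltnW; apply: k_lt; rewrite s1.
Qed.

Lemma k_ge s : (1 <= s)%N -> (s <= k s)%N.
Proof.
elim: s => // -[|s] IH _; first exact: k1_gt0.
by apply: (leq_ltn_trans (IH isT)); apply: k_lt; lia.
Qed.

(** The point is that the natural subtractions in [m] do not truncate: by the growth of [k], the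
    leading power exceeds everything subtracted. *)
Lemma m_lt n : (1 <= n)%N -> (m k n.-1 < m k n)%N.
Proof.
case: n => // -[|n] _ /=.
  have : (2 ^ 3 <= 2 ^ (k 1 + 2))%N by rewrite leq_exp2l//; lia.
  by lia.
have := @k_growth n.+2 isT; rewrite /glevel /=.
set a := k n.+1; set b := k n.+2; set e := (2 * n.+2)%N => ab.
have le1 : (2 ^ (a + 2) * 2 ^ (2 ^ e + 4) <= 2 ^ (b + 2))%N.
  by rewrite -expnD leq_exp2l//; lia.
have le2 : (2 ^ e < 2 ^ (2 ^ e))%N by exact: ltn_expl.
have le3 : (2 ^ (2 ^ e + 4) = 16 * 2 ^ (2 ^ e))%N by rewrite expnD mulnC.
have le4 : (4 <= 2 ^ (a + 2))%N by rewrite (@leq_exp2l 2 2)//; lia.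
have le5 : (2 ^ (a + 2) * (16 * (2 ^ e).+1) <= 2 ^ (b + 2))%N.
  by apply: leq_trans le1; rewrite le3 leq_mul2l leq_mul2l le2 !orbT.
have le6 : (2 ^ (a + 2) + 2 ^ (a + 2) * 2 ^ e <= 2 ^ (a + 2) * (16 * (2 ^ e).+1))%N.
  by rewrite -mulnS leq_mul2l; apply/orP; right; lia.
have le7 : (4 * 2 ^ e <= 2 ^ (a + 2) * 2 ^ e)%N by rewrite leq_mul2r le4 orbT.
have : (0 < 2 ^ e)%N by rewrite expn_gt0.
have : (2 ^ (a + 2) * (16 * (2 ^ e).+1) = 2 ^ (a + 2) * 16 + 16 * (2 ^ (a + 2) * 2 ^ e))%N by lia.
by lia.
Qed.

Lemma m_le a b : (a <= b)%N -> (m k a <= m k b)%N.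
Proof.
elim: b => [|b IH]; first by rewrite leqn0 => /eqP ->.
rewrite leq_eqVlt => /predU1P[->//|ab].
by apply: (leq_trans (IH ab)); apply: ltnW; exact: (@m_lt b.+1).
Qed.

Lemma m_ge n : (n <= m k n)%N.
Proof. by elim: n => // n IH; apply: (leq_ltn_trans IH); exact: (@m_lt n.+1). Qed.

Lemma p_ge2 n : (2 <= p k n)%N.
Proof. by rewrite /p -[X in (X <= _)%N]expn1 leq_exp2l//; lia. Qed.

Lemma rhoS n : rho k n.+1 = (rho k n + p k n.+1 * (m k n.+1 - m k n))%N.
Proof. by rewrite /rho big_nat_recr. Qed.

Lemma rho0 : rho k 0 = 0%N. Proof. by rewrite /rho big_geq. Qed.

Lemma rho_ge n : (2 * n <= rho k n)%N.
Proof.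
elim: n => // n IH; rewrite rhoS.
have p2 := p_ge2 n.+1; have mm : (m k n < m k n.+1)%N := @m_lt n.+1 isT.
have : (2 * 1 <= p k n.+1 * (m k n.+1 - m k n))%N by apply: leq_mul => //; lia.
lia.
Qed.

Lemma rho_le a b : (a <= b)%N -> (rho k a <= rho k b)%N.
Proof.
elim: b => [|b IH]; first by rewrite leqn0 => /eqP ->.
rewrite leq_eqVlt => /predU1P[->//|ab].
by apply: (leq_trans (IH ab)); rewrite rhoS leq_addr.
Qed.

(* [l] is the index of phi_j^nu, with nu in the n-th block. *)
Definition xi_index l n nu j : Prop :=
  [/\ (1 <= n)%N, (m k n.-1 + 1 <= nu <= m k n)%N, (1 <= j <= p k n)%N &
      l = (rho_at k n nu + j)%N].

Lemma xi_index_exists l : (1 <= l)%N -> exists n nu j, xi_index l n nu j.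
Proof.
move=> l1.
have [|n ln nmin] := @ex_minnP (fun n => (l <= rho k n)%N).
  by exists l; have := rho_ge l; lia.
case: n ln nmin => [|n] ln nmin; first by move: ln; rewrite rho0; lia.
have ln' : (rho k n < l)%N by rewrite ltnNge; apply/negP => /nmin; rewrite ltnn.
set d := (l - rho k n - 1)%N; set P := p k n.+1.
have P0 : (0 < P)%N by have := p_ge2 n.+1; rewrite -/P; lia.
have dP : (d < (m k n.+1 - m k n) * P)%N by move: ln; rewrite rhoS mulnC -/P /d; lia.
have qP : (d %/ P < m k n.+1 - m k n)%N by rewrite ltn_divLR.
have rP : (d %% P < P)%N by rewrite ltn_mod.
exists n.+1, (m k n + 1 + d %/ P)%N, (d %% P + 1)%N; split; rewrite ?succnK //; [|by rewrite -/P addn1 /= rP|].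
  by rewrite leq_addr andTb; move: qP; move: (d %/ P)%N => x; lia.
rewrite /rho_at succnK (_ : (m k n + 1 + d %/ P - m k n - 1 = d %/ P)%N); last first.
  by move: (d %/ P)%N => x; lia.
by have := divn_eq d P; rewrite -/P /d; lia.
Qed.

Section Index.
Variables (l n nu j : nat).
Hypothesis lnj : xi_index l n nu j.

Lemma xi_index_bounds : (rho k n.-1 < l <= rho k n)%N.
Proof.
have [n1 nunu jp ->] := lnj; case: n n1 nunu jp => // b _; rewrite succnK => nunu jp.
rewrite rhoS /rho_at succnK.
have : ((nu - m k b - 1).+1 * p k b.+1 <= p k b.+1 * (m k b.+1 - m k b))%N.
  by rewrite mulnC leq_mul2l; apply/orP; right; lia.
rewrite mulSn; move: (_ * p k b.+1)%N (p k b.+1 * _)%N => x y; lia.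
Qed.

(** Every block contains at least two indices. Consequently the level of the [psi_nu] inside [xi_l]
    is at most [k (l - 1) + 2]. *)
Lemma xi_index_lt : (2 <= l)%N -> (n < l)%N.
Proof.
have [n1 _ _ _] := lnj; have /andP[rl _] := xi_index_bounds => l2.
have [->//|n2] := eqVneq n 1%N.
by have := rho_ge n.-1; lia.
Qed.

Lemma nu_large B : (rho k B < l)%N -> (B < nu)%N.
Proof.
have [n1 nunu _ _] := lnj => Bl; have /andP[_ ln] := xi_index_bounds.
have Bn : (B < n)%N by rewrite ltnNge; apply/negP => /rho_le; lia.
by have := m_ge n.-1; lia.
Qed.

(** The Haar indices grow with [nu]; together with [nu_large] this pushes the supports of the Haar
    terms of [xi_l] towards 0. *)
Lemma q_at_ge : (nu - 1 <= q_at k n nu)%N.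
Proof.
have [n1 nunu _ _] := lnj; rewrite /q_at.
have le1 N : (m k N <= \sum_(1 <= i < N.+1) q k i)%N.
  elim: N => [|N IH]; first by rewrite big_geq.
  rewrite big_nat_recr// {2}/q succnK; have p2 := p_ge2 N.+1.
  have mm : (m k N < m k N.+1)%N := @m_lt N.+1 isT.
  have : (1 * (m k N.+1 - m k N) <= (p k N.+1 - 1) * (m k N.+1 - m k N))%N.
    by rewrite leq_mul2r; apply/orP; right; lia.
  rewrite mul1n; move: ((p k N.+1 - 1) * _)%N => x Dx.
  apply: (@leq_trans (\sum_(1 <= i < N.+1) q k i + x)%N); last by [].
  by move: IH mm Dx; clear; lia.
have := le1 n.-1; rewrite prednK//.
have : ((nu - m k n.-1 - 1) * 1 <= (nu - m k n.-1 - 1) * (p k n - 1))%N.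
  by rewrite leq_mul2l; apply/orP; right; have := p_ge2 n; lia.
rewrite muln1; move: ((nu - m k n.-1 - 1) * _)%N => x; lia.
Qed.

End Index.

Lemma xi_index_inj l l' n n' nu j j' : xi_index l n nu j -> xi_index l' n' nu j' -> n = n'.
Proof.
move=> [n1 nunu _ _] [n1' nunu' _ _].
have H a b : (1 <= a)%N -> (m k a.-1 + 1 <= nu)%N -> (nu <= m k b)%N -> (a <= b)%N.
  move=> a1 na nb; rewrite leqNgt; apply/negP => ba.
  have : (m k b <= m k a.-1)%N by apply: m_le; lia.
  lia.
by apply/eqP; rewrite eqn_leq; apply/andP; split; apply: H; lia.
Qed.

Lemma xi_index_count n nu j (s : seq nat) (l : nat) :
  uniq s -> xi_index l n nu j ->
  (forall i, i \in s -> exists n' j', xi_index i n' nu j') -> (size s <= p k n)%N.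
Proof.
move=> us lnu sP.
have sub : {subset s <= [seq (rho_at k n nu + i)%N | i <- iota 1 (p k n)]}.
  move=> i /sP[n' [j' inj]]; have e := xi_index_inj lnu inj; subst n'.
  have [_ _ jp ->] := inj; apply/mapP; exists j' => //.
  by rewrite mem_iota; lia.
by have := uniq_leq_size us sub; rewrite size_map size_iota.
Qed.

End Indices.

(** * Positions of the two kinds of functions in the enumeration *)

Section Blocks.
Variables (nu n : nat -> nat).
Hypothesis nu0_gt0 : (0 < nu 0)%N.
Hypothesis n_gt0 : forall j, (1 <= j)%N -> (0 < n j)%N.
Hypothesis nuE : forall j, (1 <= j)%N -> nu j = (nu j.-1 + 2 ^ n j - 1)%N.

Lemma nu_ltS j : (nu j < nu j.+1)%N.
Proof.
have := @n_gt0 j.+1 isT; have := @nuE j.+1 isT => /= -> n0.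
have : (2 <= 2 ^ n j.+1)%N by rewrite -[X in (X <= _)%N]expn1 leq_exp2l.
lia.
Qed.

Lemma nu_le i j : (i <= j)%N -> (nu i <= nu j)%N.
Proof.
elim: j => [|j IH]; first by rewrite leqn0 => /eqP ->.
rewrite leq_eqVlt => /predU1P[->//|ij].
by apply: (leq_trans (IH ij)); rewrite ltnW// nu_ltS.
Qed.

Lemma nu_gt j : (j < nu j)%N.
Proof. by elim: j => // j IH; apply: (leq_ltn_trans IH); exact: nu_ltS. Qed.

(* The number of blocks opened before the [s]-th Rademacher function. *)
Definition opened s := (\sum_(j < s) (nu j < s))%N.

Lemma openedE j s : (j = 0 \/ nu j.-1 < s)%N -> (s <= nu j)%N -> opened s = j.
Proof.
move=> js sj; rewrite /opened -(big_mkord xpredT (fun i => (nu i < s) : nat)).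
have js' : (j <= s)%N.
  by case: js => [->//|js]; have := nu_gt j.-1; lia.
rewrite (@big_cat_nat _ _ _ j)//= [X in (_ + X)%N]big_nat [X in (_ + X)%N]big1 ?addn0.
  rewrite big_nat (eq_bigr (fun=> 1%N)) => [|i /= ij].
    by rewrite -big_nat sum_nat_const_nat muln1 subn0.
  case: js => [j0|js]; first lia.
  by have /leq_ltn_trans/(_ js) -> : (nu i <= nu j.-1)%N by apply: nu_le; lia.
move=> i /andP[ji _]; rewrite ltnNge (leq_trans sj)// nu_le//.
Qed.

(** Position [nu l.-1 + l] holds [Upsilon_l], and the [s]-th Rademacher function is displaced by the
    [Upsilon] that precede it. *)
Lemma sum_blocks (V : nmodType) (h : nat -> V) j :
  \sum_(1 <= i < (nu j + j).+1) h i =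
  \sum_(1 <= l < j.+1) h (nu l.-1 + l)%N +
  \sum_(1 <= s < (nu j).+1) h (s + opened s)%N.
Proof.
elim: j => [|j IH].
  rewrite addn0 [X in _ = X + _]big_geq// add0r !big_nat; apply: eq_bigr => s s1.
  by rewrite (@openedE 0) ?addn0//; [left|lia].
have nn := nu_ltS j.
rewrite (@big_cat_nat _ _ _ (nu j + j).+1)//=; last lia.
rewrite IH [X in _ = X + _]big_nat_recr//=.
rewrite [X in _ = _ + X](@big_cat_nat _ _ _ (nu j).+1)//=; last lia.
rewrite (@big_ltn _ _ _ (nu j + j).+1); last lia.
rewrite [RHS]addrACA; congr (_ + (_ + _)); first by rewrite addnS.
have := big_addn (nu j).+1 (nu j.+1 + j.+1).+1 j.+1 xpredT h.
rewrite addSn addnS => ->.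
rewrite subSn ?leq_addl// addnK !big_nat; apply: eq_bigr => s s1.
by rewrite (@openedE j.+1)//; [right; rewrite succnK; lia|lia].
Qed.

End Blocks.

(** * The orthogonal matrices kappa *)

Section KappaAlgebra.
Context {R : realType}.

Lemma sqrt_gt1 N : (0 < N)%N -> 1 < Num.sqrt (N.+1%:R : R).
Proof. by move=> N0; rewrite -[ltLHS]sqrtr1 ltr_sqrt// ltr1n. Qed.

Lemma sqr_sqrtS N : Num.sqrt (N.+1%:R : R) ^+ 2 = N%:R + 1.
Proof. by rewrite sqr_sqrtr// natr1. Qed.

(** An orthogonal matrix preserves the norm. Substituting [N = r ^+ 2 - 1] makes [delta] rational in
    [r], and the identity becomes pure algebra. *)
Lemma kappa_energy N (b : nat -> R) : (0 < N)%N ->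
  let r := Num.sqrt (N.+1%:R : R) in
  let s := \sum_(i < N) b i in
  ((s + b N) / r) ^+ 2 + \sum_(i < N) (b i - delta R N * s + b N / r) ^+ 2 =
  \sum_(i < N.+1) b i ^+ 2.
Proof.
move=> N0 r s; rewrite big_ord_recr /=.
have r1 : 1 < r := sqrt_gt1 N0.
have r2 : N%:R = r ^+ 2 - 1 by rewrite sqr_sqrtS addrK.
pose c := b N / r - delta R N * s.
have -> : \sum_(i < N) (b i - delta R N * s + b N / r) ^+ 2 =
    \sum_(i < N) b i ^+ 2 + 2 * c * s + N%:R * c ^+ 2.
  rewrite (eq_bigr (fun i : 'I_N => b i ^+ 2 + 2 * c * b i + c ^+ 2)); last first.
    by move=> i _; rewrite /c; ring.
  by rewrite !big_split /= -mulr_sumr -/s sumr_const card_ord -[c ^+ 2 *+ N]mulr_natl.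
have e : delta R N = (1 + 1 / r) / (r ^+ 2 - 1) by rewrite /delta -r2 [1 / N%:R]div1r mulrC.
rewrite /c e r2; field; apply/andP; split; nra.
Qed.

Lemma delta_bounds N : (0 < N)%N -> 0 <= delta R N <= 2 / N%:R.
Proof.
move=> N0; have r1 := sqrt_gt1 N0; have NR : 0 < N%:R :> R by rewrite ltr0n.
rewrite /delta !div1r; have i1 : (Num.sqrt (N.+1%:R : R))^-1 <= 1.
  by rewrite invf_le1; [exact: ltW|exact: lt_trans ltr01 r1].
have i0 : 0 <= (Num.sqrt (N.+1%:R : R))^-1 by rewrite invr_ge0 sqrtr_ge0.
apply/andP; split.
  by rewrite mulr_ge0 ?invr_ge0 ?addr_ge0// ltW.
by rewrite mulrC ler_pM2r ?invr_gt0//; lra.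
Qed.

End KappaAlgebra.

Definition bsize s := (2 ^ (2 * s))%N.
Lemma bsize_gt0 s : (0 < bsize s)%N. Proof. by rewrite expn_gt0. Qed.

Lemma muS s : mu s.+1 = (mu s + bsize s.+1 + 1)%N. Proof. by []. Qed.

Lemma mu_ge s : (s <= mu s)%N.
Proof. by elim: s => // s IH; rewrite muS; lia. Qed.

Lemma mu_le s t : (s <= t)%N -> (mu s <= mu t)%N.
Proof.
elim: t => [|t IH]; first by rewrite leqn0 => /eqP ->.
rewrite leq_eqVlt => /predU1P[->//|st]; apply: (leq_trans (IH st)); rewrite muS; lia.
Qed.

(** * Partial sums grouped by blocks *)

Section System.
Context {R : realType}.
Variables (f : nat -> nat -> R -> R) (k : nat -> nat) (psi xi Upsilon : nat -> R -> R).
Variables (n nu : nat -> nat) (chi : nat -> R -> R) (a : nat -> R).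
Hypothesis hxi : xi_system k psi xi.
Hypothesis hUpsilon : Upsilon_system f k xi Upsilon.
Hypothesis hchi : chi_system k Upsilon n nu chi.
Hypothesis nu0_gt0 : (0 < nu 0)%N.
Hypothesis n_gt0 : forall j, (1 <= j)%N -> (0 < n j)%N.
Hypothesis nuE : forall j, (1 <= j)%N -> nu j = (nu j.-1 + 2 ^ n j - 1)%N.
Hypothesis k1_gt0 : (0 < k 1)%N.
Hypothesis k_growth : forall s, (2 <= s)%N ->
  (glevel k s + k s.-1 + 4 + 2 ^ (2 * s) <= k s)%N.

Definition bcoef l : R := a (nu l.-1 + l)%N.
Definition ccoef s : R := a (s + opened nu s)%N.
Definition psum j x : R := \sum_(1 <= i < (nu j + j).+1) a i * chi i x.

Lemma chi_rademacher s : (1 <= s)%N -> chi (s + opened nu s)%N = rademacher (k s).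
Proof.
move=> s1; have [|j sj jmin] := @ex_minnP (fun j => (s <= nu j)%N).
  by exists s; rewrite ltnW// (nu_gt nu0_gt0 n_gt0 nuE).
case: j sj jmin => [|j] sj jmin.
  rewrite (openedE nu0_gt0 n_gt0 nuE (j := 0))//; last by left.
  by rewrite addn0 (chi_block0 hchi)// s1.
have js : (nu j < s)%N by rewrite ltnNge; apply/negP => /jmin; rewrite ltnn.
rewrite (openedE nu0_gt0 n_gt0 nuE (j := j.+1))//; last by right.
have := @chi_block _ _ _ _ _ _ hchi j.+1 (s - nu j + 1)%N isT; rewrite succnK.
have := @nuE j.+1 isT; rewrite succnK => E.
rewrite (_ : (nu j + j.+1 + (s - nu j + 1) - 1 = s + j.+1)%N); last lia.
rewrite (_ : (nu j + (s - nu j + 1) - 1 = s)%N); last lia.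
by apply; lia.
Qed.

Lemma psumE j x : psum j x = \sum_(1 <= l < j.+1) bcoef l * Upsilon l x +
  \sum_(1 <= s < (nu j).+1) ccoef s * rademacher (k s) x.
Proof.
rewrite /psum (sum_blocks nu0_gt0 n_gt0 nuE (fun i => a i * chi i x)).
congr (_ + _); rewrite !big_nat; apply: eq_bigr => l /andP[l1 _].
  by rewrite (chi_block1 hchi).
by rewrite chi_rademacher.
Qed.

Lemma psum_diff j j' x : (j <= j')%N -> psum j' x - psum j x =
  \sum_(j.+1 <= l < j'.+1) bcoef l * Upsilon l x +
  \sum_((nu j).+1 <= s < (nu j').+1) ccoef s * rademacher (k s) x.
Proof.
move=> jj'; have nn := nu_le nu0_gt0 n_gt0 nuE jj'; rewrite !psumE.
rewrite [X in X + _ - _](@big_cat_nat _ _ _ j.+1)//=.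
rewrite [X in _ + X - _](@big_cat_nat _ _ _ (nu j).+1)//=.
by rewrite addrACA [LHS]addrC addKr.
Qed.

Lemma energyE j : \sum_(1 <= i < (nu j + j).+1) a i ^+ 2 =
  \sum_(1 <= l < j.+1) bcoef l ^+ 2 + \sum_(1 <= s < (nu j).+1) ccoef s ^+ 2.
Proof. exact: (sum_blocks nu0_gt0 n_gt0 nuE (fun i => a i ^+ 2)). Qed.

(** Counted from 0: [i < bsize s] belongs to the columns of kappa with an entry [1 - delta], and
    [i = bsize s] to the last, constant column. *)
Definition bblk s i : R := bcoef (mu s.-1 + i.+1)%N.
Definition ublk s i (x : R) : R := Upsilon (mu s.-1 + i.+1)%N x.
Definition rblk s : R := Num.sqrt ((bsize s).+1)%:R.

Lemma sum_blk s J J' x : (J <= J')%N ->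
  \sum_((mu s.-1 + J).+1 <= l < (mu s.-1 + J').+1) bcoef l * Upsilon l x =
  \sum_(J <= i < J') bblk s i * ublk s i x.
Proof.
move=> JJ.
have := big_addn J (mu s.-1 + J').+1 (mu s.-1).+1 xpredT (fun l => bcoef l * Upsilon l x).
rewrite addnS [(J + _)%N]addnC => ->.
rewrite (_ : ((mu s.-1 + J').+1 - (mu s.-1).+1 = J')%N); last lia.
by apply: eq_bigr => i _; rewrite /bblk /ublk addnS addnC addnS.
Qed.

Lemma ublkE s i x : (1 <= s)%N -> (i <= bsize s)%N ->
  ublk s i x = xi s x / rblk s +
    if (i < bsize s)%N then g f k s i x - delta R (bsize s) * \sum_(j < bsize s) g f k s j x
    else (\sum_(j < bsize s) g f k s j x) / rblk s.
Proof.
move=> s1 iN; have ii : (1 <= i.+1 <= 2 ^ (2 * s) + 1)%N by rewrite addn1 /= ltnS.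
rewrite /ublk (hUpsilon s1 ii) /Upsilon_block -/(bsize s) addn1.
congr (_ + _); first by rewrite /kappa eqxx /= mulrC div1r.
have := big_addn 0 (bsize s).+2 2 xpredT
  (fun i0 => kappa R (bsize s).+1 i0 i.+1 * g f k s (i0 - 2) x).
rewrite add0n => ->; rewrite subn2 [_.-2]/= big_mkord.
rewrite (eq_bigr (fun j : 'I_(bsize s) => kappa R (bsize s).+1 (j + 2) i.+1 * g f k s j x)); last first.
  by move=> j _; rewrite addnK.
have kE (j : 'I_(bsize s)) : kappa R (bsize s).+1 (j + 2) i.+1 =
    if (i < bsize s)%N then (i == j)%:R - delta R (bsize s) else (rblk s)^-1.
  rewrite /kappa addn2 eqSS -/(rblk s) div1r [_.+1.-1]/= eqSS.
  case: ltnP => iN'; last by rewrite (_ : i == bsize s) ?orbT// eqn_leq iN iN'.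
  rewrite (ltn_eqF iN') orbF.
  by rewrite /= eqSS; case: eqP => _; rewrite /= ?sub0r.
under eq_bigr => j _ do rewrite kE.
case: ltnP => iN'; last by rewrite -mulr_sumr mulrC.
rewrite (eq_bigr (fun j : 'I_(bsize s) => (i == j)%:R * g f k s j x - delta R (bsize s) * g f k s j x)).
  rewrite sumrB -mulr_sumr; congr (_ - _).
  rewrite (bigD1 (Ordinal iN'))//= eqxx mul1r big1 ?addr0// => j /negP ji.
  rewrite (_ : i == j = false) ?mul0r//; apply/negbTE/negP => /eqP ij; apply: ji.
  by apply/eqP/val_inj.
by move=> j _; rewrite mulrBl.
Qed.

Definition gam s : R := (\sum_(i < (bsize s).+1) bblk s i) / rblk s.
Definition bet s i : R := bblk s i -
  delta R (bsize s) * (\sum_(j < bsize s) bblk s j) + bblk s (bsize s) / rblk s.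

Lemma block_energy s : gam s ^+ 2 + \sum_(i < bsize s) bet s i ^+ 2 =
  \sum_(i < (bsize s).+1) bblk s i ^+ 2.
Proof. by rewrite /gam big_ord_recr; exact: (kappa_energy _ (bsize_gt0 s)). Qed.

Lemma block_sum s x : (1 <= s)%N ->
  \sum_(0 <= i < (bsize s).+1) bblk s i * ublk s i x =
  gam s * xi s x + \sum_(i < bsize s) bet s i * g f k s i x.
Proof.
move=> s1; rewrite big_mkord big_ord_recr /= ublkE// ltnn.
rewrite (eq_bigr (fun i : 'I_(bsize s) => xi s x / rblk s * bblk s i + bblk s i * g f k s i x
   - delta R (bsize s) * (\sum_(j < bsize s) g f k s j x) * bblk s i)); last first.
  by move=> i _; rewrite ublkE ?ltn_ord// 1?ltnW//; ring.
rewrite (eq_bigr (fun i : 'I_(bsize s) => bblk s i * g f k s i x +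
   (bblk s (bsize s) / rblk s - delta R (bsize s) * \sum_(j < bsize s) bblk s j) * g f k s i x)
   (r := index_enum 'I_(bsize s)) (F1 := fun i => bet s i * g f k s i x)); last first.
  by move=> i _; rewrite /bet; ring.
rewrite sumrB !big_split /= -!mulr_sumr /gam big_ord_recr /=; ring.
Qed.

Lemma psum_blocks m1 m2 x : (1 <= m1 <= m2)%N ->
  psum (mu m2.-1) x - psum (mu m1.-1) x =
  \sum_(m1 <= s < m2) (gam s * xi s x + \sum_(i < bsize s) bet s i * g f k s i x) +
  \sum_((nu (mu m1.-1)).+1 <= s < (nu (mu m2.-1)).+1) ccoef s * rademacher (k s) x.
Proof.
move=> /andP[m11 m12]; rewrite psum_diff; last by apply: mu_le; lia.
congr (_ + _); elim: m2 m12 => [|m2 IH] m12; first by lia.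
have [m1m2|m1m2] := leqP m1 m2; last first.
  have -> : m1 = m2.+1 by lia.
  by rewrite !big_geq.
rewrite [RHS]big_nat_recr//= -IH// -block_sum//; last lia.
have m2S : m2 = m2.-1.+1 by lia.
have e : mu m2 = (mu m2.-1 + (bsize m2).+1)%N by rewrite {1}m2S muS -m2S addn1 addnS.
rewrite (@big_cat_nat _ _ _ (mu m2.-1).+1)/=; first last.
- by rewrite e; lia.
- by rewrite ltnS; apply: mu_le; lia.
congr (_ + _); rewrite -sum_blk// e addn0//.
Qed.

End System.

(** * The functions xi away from 0 *)

Section XiFarFromZero.
Context {R : realType}.
Local Notation mu := (@lebesgue_measure R).
Variables (f : nat -> nat -> R -> R) (k : nat -> nat) (psi xi : nat -> R -> R).
Variables (Z : set R) (z : R).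
Hypothesis cZ : countable Z.
Hypothesis gz : generic Z z.
Hypothesis Zpsi : forall v l, dyadic_step 0 1 l (psi v) -> step_off Z l (psi v).
Hypothesis hpsi : psi_system f k psi.
Hypothesis hxi : xi_system k psi xi.
Hypothesis k1_gt0 : (0 < k 1)%N.
Hypothesis k_growth : forall s, (2 <= s)%N ->
  (glevel k s + k s.-1 + 4 + 2 ^ (2 * s) <= k s)%N.

Let z01 : 0 < z < 1 := gz.1.
Local Notation xi_index := (xi_index k).

Lemma haar1_far K (x : R) : 2 ^- K <= x -> haar1 K x = 0.
Proof.
move=> Kx; rewrite /haar1 ifF; last first.
  apply: negbTE; rewrite negb_and -!leNgt; apply/orP; right; apply: le_trans Kx.
  by rewrite lef_pV2 ?posrE ?exprn_gt0// ler_weXn2l// ler1n.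
by rewrite ifF//; apply: negbTE; rewrite negb_and -!leNgt Kx orbT.
Qed.

(** The level of every Haar term is at least [v], so all of them vanish at [x] and only the multiple
    of [psi v] remains. *)
Lemma xi_far l b v j l0 x : xi_index l b v j -> (l0 <= v)%N -> 2 ^- l0 <= x ->
  xi l x = psi v x / Num.sqrt (p k b)%:R.
Proof.
move=> lbv l0v xl; have [b1 vm jp lE] := lbv.
rewrite lE (hxi b1 vm jp) /phi big_nat big1 ?addr0.
  by rewrite /kappa eqxx /= mulrC div1r.
move=> i /andP[i2 _]; rewrite haar1_far ?mulr0//; apply: le_trans xl.
rewrite lef_pV2 ?posrE ?exprn_gt0// ler_weXn2l ?ler1n//.
have qv := q_at_ge k1_gt0 k_growth lbv.
apply: (leq_trans l0v); apply: leqW.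
have s1 : (1 <= q_at k b v + i - 1)%N by lia.
by apply: leq_trans (k_ge k1_gt0 k_growth s1); lia.
Qed.

Lemma dyadic_step_mono l l' (F : R -> R) : (l <= l')%N ->
  dyadic_step 0 1 l F -> dyadic_step 0 1 l' F.
Proof.
move=> ll' sF i il'; have [|c cP] := sF (i %/ 2 ^ (l' - l))%N.
  by rewrite ltn_divLR ?expn_gt0// -expnD subnKC.
exists c; apply: sub_finite_set cP => x [x01 Fx]; split => //.
move: x01; rewrite /= !in_itv /= !add0r !subr0 !mul1r => /andP[x1 x2].
have P0 (d : nat) : 0 < (2 : R) ^+ d by rewrite exprn_gt0.
have -> : (2 : R) ^- l = 2 ^+ (l' - l) * 2 ^- l'.
  have -> : (2 : R) ^+ l' = 2 ^+ (l' - l) * 2 ^+ l by rewrite -exprD subnK.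
  by rewrite invfM mulrA divff ?mul1r// gt_eqF.
apply/andP; split.
  apply: le_lt_trans x1; rewrite mulrA ler_pM2r ?invr_gt0// -natrX -natrM ler_nat.
  exact: leq_trunc_div.
apply: (lt_le_trans x2); rewrite mulrA ler_pM2r ?invr_gt0// -natrX -natrM ler_nat.
by rewrite ltn_ceil// expn_gt0.
Qed.

Lemma psi_dyadic_step b v : (1 <= b)%N -> (m k b.-1 < v <= m k b)%N ->
  dyadic_step 0 1 (k b + 2) (psi v).
Proof.
move=> b1 vb; have [/(_ v vb) [+ _ _ _] _ _] := psi_basis hpsi b1.
by case: eqP => [->//|_ []].
Qed.

Lemma innerC (F G : R -> R) : inner 0 1 F G = inner 0 1 G F.
Proof. by congr fine; apply: eq_integral => x _; rewrite mulrC. Qed.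

(** Inside one block this is the basis property; across blocks, the later function is orthogonal to
    all step functions of the earlier level. *)
Lemma psi_inner b v b' v' : (1 <= b)%N -> (m k b.-1 < v <= m k b)%N ->
  (1 <= b')%N -> (m k b'.-1 < v' <= m k b')%N ->
  inner 0 1 (psi v) (psi v') = (v == v')%:R.
Proof.
wlog bb' : b v b' v' / (b <= b')%N.
  move=> H b1 vb b'1 vb'; have [bb'|bb'] := leqP b b'; first exact: (H b v b' v').
  by rewrite innerC eq_sym; apply: (H b' v' b v) => //; exact: ltnW.
move=> b1 vb b'1 vb'.
move: bb'; rewrite leq_eqVlt => /predU1P[bb'|bb'].
  have [_ on _] := psi_basis hpsi b1; apply: on => //; by rewrite bb'.
have [/(_ v' vb') [+ _ _ _] _ _] := psi_basis hpsi b'1.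
rewrite ifF; last by apply/negbTE; lia.
move=> [_ ort]; have le : (m k b <= m k b'.-1)%N by apply: m_le => //; lia.
rewrite innerC ort; last first.
  apply: dyadic_step_mono (psi_dyadic_step b1 vb).
  by rewrite leq_add2r; apply: k_le => //; lia.
by rewrite (_ : v == v' = false)//; apply/negbTE; lia.
Qed.

Lemma psi_avg K b v b' v' : (1 <= b)%N -> (m k b.-1 < v <= m k b)%N ->
  (1 <= b')%N -> (m k b'.-1 < v' <= m k b')%N ->
  (k b + 2 <= K)%N -> (k b' + 2 <= K)%N ->
  avg K 0 0 (fun i => psi v (pt z K i) * psi v' (pt z K i)) = (v == v')%:R.
Proof.
move=> b1 vb b'1 vb' bK b'K; rewrite -(psi_inner b1 vb b'1 vb') /inner.
have s1 := Zpsi (dyadic_step_mono bK (psi_dyadic_step b1 vb)).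
have s2 := Zpsi (dyadic_step_mono b'K (psi_dyadic_step b'1 vb')).
rewrite (@integral_step _ (fun x => psi v x * psi v' x) Z z K cZ gz)//.
by move=> i x y iK xi' yi' nx ny; rewrite (s1 i x y)// (s2 i x y).
Qed.

Lemma cell_lt K l c i : (l <= K)%N -> (c < 2 ^ l)%N -> (i %/ 2 ^ (K - l) = c)%N ->
  (i < 2 ^ K)%N.
Proof.
move=> lK cl ic; have := ltn_ceil i (_ : (0 < 2 ^ (K - l))%N).
rewrite expn_gt0 ic => /(_ isT) iK; apply: (leq_trans iK).
have -> : (2 ^ K = 2 ^ l * 2 ^ (K - l))%N by rewrite -expnD subnKC.
by rewrite leq_mul2r cl orbT.
Qed.

Lemma pt_far K l c i : (l <= K)%N -> (0 < c)%N -> (i %/ 2 ^ (K - l) = c)%N ->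
  2 ^- l <= pt z K i.
Proof.
move=> lK c0 ic; have /andP[+ _] := pt_cell z01 i lK; rewrite ic => /ltW; apply: le_trans.
by rewrite -[leLHS]mul1r ler_pM2r ?invr_gt0 ?exprn_gt0// ler1n.
Qed.

(** There [xi_s] is a multiple of some [psi_v] from a block [b < s], whose level [k b + 2] is at
    most [glevel k s]. *)
Lemma xi_step K l c s : (0 < c < 2 ^ l)%N -> (2 <= s)%N -> (rho k l < s)%N ->
  (l <= K)%N -> (glevel k s <= K)%N ->
  step_in K l c (glevel k s) (fun i => xi s (pt z K i)).
Proof.
move=> /andP[c0 cl] s2 ls lK sK i j ic ij.
have s1 : (1 <= s)%N by lia.
have [b [v [j' sbv]]] := xi_index_exists k1_gt0 k_growth s1.
have lv := nu_large k1_gt0 k_growth sbv ls.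
have bs := xi_index_lt k1_gt0 k_growth sbv s2.
have [b1 vm _ _] := sbv.
have kb : (k b + 2 <= glevel k s)%N.
  by have := @k_le _ k1_gt0 k_growth b s.-1; rewrite /glevel; move: b1 bs; clear; lia.
have lL : (l <= glevel k s)%N.
  have := rho_ge k1_gt0 k_growth l; have := @k_ge _ k1_gt0 k_growth s.-1.
  by rewrite /glevel; move: ls s2; clear; lia.
have jc : (j %/ 2 ^ (K - l) = c)%N.
  have lLK : (l <= glevel k s <= K)%N by lia.
  by rewrite -(divn_pow2 j lLK) -ij (divn_pow2 i lLK).
rewrite !(xi_far sbv (ltnW lv)) ?(pt_far lK c0)//; congr (_ / _).
have vb : (m k b.-1 < v <= m k b)%N by lia.
have st := Zpsi (dyadic_step_mono kb (psi_dyadic_step b1 vb)).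
by apply: (step_pt st gz) => //; exact: cell_lt ic.
Qed.

Lemma avg_sub_le K l c (F : nat -> R) : (l <= K)%N -> (c < 2 ^ l)%N ->
  (forall i, 0 <= F i) -> avg K l c F <= 2 ^+ l * avg K 0 0 F.
Proof.
move=> lK cl F0; rewrite (@avg_tower _ K l 0)//= {2}/avg subn0 mulrC divfK; last first.
  by rewrite expf_neq0.
rewrite (bigD1 (Ordinal cl))//= mul0n add0n lerDl.
by apply: sumr_ge0 => i _; exact: avg_ge0.
Qed.

(* Bessel: away from 0 the xi_s are multiples of the psi_v, each psi_v being
   used for at most p(b) values of s with the factor p(b)^(-1/2). *)
Lemma xi_bessel K l c m1 m2 (gam : nat -> R) : (0 < c < 2 ^ l)%N -> (l <= K)%N ->
  (2 <= m1 <= m2)%N -> (rho k l < m1)%N -> (k m2 <= K)%N ->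
  avg K l c (fun i => (\sum_(m1 <= s < m2) gam s * xi s (pt z K i)) ^+ 2) <=
  2 ^+ l * \sum_(m1 <= s < m2) gam s ^+ 2.
Proof.
move=> /andP[c0 cl] lK m12 lm1 m2K.
have /choice[w wP] : forall s : nat, exists w : nat * nat * nat,
    (1 <= s)%N -> xi_index s w.1.1 w.1.2 w.2.
  move=> s; have [s0|s1] := posnP s; first by exists (0, 0, 0)%N; rewrite s0.
  have [b [v [j sbv]]] := xi_index_exists k1_gt0 k_growth s1.
  by exists (b, v, j).
pose b s := (w s).1.1; pose v s := (w s).1.2.
have wP' s : (m1 <= s)%N -> xi_index s (b s) (v s) (w s).2 by move=> ms; apply: wP; lia.
pose r s : R := Num.sqrt (p k (b s))%:R.
have r0 s : 0 < r s by rewrite sqrtr_gt0 ltr0n; have := p_ge2 k1_gt0 (b s); lia.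
pose T i := \sum_(m1 <= s < m2) gam s / r s * psi (v s) (pt z K i).
have -> : avg K l c (fun i => (\sum_(m1 <= s < m2) gam s * xi s (pt z K i)) ^+ 2) =
    avg K l c (fun i => T i ^+ 2).
  apply: avg_ext => i ic; congr (_ ^+ 2); rewrite /T !big_nat; apply: eq_bigr => s /andP[ms _].
  have lv := nu_large k1_gt0 k_growth (wP' s ms) (leq_trans lm1 ms).
  by rewrite (xi_far (wP' s ms) (ltnW lv)) ?(pt_far lK c0)// /r mulrAC mulrA.
(* Orthogonality holds on [[0, 1]] only, so the cell is enlarged to the whole interval at the cost
   of [2 ^+ l]. *)
apply: (le_trans (avg_sub_le lK cl _)); first by move=> i; exact: sqr_ge0.
rewrite ler_pM2l ?exprn_gt0//.
have kb s : (m1 <= s < m2)%N -> (k (b s) + 2 <= K)%N.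
  move=> /andP[ms sm]; have s2 : (2 <= s)%N by lia.
  have bs := xi_index_lt k1_gt0 k_growth (wP' s ms) s2.
  have [b1 _ _ _] := wP' s ms.
  have := @k_le _ k1_gt0 k_growth (b s) s.-1; have := k_growth s2.
  have := @k_le _ k1_gt0 k_growth s m2; rewrite /glevel; lia.
have -> : avg K 0 0 (fun i => T i ^+ 2) =
    \sum_(m1 <= s < m2) \sum_(m1 <= t < m2)
      gam s / r s * (gam t / r t) * (v s == v t)%:R.
  rewrite (avg_ext (H := fun i => \sum_(m1 <= s < m2) \sum_(m1 <= t < m2)
      gam s / r s * (gam t / r t) * (psi (v s) (pt z K i) * psi (v t) (pt z K i)))); last first.
    move=> i _; rewrite expr2 /T mulr_suml; apply: eq_bigr => s _.
    by rewrite mulr_sumr; apply: eq_bigr => t _; ring.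
  rewrite avg_sum !big_nat; apply: eq_bigr => s sm.
  rewrite avg_sum !big_nat; apply: eq_bigr => t tm; rewrite avgZ; congr (_ * _).
  have /andP[ms _] := sm; have /andP[mt _] := tm.
  have [bs1 vs _ _] := wP' s ms; have [bt1 vt _ _] := wP' t mt.
  by apply: (psi_avg bs1 _ bt1) => //; [lia|lia|exact: kb|exact: kb].
have samep s t : (m1 <= s)%N -> (m1 <= t)%N -> v s = v t -> b s = b t.
  move=> ms mt st; have := wP' t mt; rewrite -st; exact: (xi_index_inj k1_gt0 k_growth (wP' s ms)).
have cnt s : (m1 <= s)%N -> \sum_(m1 <= t < m2) (v s == v t)%:R <= (p k (b s))%:R :> R.
  move=> ms; rewrite -natr_sum ler_nat.
  have -> : (\sum_(m1 <= t < m2) (v s == v t) = \sum_(m1 <= t < m2 | v s == v t) 1)%N.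
    by rewrite [RHS]big_mkcond; apply: eq_bigr => t _; case: (_ == _).
  rewrite sum1_count -size_filter.
  apply: (@xi_index_count _ k1_gt0 k_growth (b s) (v s) (w s).2 _ s) (wP' s ms) _.
    by rewrite filter_uniq// iota_uniq.
  move=> t; rewrite mem_filter mem_index_iota => /andP[/eqP vst /andP[mt _]].
  by exists (b t), (w t).2; rewrite vst; exact: wP'.
have pE s : (p k (b s))%:R = r s ^+ 2 :> R by rewrite sqr_sqrtr.
(* Products with a common [psi] are split by [2xy <= x^2 + y^2]; each [s] has at most [r s ^+ 2]
   partners, which cancels the denominator. *)
pose A := \sum_(m1 <= s < m2) \sum_(m1 <= t < m2) gam s ^+ 2 / r s ^+ 2 * (v s == v t)%:R.
have A_le : A <= \sum_(m1 <= s < m2) gam s ^+ 2.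
  rewrite /A !big_nat; apply: ler_sum => s /andP[ms _]; rewrite -mulr_sumr.
  rewrite mulrAC ler_pdivrMr ?exprn_gt0// ler_wpM2l ?sqr_ge0//.
  by apply: (le_trans (cnt s ms)); rewrite pE.
apply: le_trans A_le; apply: (@le_trans _ _ ((A + A) / 2)); last by lra.
have A2 : A = \sum_(m1 <= s < m2) \sum_(m1 <= t < m2) gam t ^+ 2 / r t ^+ 2 * (v t == v s)%:R.
  by rewrite /A exchange_big.
rewrite [X in _ <= (_ + X) / 2]A2 /A -big_split /= mulr_suml !big_nat.
apply: ler_sum => s /andP[ms _]; rewrite -big_split /= mulr_suml !big_nat.
apply: ler_sum => t /andP[mt _]; rewrite [v t == v s]eq_sym.
case: eqP => [st|_]; last by rewrite !mulr0 addr0 mul0r.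
rewrite !mulr1 (_ : r t = r s); last by rewrite /r (samep t s).
rewrite -subr_ge0 [X in 0 <= X](_ : _ = (gam s - gam t) ^+ 2 / (2 * r s ^+ 2)); last first.
  by field; rewrite gt_eqF.
by rewrite divr_ge0 ?sqr_ge0// mulr_ge0// sqr_ge0.
Qed.

End XiFarFromZero.

(** * Oscillation on a fixed proportion of each cell *)

Section NuMu.
Variables (nu n : nat -> nat).
Hypothesis nu0_gt0 : (0 < nu 0)%N.
Hypothesis n_gt0 : forall j, (1 <= j)%N -> (0 < n j)%N.
Hypothesis nuE : forall j, (1 <= j)%N -> nu j = (nu j.-1 + 2 ^ n j - 1)%N.

Lemma nu_mu_ge m1 : (1 <= m1)%N -> (m1 <= nu (mu m1.-1))%N.
Proof.
move=> m11; have := nu_gt nu0_gt0 n_gt0 nuE (mu m1.-1); have := mu_ge m1.-1; lia.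
Qed.

Lemma nu_mu_le m1 m2 : (m1 <= m2)%N -> (nu (mu m1.-1) <= nu (mu m2.-1))%N.
Proof. by move=> m12; apply: (nu_le nu0_gt0 n_gt0 nuE); apply: mu_le; lia. Qed.

End NuMu.

(** * Windows of large energy *)

Section Spread.
Context {R : realType}.
Variables (f : nat -> nat -> R -> R) (k : nat -> nat) (psi xi Upsilon : nat -> R -> R).
Variables (n nu : nat -> nat) (chi : nat -> R -> R) (a : nat -> R).
Variables (Z : set R) (z : R).
Hypothesis hxi : xi_system k psi xi.
Hypothesis hUpsilon : Upsilon_system f k xi Upsilon.
Hypothesis hchi : chi_system k Upsilon n nu chi.
Hypothesis nu0_gt0 : (0 < nu 0)%N.
Hypothesis n_gt0 : forall j, (1 <= j)%N -> (0 < n j)%N.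
Hypothesis nuE : forall j, (1 <= j)%N -> nu j = (nu j.-1 + 2 ^ n j - 1)%N.
Hypothesis k1_gt0 : (0 < k 1)%N.
Hypothesis k_growth : forall s, (2 <= s)%N ->
  (glevel k s + k s.-1 + 4 + 2 ^ (2 * s) <= k s)%N.
Hypothesis cZ : countable Z.
Hypothesis gz : generic Z z.
Hypothesis Zg : forall s j, (1 <= s)%N -> (j < 2 ^ (2 * s))%N -> step_off Z (k s) (g f k s j).
Hypothesis Zpsi : forall v l, dyadic_step 0 1 l (psi v) -> step_off Z l (psi v).
Hypothesis hpsi : psi_system f k psi.

Let z01 : 0 < z < 1 := gz.1.
Local Notation psum := (psum nu chi a).
Local Notation ccoef := (ccoef nu a).
Local Notation gam := (gam nu a).
Local Notation bet := (bet nu a).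

(** Only finitely many sums are involved, so the condition is decided on the cells of some level, up
    to [Z]. *)
Definition quiet J0 J1 : set R := [set x | forall j j', (J0 <= j <= J1)%N ->
  (J0 <= j' <= J1)%N -> `|psum j x - psum j' x| <= 1 / 10].

Definition small_cell J0 l c (t : R) : Prop := exists J1 K1, forall K, (K1 <= K)%N ->
  avg K l c (fun i => (`[< quiet J0 J1 (pt z K i) >])%:R) <= t.

(** Layer [s] couples the [g_s^j] with the Rademacher function of level [k s], but in a window these
    occur for different ranges of [s]; padding with zeros gives both one range. *)
Definition wbet m2 s j : R := if (s < m2)%N then bet s j else 0.
Definition wcc m1 s : R := if (nu (mu m1.-1) < s)%N then ccoef s else 0.
Definition wlayer K m1 m2 i : R := \sum_(m1 <= s < (nu (mu m2.-1)).+1)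
   layer K k bsize (gval f k z K) (wbet m2) (wcc m1) s i.
Definition wenergy m1 m2 : R :=
  \sum_(m1 <= s < m2) \sum_(j < bsize s) bet s j ^+ 2 +
  \sum_((nu (mu m1.-1)).+1 <= s < (nu (mu m2.-1)).+1) ccoef s ^+ 2.

Lemma psum_layers K m1 m2 i : (1 <= m1 <= m2)%N -> (k (nu (mu m2.-1)) < K)%N ->
  psum (mu m2.-1) (pt z K i) - psum (mu m1.-1) (pt z K i) =
  \sum_(m1 <= s < m2) gam s * xi s (pt z K i) + wlayer K m1 m2 i.
Proof.
move=> /andP[m11 m12] kK; have m21 : (1 <= m2)%N by lia.
have m1n := nu_mu_ge nu0_gt0 n_gt0 nuE m11; have m2n := nu_mu_ge nu0_gt0 n_gt0 nuE m21; have nn := nu_mu_le nu0_gt0 n_gt0 nuE m12.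
rewrite (psum_blocks a hUpsilon hchi nu0_gt0 n_gt0 nuE)//; last by rewrite m11.
rewrite big_split /= -addrA; congr (_ + _).
rewrite /wlayer /layer big_split /=; congr (_ + _).
  rewrite [RHS](@big_cat_nat _ _ _ m2)//=; last by lia.
  rewrite [X in _ = _ + X]big_nat [X in _ = _ + X]big1 ?addr0; last first.
    move=> s /andP[m2s _]; rewrite big1// => j _; rewrite /wbet ltnNge m2s mul0r//.
  rewrite !big_nat; apply: eq_bigr => s /andP[_ sm]; apply: eq_bigr => j _.
  by rewrite /wbet sm.
rewrite [RHS](@big_cat_nat _ _ _ (nu (mu m1.-1)).+1)//=; last by lia.
rewrite [X in _ = X + _]big_nat [X in _ = X + _]big1 ?add0r; last first.
  by move=> s /andP[_ sn]; rewrite /wcc ltnNge -ltnS sn mul0r.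
rewrite !big_nat; apply: eq_bigr => s /andP[sn s2]; rewrite /wcc sn (rademacher_pt z01)//.
by apply: leq_ltn_trans kK; apply: (k_le k1_gt0 k_growth); lia.
Qed.

Lemma wenergyE m1 m2 : (1 <= m1 <= m2)%N ->
  \sum_(m1 <= s < (nu (mu m2.-1)).+1)
    (\sum_(j < bsize s) wbet m2 s j ^+ 2 + wcc m1 s ^+ 2) = wenergy m1 m2.
Proof.
move=> /andP[m11 m12]; have m21 : (1 <= m2)%N by lia.
have m1n := nu_mu_ge nu0_gt0 n_gt0 nuE m11; have m2n := nu_mu_ge nu0_gt0 n_gt0 nuE m21; have nn := nu_mu_le nu0_gt0 n_gt0 nuE m12.
rewrite big_split /=; congr (_ + _).
  rewrite [LHS](@big_cat_nat _ _ _ m2)//=; last by lia.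
  rewrite [X in _ + X = _]big_nat [X in _ + X = _]big1 ?addr0; last first.
    by move=> s /andP[m2s _]; rewrite big1// => j _; rewrite /wbet ltnNge m2s expr0n.
  rewrite !big_nat; apply: eq_bigr => s /andP[_ sm]; apply: eq_bigr => j _.
  by rewrite /wbet sm.
rewrite [LHS](@big_cat_nat _ _ _ (nu (mu m1.-1)).+1)//=; last by lia.
rewrite [X in X + _ = _]big_nat [X in X + _ = _]big1 ?add0r; last first.
  by move=> s /andP[_ sn]; rewrite /wcc ltnNge -ltnS sn expr0n.
by rewrite !big_nat; apply: eq_bigr => s /andP[sn s2]; rewrite /wcc sn.
Qed.

(** Energy at least 1 makes the normalising factor [t] at most 1, so closeness within [d] is
    preserved, and [65 / 33] is [1 + 32 / 33]. For [d] up to 2/10 the proportion obtained is below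
    999/1000. *)
Lemma spread K l c m1 m2 (v d : R) (P : pred nat) :
  (2 <= m1 <= m2)%N -> (l <= glevel k m1)%N -> (k (nu (mu m2.-1)) < K)%N ->
  1 <= wenergy m1 m2 ->
  (forall i, (i %/ 2 ^ (K - l) = c)%N -> P i -> `|v + wlayer K m1 m2 i| <= d) ->
  (2 - d ^+ 2 / 2) * avg K l c (fun i => (P i)%:R) <= 65 / 33.
Proof.
move=> m12 lL kK V1 Pd.
have m12' : (1 <= m1 <= m2)%N by lia.
have m11 : (1 <= m1)%N by lia.
have V0 : 0 < wenergy m1 m2 by apply: lt_le_trans V1.
pose t : R := (Num.sqrt (wenergy m1 m2))^-1.
have t0 : 0 < t by rewrite invr_gt0 sqrtr_gt0.
have t1 : t <= 1.
  by rewrite invf_le1 ?sqrtr_gt0// -[leLHS]sqrtr1 ler_wsqrtr.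
have t2 : t ^+ 2 * wenergy m1 m2 = 1.
  by rewrite exprVn sqr_sqrtr ?ltW// mulVf// gt_eqF.
have lay := layers_g gz Zg K (_ : (2 <= m1)%N).
have {}lay : layers K (glevel k) k bsize (gkap k) (gval f k z K) m1 by apply: lay; lia.
have := @avg_cos_layers _ K (glevel k) k bsize (gkap k) (gval f k z K) m1
  (wbet m2) (wcc m1) (nu (mu m2.-1)).+1 l c (t * v) t lay.
have s01 : (m1 <= (nu (mu m2.-1)).+1)%N.
  by have := nu_mu_ge nu0_gt0 n_gt0 nuE m11; have := nu_mu_le nu0_gt0 n_gt0 nuE (m1 := m1) (m2 := m2); lia.
have kK' s : (m1 <= s < (nu (mu m2.-1)).+1)%N -> (k s < K)%N.
  by move=> ss; apply: leq_ltn_trans kK; apply: (k_le k1_gt0 k_growth); lia.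
rewrite wenergyE// => /(_ s01 lL kK' t2) /(le_trans (ler_norm _)) cosle.
have -> : 65 / 33 = 1 + 32 / 33 :> R by field.
apply: (@avg_small_le _ _ _ _ (fun i => t * v + t * wlayer K m1 m2 i)) => // i ic Pi.
rewrite -mulrDr normrM gtr0_norm//.
have := Pd i ic Pi; apply: le_trans; rewrite ler_piMl//.
Qed.

Lemma quiet_diff J0 J1 j j' x : quiet J0 J1 x -> (J0 <= j <= J1)%N -> (J0 <= j' <= J1)%N ->
  `|psum j x - psum j' x| <= 1 / 10.
Proof. by move=> q; exact: q. Qed.

(* A block with large g-energy: xi is frozen on the cells of level [glevel]. *)
Lemma spread_one_block J0 l c s : (0 < c < 2 ^ l)%N -> (2 <= s)%N ->
  (rho k l < s)%N -> (l <= glevel k s)%N -> (J0 <= mu s.-1)%N ->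
  1 <= \sum_(j < bsize s) bet s j ^+ 2 -> small_cell J0 l c (999 / 1000).
Proof.
move=> cl s2 ls lL Js bs1; exists (mu s), (k (nu (mu s))).+1 => K kK.
have s1 : (1 <= s)%N by lia.
have ss1 : (s <= nu (mu s))%N by have := nu_mu_ge nu0_gt0 n_gt0 nuE (m1 := s.+1) isT; rewrite succnK; lia.
have LK : (glevel k s <= K)%N.
  have := k_growth s2; have := @k_le _ k1_gt0 k_growth s (nu (mu s)); lia.
rewrite -[leRHS](avg_cst K l c).
have lLK : (l <= glevel k s <= K)%N by rewrite lL.
apply: (avg_le_sub lLK) => e ec; rewrite avg_cst.
have lK : (l <= K)%N by lia.
have xs := step_in_cst lLK (xi_step cZ gz Zpsi hpsi hxi k1_gt0 k_growth cl s2 ls lK LK) ec.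
have mm : (2 <= s <= s.+1)%N by lia.
have := @spread K (glevel k s) e s s.+1
  (gam s * xi s (pt z K (e * 2 ^ (K - glevel k s)))) (1 / 10)
  (fun i => `[< quiet J0 (mu s) (pt z K i) >]) mm (leqnn _) kK.
have V1 : 1 <= wenergy s s.+1.
  rewrite /wenergy big_nat1; apply: (le_trans bs1); rewrite lerDl.
  by apply: sumr_ge0 => j _; exact: sqr_ge0.
move=> /(_ V1) H.
have {}H : (2 - (1 / 10) ^+ 2 / 2) * avg K (glevel k s) e
    (fun i => (`[< quiet J0 (mu s) (pt z K i) >])%:R) <= 65 / 33 :> R.
  apply: H => i ie /asboolP q; rewrite -(xs i ie).
  have mm1 : (1 <= s <= s.+1)%N by lia.
  have := @psum_layers K s s.+1 i mm1 kK; rewrite big_nat1 => <-.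
  have mu1 := @mu_le s.-1 s (leq_pred s).
  by apply: (quiet_diff q); rewrite ?succnK; lia.
by move: H; move: (avg _ _ _ _) => x; lra.
Qed.

(* Small xi-coefficients: Bessel and Chebyshev control the xi-part. *)
Lemma spread_many_blocks J0 l c m1 m2 : (0 < c < 2 ^ l)%N -> (2 <= m1 <= m2)%N ->
  (rho k l < m1)%N -> (l <= glevel k m1)%N -> (J0 <= mu m1.-1)%N ->
  2 ^+ l * \sum_(m1 <= s < m2) gam s ^+ 2 <= 1 / 1000 / 100 ->
  1 <= wenergy m1 m2 -> small_cell J0 l c (999 / 1000).
Proof.
move=> cl m12 lm1 lL Jm gs V1; exists (mu m2.-1), (k (nu (mu m2.-1)) + k m2).+1 => K kK.
have [m1_2 m1m2] : (2 <= m1)%N /\ (m1 <= m2)%N by lia.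
have lK : (l <= K)%N.
  have := k_growth m1_2; have := @k_le _ k1_gt0 k_growth m1 m2; lia.
have kK' : (k (nu (mu m2.-1)) < K)%N by lia.
have m2K : (k m2 <= K)%N by lia.
pose E i := \sum_(m1 <= s < m2) gam s * xi s (pt z K i).
have bes : avg K l c (fun i => E i ^+ 2) <= 1 / 1000 / 100.
  apply: le_trans gs.
  exact: (xi_bessel cZ gz Zpsi hpsi hxi k1_gt0 k_growth gam cl lK m12 lm1 m2K).
pose W i := `[< quiet J0 (mu m2.-1) (pt z K i) >].
pose P i := W i && (`|E i| <= 1 / 10).
have mm1 : (1 <= m1 <= m2)%N by lia.
have sp : (2 - (2 / 10) ^+ 2 / 2) * avg K l c (fun i => (P i)%:R) <= 65 / 33 :> R.
  apply: (@spread K l c m1 m2 0) => // i ic /andP[/asboolP q Ei]; rewrite add0r.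
  have mu1 : (mu m1.-1 <= mu m2.-1)%N by apply: mu_le; move: m1m2; clear; lia.
  have := @psum_layers K m1 m2 i mm1 kK'; rewrite -/(E i) => e.
  have : `|psum (mu m2.-1) (pt z K i) - psum (mu m1.-1) (pt z K i)| <= 1 / 10.
    by apply: (quiet_diff q); rewrite ?Jm ?mu1 ?(leq_trans Jm mu1) ?leqnn.
  rewrite e => EW; have := ler_normB (E i + wlayer K m1 m2 i) (E i).
  by rewrite [E i + _]addrC addrK; move: EW; rewrite [E i + _]addrC; lra.
(* Where [E i] exceeds 1/10 in size, [100 * E i ^+ 2] exceeds 1; its average is at most 1/1000. *)
have : avg K l c (fun i => (W i)%:R) <= avg K l c (fun i => (P i)%:R + 100 * E i ^+ 2).
  apply: avg_le => i ic; rewrite /P; case: (W i) => /=; last first.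
    by rewrite add0r mulr_ge0// sqr_ge0.
  have E0 : 0 <= 100 * E i ^+ 2 by rewrite mulr_ge0// sqr_ge0.
  case: (leP `|E i| (1 / 10)) => Ei.
    change (1 <= 1 + 100 * E i ^+ 2); lra.
  change (1 <= 0 + 100 * E i ^+ 2); rewrite -real_normK ?num_real//.
  by move: Ei; move: (`|E i|) => x Ex; nra.
have -> : avg K l c (fun i => (P i)%:R + 100 * E i ^+ 2) =
    avg K l c (fun i => (P i)%:R) + 100 * avg K l c (fun i => E i ^+ 2).
  by rewrite -avgZ -avgD.
by move: sp bes; move: (avg _ _ _ _) (avg _ _ _ _) (avg _ _ _ _) => x y w; lra.
Qed.

End Spread.

(* Decomposition according to the first index at which an event occurs. *)
Lemma first_event_avg {R : realType} K l c (q : pred nat) (O : nat -> pred nat)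
    (L L' : nat -> nat) (w : nat -> R) ma mb :
  (ma <= mb)%N ->
  (forall s, (ma <= s < mb)%N -> (l <= L s <= K)%N) ->
  (forall s, (ma <= s < mb)%N -> (l <= L' s <= K)%N) ->
  (forall s t, (ma <= s < mb)%N -> (ma <= t < s)%N ->
    step_in K l c (L s) (fun i => (O t i)%:R : R)) ->
  (forall s t, (ma <= s < mb)%N -> (ma <= t <= s)%N ->
    step_in K l c (L' s) (fun i => (O t i)%:R : R)) ->
  (forall s e, (ma <= s < mb)%N -> (e %/ 2 ^ (L s - l) = c)%N ->
    w s <= avg K (L s) e (fun i => (O s i)%:R)) ->
  (forall s e, (ma <= s < mb)%N -> (e %/ 2 ^ (L' s - l) = c)%N ->
    O s (e * 2 ^ (K - L' s))%N -> avg K (L' s) e (fun i => (q i)%:R) <= 3 / 5 :> R) ->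
  4 <= \sum_(ma <= s < mb) w s ->
  avg K l c (fun i => (q i)%:R) <= 4 / 5 :> R.
Proof.
move=> mab lL lL' stL stL' wO qO w4.
(* [U s]: no event before [s]; [W s]: the first event is at [s]. At level [L s] the past is known
   while event [s] is still open; at level [L' s] event [s] is decided. *)
pose U s i : R := \prod_(ma <= t < s) (~~ O t i)%:R.
pose W s i : R := U s i * (O s i)%:R.
have U0 s i : 0 <= U s i by apply: prodr_ge0 => t _; rewrite ler0n.
have US s i : (ma <= s)%N -> U s.+1 i = U s i - W s i.
  by move=> ms; rewrite /U big_nat_recr //= /W; case: (O s i) => /=; rewrite -/(U s i); ring.
have stU M s : (forall t, (ma <= t < s)%N -> step_in K l c M (fun i => (O t i)%:R : R)) ->
    step_in K l c M (U s).
  move=> st x y xc xy; rewrite /U !big_nat; apply: eq_bigr => t ts.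
  have := st t ts x y xc xy => /eqP; rewrite eqr_nat; case: (O t x); by case: (O t y).
have tel s : (ma <= s <= mb)%N ->
    \sum_(ma <= t < s) avg K l c (W t) = 1 - avg K l c (U s).
  move=> /andP[ms _]; rewrite -(subnKC ms); move: (s - ma)%N => d.
  elim: d => [|d IH].
    by rewrite addn0 big_geq// (_ : avg _ _ _ _ = 1) ?subrr// -(avg_cst K l c 1);
      apply: avg_ext => i _; rewrite /U big_geq.
  rewrite addnS big_nat_recr ?leq_addr//= IH.
  rewrite (_ : avg K l c (U (ma + d).+1) = avg K l c (U (ma + d)%N) - avg K l c (W (ma + d)%N)).
    by ring.
  by rewrite -avgB; apply: avg_ext => i _; rewrite US ?leq_addr.
(* Survival is multiplied by at most [1 - x <= (1 + x)^-1], with [x] the weight; the maximum with 0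
   is taken because weights may be negative. *)
have surv s : (ma <= s <= mb)%N ->
    avg K l c (U s) <= \prod_(ma <= t < s) (1 + Num.max (w t) 0)^-1.
  move=> /andP[ms]; rewrite -(subnKC ms); move: (s - ma)%N => d.
  elim: d => [|d IH].
    move=> _; rewrite addn0 big_geq// -[leRHS](avg_cst K l c 1).
    by apply: avg_le => i _; rewrite /U big_geq.
  rewrite addnS => dmb; rewrite big_nat_recr ?leq_addr//=.
  set t := (ma + d)%N in dmb IH *.
  have tm : (ma <= t < mb)%N by rewrite leq_addr.
  have w0 : 0 <= Num.max (w t) 0 by rewrite le_max lexx orbT.
  apply: le_trans (ler_wpM2r _ (IH (ltnW dmb))); last by rewrite invr_ge0; lra.
  rewrite mulrC -avgZ; apply: (avg_le_sub (lL t tm)) => e ec.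
  have Ue i : (i %/ 2 ^ (K - L t) = e)%N -> U t i = U t (e * 2 ^ (K - L t))%N.
    by apply: (step_in_cst (lL t tm) _ ec); apply: stU => t' t't; exact: stL.
  set u := U t (e * _)%N in Ue; have u0 : 0 <= u by exact: U0.
  rewrite [leRHS](avg_const (a := (1 + Num.max (w t) 0)^-1 * u)) => [|i ie]; last by rewrite Ue.
  rewrite (avg_ext (H := fun i => u * (1 - (O t i)%:R))) => [|i ie]; last first.
    by rewrite US ?leq_addr// /W Ue//; ring.
  rewrite avgZ mulrC ler_wpM2r//.
  have -> : avg K (L t) e (fun i => 1 - (O t i)%:R) = 1 - avg K (L t) e (fun i => (O t i)%:R) :> R.
    by rewrite -[X in _ = X - _](avg_cst K (L t) e) -avgB.
  have wa : Num.max (w t) 0 <= avg K (L t) e (fun i => (O t i)%:R).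
    by rewrite ge_max wO//= avg_ge0// => i _; rewrite ler0n.
  rewrite -[leRHS]mul1r ler_pdivlMr; last lra.
  move: w0 wa; move: (avg _ _ _ _) (Num.max _ _) => x y; nra.
have Ub : avg K l c (U mb) <= 1 / 5.
  have mbb : (ma <= mb <= mb)%N by rewrite mab leqnn.
  apply: (le_trans (surv mb mbb)).
  have w0 t : true -> 0 <= Num.max (w t) 0 by rewrite le_max lexx orbT.
  apply: (le_trans (prod_inv1D_le _ w0)).
  have s4 : 4 <= \sum_(ma <= t < mb) Num.max (w t) 0.
    by apply: (le_trans w4); apply: ler_sum => t _; rewrite le_max lexx.
  by rewrite div1r lef_pV2 ?posrE; lra.
have dec s i : (ma <= s)%N ->
    (q i)%:R = U s i * (q i)%:R + \sum_(ma <= t < s) W t i * (q i)%:R.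
  move=> ms; rewrite -(subnKC ms); move: (s - ma)%N => d.
  elim: d => [|d IH].
    by rewrite addn0 /U !big_geq// mul1r addr0.
  by rewrite addnS big_nat_recr ?leq_addr//= US ?leq_addr// {1}IH; ring.
rewrite (avg_ext (H := (fun i => U mb i * (q i)%:R) \+
  (fun i => \sum_(ma <= t < mb) W t i * (q i)%:R))); last by move=> i _; exact: dec.
rewrite avgD avg_sum.
have first : avg K l c (fun i => U mb i * (q i)%:R) <= avg K l c (U mb).
  by apply: avg_le => i _; rewrite ler_piMr//; case: (q i); rewrite /= ?ler01.
have rest : \sum_(ma <= t < mb) avg K l c (fun i => W t i * (q i)%:R) <=
    \sum_(ma <= t < mb) 3 / 5 * avg K l c (W t).
  rewrite !big_nat; apply: ler_sum => t tm; rewrite -avgZ.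
  apply: (avg_le_sub (lL' t tm)) => e ec.
  have We i : (i %/ 2 ^ (K - L' t) = e)%N -> W t i = W t (e * 2 ^ (K - L' t))%N.
    apply: (step_in_cst (lL' t tm) _ ec) => x y xc xy; rewrite /W.
    rewrite (stU (L' t) t _ x y xc xy) => [|t' t't]; last by apply: stL' => //; lia.
    by congr (_ * _); apply: (stL' t t tm _ x y xc xy); lia.
  rewrite [leRHS](avg_const (a := 3 / 5 * W t (e * 2 ^ (K - L' t))%N)) => [|i ie]; last by rewrite We.
  rewrite (avg_ext (H := fun i => W t (e * 2 ^ (K - L' t))%N * (q i)%:R)) => [|i ie]; last first.
    by rewrite We.
  rewrite avgZ /W; case: (boolP (O t (e * 2 ^ (K - L' t))%N)) => Oe /=; last first.
    by rewrite !mulr0 mul0r.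
  rewrite mulr1 mulrC ler_wpM2r//; exact: qO.
rewrite -mulr_sumr tel in rest; last by rewrite mab leqnn.
by move: first rest Ub; move: (avg _ _ _ _) (\sum_(_ <= _ < _) _) (avg _ _ _ _) => x y v; lra.
Qed.

(** * The Menshov alternative: divergent gam-energy *)

Section MenshovCase.
Context {R : realType}.
Variables (f : nat -> nat -> R -> R) (k : nat -> nat) (psi xi Upsilon : nat -> R -> R).
Variables (n nu : nat -> nat) (chi : nat -> R -> R) (a : nat -> R).
Variables (Z : set R) (z : R).
Hypothesis hxi : xi_system k psi xi.
Hypothesis hUpsilon : Upsilon_system f k xi Upsilon.
Hypothesis hchi : chi_system k Upsilon n nu chi.
Hypothesis nu0_gt0 : (0 < nu 0)%N.
Hypothesis n_gt0 : forall j, (1 <= j)%N -> (0 < n j)%N.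
Hypothesis nuE : forall j, (1 <= j)%N -> nu j = (nu j.-1 + 2 ^ n j - 1)%N.
Hypothesis k1_gt0 : (0 < k 1)%N.
Hypothesis k_growth : forall s, (2 <= s)%N ->
  (glevel k s + k s.-1 + 4 + 2 ^ (2 * s) <= k s)%N.
Hypothesis cZ : countable Z.
Hypothesis gz : generic Z z.
Hypothesis Zf : forall n i u, (2 <= n)%N -> (i < 2 ^ n)%N -> -1 <= u <= 1 -> ~ Z u ->
  f n i u = menshov_shift n i u.
Hypothesis Zg : forall s j, (1 <= s)%N -> (j < 2 ^ (2 * s))%N -> step_off Z (k s) (g f k s j).
Hypothesis Zpsi : forall v l, dyadic_step 0 1 l (psi v) -> step_off Z l (psi v).
Hypothesis ZU : forall j l, dyadic_step 0 1 l (Upsilon j) -> step_off Z l (Upsilon j).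
Hypothesis Ublock : forall b, (1 <= b)%N -> forall j, (mu b.-1 + 1 <= j <= mu b)%N ->
  dyadic_step 0 1 (k (nu (mu b.-1))) (Upsilon j).
Hypothesis hpsi : psi_system f k psi.

Let z01 : 0 < z < 1 := gz.1.
Local Notation psum := (psum nu chi a).
Local Notation ccoef := (ccoef nu a).
Local Notation gam := (gam nu a).
Local Notation bet := (bet nu a).
Local Notation bblk := (bblk nu a).
Local Notation ublk := (ublk Upsilon).
Local Notation quiet := (quiet nu chi a).
Local Notation small_cell := (small_cell nu chi a z).

Definition bpart K s J J' x : R := \sum_(J <= i < J') bblk s i * ublk s i (pt z K x).

Definition osc K s x : bool := [exists J : 'I_(bsize s).+1,
  (1 / 4 <= `|bpart K s 0 J x|) || (1 / 4 <= `|bpart K s J (bsize s) x|)].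

(** [896 = 128 * 7] comes from [gain_lower], and 16 from the two divisions by 4 in [menshov_osc]. *)
Definition osc_weight s : R := Num.min (gam s ^+ 2) 1 / (896 * 16) - (s%:R ^+ 2)^-1.

(** All [bsize s + 1] coefficients add up to exactly [gam s * rblk s], and [rblk s >= 2 ^+ s]. The
    bound on the [bet]-energy gives [B2 <= G ^+ 2 + 1], which controls both the omitted last
    coefficient and the error in [menshov_gain_mean]; [s >= 16] absorbs the multiples of [G / s]. *)
Lemma gain_lower s (y : R) : (16 <= s)%N -> \sum_(j < bsize s) bet s j ^+ 2 <= 1 ->
  Num.min (gam s ^+ 2) 1 / 896 - (s%:R ^+ 2)^-1 <=
  (\sum_(p < bsize s) Num.min (menshov_gain s (bsize s) (bblk s) (delta R (bsize s)) p ^+ 2) 1) /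
    (bsize s)%:R.
Proof.
move=> s16 eta1; have sR : 16 <= s%:R :> R by rewrite (ler_nat R 16).
have s0 : (0 < s)%N by lia.
set B2 := \sum_(i < bsize s) bblk s i ^+ 2.
have B20 : 0 <= B2 by apply: sumr_ge0 => i _; exact: sqr_ge0.
have en := block_energy nu a s; rewrite big_ord_recr /= -/B2 in en.
set G := `|gam s|; have G0 : 0 <= G := normr_ge0 _.
have G2 : gam s ^+ 2 = G ^+ 2 by rewrite real_normK ?num_real.
have le1 (x : R) : x ^+ 2 <= G ^+ 2 + 1 -> `|x| <= G + 1.
  move=> xG; rewrite -(@ler_pXn2r _ 2) ?nnegrE ?addr_ge0// real_normK ?num_real//.
  by apply: (le_trans xG); nra.
have bb0 := sqr_ge0 (bblk s (bsize s)).
have bN : `|bblk s (bsize s)| <= G + 1 by apply: le1; lra.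
have B2G : B2 <= G ^+ 2 + 1 by lra.
have Bn : Num.sqrt B2 <= G + 1.
  by rewrite -[leLHS]ger0_norm ?sqrtr_ge0//; apply: le1; rewrite sqr_sqrtr.
have P0 : 0 < (2 : R) ^+ s by rewrite exprn_gt0.
have Ps : s%:R <= (2 : R) ^+ s by rewrite -natrX ler_nat ltnW// ltn_expl.
have r0 : 0 < rblk (R := R) s by rewrite sqrtr_gt0 ltr0n.
have rP : 2 ^+ s <= rblk (R := R) s.
  have -> : (2 : R) ^+ s = Num.sqrt (bsize s)%:R.
    by rewrite /bsize natrX mulnC exprM sqrtr_sqr ger0_norm// ltW.
  by rewrite ler_wsqrtr// ler_nat.
have S1 : G * 2 ^+ s - (G + 1) <= `|\sum_(i < bsize s) bblk s i|.
  have e : \sum_(i < bsize s) bblk s i = gam s * rblk s - bblk s (bsize s).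
    by rewrite /gam divfK ?gt_eqF// big_ord_recr /= addrK.
  rewrite e; apply: le_trans (lerB_dist _ _); apply: lerB => //.
  by rewrite normrM (gtr0_norm r0) ler_wpM2l.
have low : G / 8 - 2 / s%:R <=
    `|\sum_(i < bsize s) bblk s i| / (4 * 2 ^+ s) - 3 / 2 * Num.sqrt B2 / s%:R.
  have i0 : 0 < (s%:R : R)^-1 by rewrite invr_gt0; lra.
  have i16 : (s%:R : R)^-1 <= 1 / 16 by rewrite div1r lef_pV2 ?posrE//; lra.
  have iP : (2 ^+ s : R)^-1 <= (s%:R)^-1 by rewrite lef_pV2 ?posrE//; lra.
  have i2 : 0 <= (s%:R : R)^-1 by exact: ltW.
  have : G / 4 - (G + 1) / 4 * (2 ^+ s)^-1 <= `|\sum_(i < bsize s) bblk s i| / (4 * 2 ^+ s).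
    rewrite ler_pdivlMr ?mulr_gt0//; apply: le_trans S1.
    by rewrite le_eqVlt; apply/orP; left; apply/eqP; field; rewrite gt_eqF.
  have : (G + 1) / 4 * (2 ^+ s)^-1 <= (G + 1) / 4 * (s%:R)^-1 by rewrite ler_wpM2l//; lra.
  have : 3 / 2 * Num.sqrt B2 / s%:R <= 3 / 2 * (G + 1) / s%:R.
    by apply: ler_wpM2r => //; apply: ler_wpM2l.
  have : G * (s%:R)^-1 <= G * (1 / 16) by rewrite ler_wpM2l.
  by move: (s%:R^-1 : R) (_ / (4 * 2 ^+ s)) ((2 ^+ s)^-1) (3 / 2 * Num.sqrt B2 / s%:R) i0 i16 iP
     => w u t q; nra.
have i2 : (s%:R ^+ 2 : R)^-1 = (s%:R^-1) ^+ 2 by rewrite exprVn.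
have minG : Num.min (gam s ^+ 2) 1 / 7 <= G ^+ 2 / (4 + 3 * G ^+ 2).
  have G20 := sqr_ge0 G.
  rewrite ler_pdivlMr; last lra.
  rewrite G2; case: (leP (G ^+ 2) 1) => G1; nra.
have [yn|yp] := leP (G / 8 - 2 / s%:R) 0.
  apply: (@le_trans _ _ 0); last first.
    by rewrite divr_ge0// sumr_ge0// => p _; rewrite le_min sqr_ge0 ler01.
  have mG : Num.min (gam s ^+ 2) 1 <= G ^+ 2 by rewrite ge_min G2 lexx.
  rewrite i2; move: yn mG; move: (s%:R^-1 : R) => w; nra.
apply: le_trans (menshov_gain_min s0 erefl (delta_bounds (bsize_gt0 s)) (ltW yp) low).
rewrite -/B2.
apply: (@le_trans _ _ ((G / 8 - 2 / s%:R) ^+ 2 / (4 + 3 * G ^+ 2))); last first.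
  rewrite ler_wpM2l ?sqr_ge0// lef_pV2 ?posrE; [lra| |]; have := sqr_ge0 G; lra.
have D0 : 0 < 4 + 3 * G ^+ 2 by have := sqr_ge0 G; lra.
(* This is [(a - b)^2 >= a^2 / 2 - b^2] with [a = G / 8] and [b = 2 / s]. *)
apply: (@le_trans _ _ ((G ^+ 2 / 128 - 4 * (s%:R ^-1) ^+ 2) / (4 + 3 * G ^+ 2))); last first.
  rewrite ler_pM2r ?invr_gt0//; move: (s%:R^-1 : R) => w; have := sqr_ge0 (G / 8 - 4 * w).
  nra.
rewrite i2 mulrBl; apply: lerB.
  have -> : G ^+ 2 / 128 / (4 + 3 * G ^+ 2) = (G ^+ 2 / (4 + 3 * G ^+ 2)) / 128.
    by field; rewrite gt_eqF.
  move: minG; lra.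
rewrite ler_pdivrMr// mulrC; have := sqr_ge0 (s%:R^-1 : R); have := sqr_ge0 G.
by move: (_ ^+ 2) (_ ^+ 2) => u w; nra.
Qed.

Lemma osc_avg K l c s e : (0 < c < 2 ^ l)%N -> (16 <= s)%N -> (rho k l < s)%N ->
  (l <= glevel k s)%N -> (glevel k s + 2 * s ^ 2 + 2 + 2 * s <= K)%N ->
  (e %/ 2 ^ (glevel k s - l) = c)%N -> \sum_(j < bsize s) bet s j ^+ 2 <= 1 ->
  osc_weight s <= avg K (glevel k s) e (fun x => (osc K s x)%:R).
Proof.
move=> cl s16 ls lL LK ec eta1.
have s2 : (2 <= s)%N by lia.
have s1 : (1 <= s)%N by lia.
have LK' : (glevel k s <= K)%N by lia.
have lK : (l <= K)%N by lia.
have lLK : (l <= glevel k s <= K)%N by rewrite lL.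
have xs := step_in_cst lLK (xi_step cZ gz Zpsi hpsi hxi k1_gt0 k_growth cl s2 ls lK LK') ec.
have := @menshov_osc _ f k Z z gz Zf s K e (bblk s) (fun i x => ublk s i (pt z K x))
  (xi s (pt z K (e * 2 ^ (K - glevel k s))) / rblk s) (delta R (bsize s)) (osc K s) s2 LK.
move=> H; apply: le_trans (H _ _) => {H}.
- have := gain_lower 0 s16 eta1; rewrite -/(bsize s).
  have : (2 : R) ^- (2 * s ^ 2) <= (s%:R ^+ 2)^-1.
    have s0 : (0 < s ^ 2)%N by rewrite expn_gt0 s1.
    rewrite lef_pV2 ?posrE ?exprn_gt0 ?ltr0n// -!natrX ler_nat.
    apply: (leq_trans (ltnW (ltn_expl (s ^ 2) (isT : 1 < 2)%N))).
    by rewrite leq_exp2l//; lia.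
  rewrite /osc_weight; have : 0 <= (s%:R ^+ 2 : R)^-1 by rewrite invr_ge0 sqr_ge0.
  by move: (_ / (bsize s)%:R) ((s%:R ^+ 2)^-1) (2 ^- _) (Num.min _ _) => u v w t; lra.
- move=> i x iN xe; rewrite (ublkE hUpsilon _ s1 (ltnW iN)) iN (xs x xe) addrA.
  by [].
- move=> x J xe JN H; apply/existsP.
  have JN' : (J < (bsize s).+1)%N by [].
  exists (Ordinal JN') => /=; rewrite /bpart big_mkord.
  by apply/orP.
Qed.

(** No Rademacher function inserted inside the block has a smaller index than this level, so those
    signs are independent of the oscillation. *)
Lemma ublk_step_late K l c s i : (1 <= s)%N -> (i <= bsize s)%N ->
  (l <= K)%N -> (c < 2 ^ l)%N -> (k (nu (mu s.-1)) <= K)%N ->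
  step_in K l c (k (nu (mu s.-1))) (fun x => ublk s i (pt z K x)).
Proof.
move=> s1 iN lK cl kK x y xc xy.
apply: (step_pt (ZU _) gz kK _ xy); last exact: cell_lt xc.
apply: Ublock => //; have : mu s = (mu s.-1 + bsize s + 1)%N by rewrite -{1}(prednK s1) muS prednK.
by lia.
Qed.

(** Away from 0 the lower level [k s] is enough. The first-event argument needs it, since earlier
    events must be known at the level [glevel] of a later block. *)
Lemma ublk_step_far K l c s i : (0 < c < 2 ^ l)%N -> (2 <= s)%N -> (i <= bsize s)%N ->
  (rho k l < s)%N -> (l <= K)%N -> (k s <= K)%N ->
  step_in K l c (k s) (fun x => ublk s i (pt z K x)).
Proof.
move=> cl s2 iN ls lK kK x y xc xy.
have s1 : (1 <= s)%N by lia.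
have Lk : (glevel k s < k s)%N.
  by move: (k_growth s2); clear; lia.
have LK : (glevel k s <= K)%N by move: Lk kK; clear; lia.
have LkK : (glevel k s <= k s <= K)%N by lia.
rewrite !(ublkE hUpsilon _ s1 iN).
have -> := step_in_mono LkK (xi_step cZ gz Zpsi hpsi hxi k1_gt0 k_growth cl s2 ls lK LK) xc xy.
have gE j : (j < bsize s)%N -> g f k s j (pt z K x) = g f k s j (pt z K y).
  by move=> jN; exact: (gval_step gz Zg s2 jN kK xc xy).
congr (_ + _); case: ifP => iN'.
  rewrite gE//; congr (_ - _ * _); by apply: eq_bigr => j _; exact: gE.
by congr (_ / _); apply: eq_bigr => j _; exact: gE.
Qed.

Lemma osc_step K l c L s :
  (forall i, (i <= bsize s)%N -> step_in K l c L (fun x => ublk s i (pt z K x))) ->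
  forall x y, (x %/ 2 ^ (K - l) = c)%N -> (x %/ 2 ^ (K - L) = y %/ 2 ^ (K - L))%N ->
  (osc K s x = osc K s y) /\
  (forall J J', (J' <= bsize s)%N -> bpart K s J J' x = bpart K s J J' y).
Proof.
move=> st x y xc xy.
have bp J J' : (J' <= bsize s)%N -> bpart K s J J' x = bpart K s J J' y.
  move=> JN; rewrite /bpart !big_nat; apply: eq_bigr => i /andP[_ iJ].
  by rewrite (st i _ x y xc xy)//; lia.
split=> //; rewrite /osc; apply: eq_existsb => J; rewrite !bp//.
by rewrite -ltnS.
Qed.

(* Given the past, the Rademacher functions of a block are symmetric, so they
   cannot hide a jump of the Upsilon-part. *)
Lemma quiet_after_osc K l c s J0 J1 e : (l <= k (nu (mu s.-1)))%N -> (c < 2 ^ l)%N ->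
  (1 <= s)%N -> (J0 <= mu s.-1)%N -> (mu s <= J1)%N -> (k (nu (mu s)) < K)%N ->
  (e %/ 2 ^ (k (nu (mu s.-1)) - l) = c)%N ->
  osc K s (e * 2 ^ (K - k (nu (mu s.-1)))) ->
  avg K (k (nu (mu s.-1))) e (fun x => (`[< quiet J0 J1 (pt z K x) >])%:R) <= 3 / 5 :> R.
Proof.
move=> lL cl s1 Js sJ kK ec /existsP[J oJ].
set L := k (nu (mu s.-1)) in lL ec oJ *.
have muE : mu s = (mu s.-1 + bsize s + 1)%N by rewrite -{1}(prednK s1) muS prednK.
have nus : (nu (mu s.-1) <= nu (mu s))%N by apply: (nu_le nu0_gt0 n_gt0 nuE); lia.
have nu1 : (1 <= nu (mu s.-1))%N by have := nu_gt nu0_gt0 n_gt0 nuE (mu s.-1); lia.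
have Lk : (L <= k (nu (mu s)))%N by apply: (k_le k1_gt0 k_growth); rewrite nu1.
have LK : (L <= K)%N by lia.
have lLK : (l <= L <= K)%N by rewrite lL.
have lK : (l <= K)%N by lia.
have JN : (J <= bsize s)%N by rewrite -ltnS.
have [j0 [j1 [/andP[j01 j1N] v4]]] : exists j0 j1, (j0 <= j1 <= bsize s)%N /\
    1 / 4 <= `|bpart K s j0 j1 (e * 2 ^ (K - L))|.
  case/orP: oJ => v4; first by exists 0%N, J; rewrite JN.
  by exists J, (bsize s); rewrite JN leqnn.
set v := bpart _ _ _ _ _ in v4.
have vE x : (x %/ 2 ^ (K - L) = e)%N -> bpart K s j0 j1 x = v.
  move=> xe; have st i : (i <= bsize s)%N -> step_in K l c L (fun x => ublk s i (pt z K x)).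
    by move=> iN; exact: ublk_step_late.
  have xc : (x %/ 2 ^ (K - l) = c)%N by rewrite -(divn_pow2 x lLK) xe.
  have xy : (x %/ 2 ^ (K - L) = e * 2 ^ (K - L) %/ 2 ^ (K - L))%N by rewrite mulnK ?expn_gt0.
  by have [_ ->] := osc_step st xc xy.
have jj : (mu s.-1 + j0 <= mu s.-1 + j1)%N by lia.
have nuj0 : (nu (mu s.-1) <= nu (mu s.-1 + j0))%N by apply: (nu_le nu0_gt0 n_gt0 nuE); lia.
have nuj : (nu (mu s.-1 + j0) <= nu (mu s.-1 + j1))%N by exact: (nu_le nu0_gt0 n_gt0 nuE).
have nuj1 : (nu (mu s.-1 + j1) <= nu (mu s))%N by apply: (nu_le nu0_gt0 n_gt0 nuE); lia.
set n0 := nu (mu s.-1 + j0) in nuj0 nuj; set n1 := nu (mu s.-1 + j1) in nuj nuj1.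
pose kk t := k (n0.+1 + t)%N.
pose T t x : R := \sum_(i < n1 - n0) t * ccoef (n0.+1 + i)%N * rad K (kk i) x.
have diffE x : (x %/ 2 ^ (K - L) = e)%N ->
    psum (mu s.-1 + j1) (pt z K x) - psum (mu s.-1 + j0) (pt z K x) = v + T 1 x.
  move=> xe; rewrite (psum_diff a hchi nu0_gt0 n_gt0 nuE)// (sum_blk _ _ nu0_gt0 k1_gt0); last lia.
  rewrite -/n0 -/n1 -(vE x xe); congr (_ + _).
  have := big_addn 0 n1.+1 n0.+1 xpredT (fun s' => ccoef s' * rademacher (k s') (pt z K x)).
  rewrite add0n => ->; rewrite subSS big_mkord; apply: eq_bigr => i _.
  rewrite mul1r addnC (rademacher_pt z01)//.
  by apply: leq_ltn_trans kK; apply: (k_le k1_gt0 k_growth); have := ltn_ord i; move: nuj1; clear; lia.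
have v0 : v != 0 by apply: contraTneq v4 => ->; rewrite normr0; lra.
(* With [t * v = pi / 2] the cosine becomes [- sin (T t x)], odd in the signs and so of mean 0. As
   [v] is at least 1/4 in size, [t] is at most 8, so a variation of 1/10 becomes at most 4/5, and
   [1 / (2 - 8 / 25) <= 3 / 5]. *)
pose t : R := pi / 2 / v.
have tv : t * v = pi / 2 by rewrite divfK.
have cos0 : avg K L e (fun x => cos (t * v + T t x)) = 0.
  have kkL i : (i < n1 - n0)%N -> (L <= kk i < K)%N.
    move=> ii; apply/andP; split.
      by apply: (k_le k1_gt0 k_growth); lia.
    by apply: leq_ltn_trans kK; apply: (k_le k1_gt0 k_growth); lia.
  have kkm i j : (i < j < n1 - n0)%N -> (kk i < kk j)%N.
    by move=> ij; apply: (k_lt k1_gt0 k_growth); lia.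
  have [_ s0] := @avg_cos_rads _ K L e kk (fun i => t * ccoef (n0.+1 + i)%N) _ kkL kkm.
  rewrite (avg_ext (H := fun x => - 1 * sin (T t x))) => [|x _].
    by rewrite avgZ s0 mulr0.
  by rewrite tv cosD cos_pihalf sin_pihalf mul0r add0r mul1r mulN1r.
have := @avg_small_le _ K L e (fun x => t * v + T t x)
  (fun x => `[< quiet J0 J1 (pt z K x) >]) 0 (4 / 5).
rewrite cos0 lexx => H; have {H} := H _ isT.
suff: forall x, (x %/ 2 ^ (K - L) = e)%N -> `[< quiet J0 J1 (pt z K x) >] ->
    `|t * v + T t x| <= 4 / 5.
  by move=> q /(_ q); move: (avg _ _ _ _) => w; lra.
move=> x xe /asboolP q.
have -> : t * v + T t x = t * (v + T 1 x).
  rewrite mulrDr; congr (_ + _); rewrite mulr_sumr; apply: eq_bigr => i _.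
  by rewrite mul1r mulrA.
rewrite -(diffE x xe) normrM.
have d1 : `|psum (mu s.-1 + j1) (pt z K x) - psum (mu s.-1 + j0) (pt z K x)| <= 1 / 10.
  by apply: (quiet_diff q); move: Js sJ muE j01 j1N; clear; lia.
have t8 : `|t| <= 8.
  have p2 := @pihalf_lt2 R; have p1 := @pihalf_ge1 R.
  rewrite /t normrM normfV (@ger0_norm _ (pi / 2)); last lra.
  rewrite ler_pdivrMr ?normr_gt0//; lra.
have := ler_pM (normr_ge0 t) (normr_ge0 _) t8 d1; lra.
Qed.

Lemma menshov_case J0 l c ma mb : (0 < c < 2 ^ l)%N -> (16 <= ma < mb)%N ->
  (rho k l < ma)%N -> (l <= glevel k ma)%N -> (J0 <= mu ma.-1)%N ->
  (forall s, (ma <= s)%N -> \sum_(j < bsize s) bet s j ^+ 2 <= 1) ->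
  4 <= \sum_(ma <= s < mb) osc_weight s -> small_cell J0 l c (999 / 1000).
Proof.
move=> cl /andP[ma16 mab] lma lL Jm eta1 w4.
exists (mu mb.-1), (k (nu (mu mb.-1)) + k mb + 2 * mb ^ 2 + 2 * mb + 3)%N => K kK.
have k_le' s t : (0 < s <= t)%N -> (k s <= k t)%N by exact: (k_le k1_gt0 k_growth).
have nu_le' s t : (s <= t)%N -> (nu s <= nu t)%N by exact: (nu_le nu0_gt0 n_gt0 nuE).
have nu_gt' s : (s < nu s)%N by exact: (nu_gt nu0_gt0 n_gt0 nuE).
have gk s : (2 <= s)%N -> (glevel k s < k s)%N by move=> /k_growth; lia.
have kg s t : (1 <= s < t)%N -> (k s <= glevel k t)%N.
  by move=> st; have := k_le' s t.-1; rewrite /glevel; lia.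
have sq s : (s < mb)%N -> (s ^ 2 <= mb ^ 2)%N by move=> sb; rewrite leq_exp2r// ltnW.
have ks s : (ma <= s < mb)%N -> (k s <= K)%N by move=> sb; have := k_le' s mb; lia.
have lg s : (ma <= s)%N -> (l <= glevel k s)%N.
  rewrite leq_eqVlt => /orP[/eqP<-//|ms]; have := kg ma s; have := gk ma; lia.
have munu s : (1 <= s)%N -> (s <= nu (mu s.-1))%N.
  by move=> s1; have := nu_gt' (mu s.-1); have := mu_ge s.-1; lia.
have lk s : (ma <= s)%N -> (l <= k (nu (mu s.-1)))%N.
  move=> ms; have := k_le' s (nu (mu s.-1)); have := munu s; have := lg s ms.
  have := gk s; lia.
have mub s : (ma <= s < mb)%N -> (mu s <= mu mb.-1)%N by move=> sb; apply: mu_le; lia.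
have kn s : (ma <= s < mb)%N -> (k (nu (mu s.-1)) <= k (nu (mu s)) < K)%N.
  move=> sb; apply/andP; split.
    apply: k_le'; rewrite nu_le' ?mu_le ?leq_pred// andbT.
    by have := nu_gt' (mu s.-1); lia.
  have : (k (nu (mu s)) <= k (nu (mu mb.-1)))%N; last lia.
  apply: k_le'; rewrite nu_le' ?mub// andbT.
  by have := nu_gt' (mu s); lia.
have st L t : (forall i, (i <= bsize t)%N -> step_in K l c L (fun x => ublk t i (pt z K x))) ->
    step_in K l c L (fun x => (osc K t x)%:R : R).
  by move=> h x y xc xy; have [-> _] := osc_step h xc xy.
apply: (@le_trans _ _ (4 / 5)); last lra.
apply: (@first_event_avg _ K l c _ (osc K) (glevel k) (fun s => k (nu (mu s.-1)))
  osc_weight ma mb); rewrite ?(ltnW mab)//.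
- move=> s sb; rewrite lg; [|lia]; have := gk s; have := ks s sb; lia.
- by move=> s sb; have := kn s sb; rewrite lk; lia.
- move=> s t sb tb; apply: st => i iN.
  have LK : (k t <= glevel k s <= K)%N.
    by rewrite kg; [|lia]; have := gk s; have := ks s sb; lia.
  apply: (step_in_mono LK); apply: ublk_step_far => //; try lia.
  by have := lg s; lia.
- move=> s t sb tb; apply: st => i iN.
  have LK : (k (nu (mu t.-1)) <= k (nu (mu s.-1)) <= K)%N.
    have := kn s sb => h; rewrite k_le' /=; first lia.
    rewrite nu_le' ?mu_le; [|lia|lia].
    by have := nu_gt' (mu t.-1); lia.
  apply: (step_in_mono LK); apply: ublk_step_late => //; try lia.
  by have := lk s; lia.
- move=> s e sb ec; apply: (osc_avg cl _ _ _ _ ec); rewrite ?lg ?eta1//; try lia.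
  have := gk s; have := k_le' s mb; have := sq s; lia.
- move=> s e sb ec Oe; apply: (@quiet_after_osc K l c s J0 (mu mb.-1) e) => //.
  + by apply: lk; lia.
  + by lia.
  + by lia.
  + by apply: (leq_trans Jm); apply: mu_le; lia.
  + exact: mub.
  + by have /andP[] := kn s sb.
Qed.

End MenshovCase.

(** * Almost everywhere divergence *)

Section Tails.
Context {R : realType}.
Implicit Types (u : nat -> R).

Lemma small_tail u s0 (B e : R) : (forall s, 0 <= u s) ->
  (forall m, \sum_(s0 <= s < m) u s <= B) -> 0 < e ->
  exists2 m1, (s0 <= m1)%N & forall m2, \sum_(m1 <= s < m2) u s <= e.
Proof.
move=> u0 uB e0; pose A : set R := range (fun m => \sum_(s0 <= s < m) u s).
have hA : has_sup A.
  by split; [exists (\sum_(s0 <= s < 0) u s), 0%N|exists B => _ [m _ <-]].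
have [_ [m _ <-] mS] := sup_adherent e0 hA.
exists (maxn s0 m); first exact: leq_maxl.
move=> m2; have [m2m|mm2] := leqP m2 (maxn s0 m); first by rewrite big_geq// ltW.
have [sm|ms] := leqP s0 m; last first.
  rewrite (big_geq (ltnW ms)) in mS.
  have := ub_le_sup hA.2 (ex_intro2 _ _ m2 I erefl : A _) => /=.
  by move=> h; apply: (le_trans h); lra.
have := ub_le_sup hA.2 (ex_intro2 _ _ m2 I erefl : A _) => /=.
rewrite (@big_cat_nat _ _ _ m)//=; last by lia.
by move: mS; move: (\sum_(s0 <= s < m) _) (sup A) (\sum_(m <= s < m2) _) => x y v; lra.
Qed.

Lemma sum_inv_sqr s m : (2 <= s)%N -> \sum_(s <= i < m) (i%:R ^+ 2)^-1 <= 1 :> R.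
Proof.
move=> s2; have [ms|sm] := leqP m s; first by rewrite big_geq.
suff H d : \sum_(s <= i < s + d) (i%:R ^+ 2)^-1 <= (s.-1%:R)^-1 - ((s + d).-1%:R)^-1 :> R.
  rewrite -(subnKC (ltnW sm)); apply: (le_trans (H _)).
  rewrite lerBlDr (@le_trans _ _ 1) ?lerDl ?invr_ge0//.
  by rewrite invf_le1 ?ler1n ?ltr0n//; lia.
elim: d => [|d IH]; first by rewrite addn0 big_geq// subrr.
rewrite addnS big_nat_recr ?leq_addr//=; have x0 : 0 < ((s + d).-1%:R : R) by rewrite ltr0n; lia.
have -> : (s + d)%:R = (s + d).-1%:R + 1 :> R by rewrite natr1 prednK//; lia.
apply: (le_trans (lerD IH (lexx _))); move: ((s + d).-1%:R) x0 (s.-1%:R^-1) => x x0 y.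
suff : ((x + 1) ^+ 2)^-1 <= x^-1 - (x + 1)^-1 by lra.
have -> : x^-1 - (x + 1)^-1 = ((x + 1) * x)^-1 :> R by field; apply/andP; split; lra.
by rewrite lef_pV2 ?posrE; nra.
Qed.

Lemma unbounded_partial_sums u (B : R) : (forall i, 0 <= u i) ->
  ~ cvgn (fun N => \sum_(1 <= i < N.+1) u i) ->
  exists N, forall N', (N <= N')%N -> B < \sum_(1 <= i < N'.+1) u i.
Proof.
move=> u0 nc; have mono N N' : (N <= N')%N -> \sum_(1 <= i < N.+1) u i <= \sum_(1 <= i < N'.+1) u i.
  by move=> NN'; rewrite [leRHS](@big_cat_nat _ _ _ N.+1)//= lerDl sumr_ge0.
apply: contrapT => h; apply: nc; apply: nondecreasing_is_cvgn.
  by move=> i j ij; exact: mono.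
exists B => _ [N _ <-]; rewrite leNgt; apply/negP => BN; apply: h; exists N => N' NN'.
by apply: (lt_le_trans BN); exact: mono.
Qed.

End Tails.

(** * The alternatives on a cell away from 0 *)

Section SmallCells.
Context {R : realType}.
Variables (f : nat -> nat -> R -> R) (k : nat -> nat) (psi xi Upsilon : nat -> R -> R).
Variables (n nu : nat -> nat) (chi : nat -> R -> R) (a : nat -> R).
Variables (Z : set R) (z : R).
Hypothesis hxi : xi_system k psi xi.
Hypothesis hUpsilon : Upsilon_system f k xi Upsilon.
Hypothesis hchi : chi_system k Upsilon n nu chi.
Hypothesis nu0_gt0 : (0 < nu 0)%N.
Hypothesis n_gt0 : forall j, (1 <= j)%N -> (0 < n j)%N.
Hypothesis nuE : forall j, (1 <= j)%N -> nu j = (nu j.-1 + 2 ^ n j - 1)%N.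
Hypothesis k1_gt0 : (0 < k 1)%N.
Hypothesis k_growth : forall s, (2 <= s)%N ->
  (glevel k s + k s.-1 + 4 + 2 ^ (2 * s) <= k s)%N.
Hypothesis cZ : countable Z.
Hypothesis gz : generic Z z.
Hypothesis Zf : forall n i u, (2 <= n)%N -> (i < 2 ^ n)%N -> -1 <= u <= 1 -> ~ Z u ->
  f n i u = menshov_shift n i u.
Hypothesis Zg : forall s j, (1 <= s)%N -> (j < 2 ^ (2 * s))%N -> step_off Z (k s) (g f k s j).
Hypothesis Zpsi : forall v l, dyadic_step 0 1 l (psi v) -> step_off Z l (psi v).
Hypothesis ZU : forall j l, dyadic_step 0 1 l (Upsilon j) -> step_off Z l (Upsilon j).
Hypothesis Ublock : forall b, (1 <= b)%N -> forall j, (mu b.-1 + 1 <= j <= mu b)%N ->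
  dyadic_step 0 1 (k (nu (mu b.-1))) (Upsilon j).
Hypothesis hpsi : psi_system f k psi.
Hypothesis ha : ~ cvgn (fun N : nat => \sum_(1 <= i < N.+1) a i ^+ 2).

Local Notation ccoef := (ccoef nu a).
Local Notation gam := (gam nu a).
Local Notation bet := (bet nu a).
Local Notation wenergy := (wenergy nu a).

Lemma mu_blocks (F : nat -> R) M : \sum_(1 <= l < (mu M).+1) F l =
  \sum_(1 <= s < M.+1) \sum_(i < (bsize s).+1) F (mu s.-1 + i.+1)%N.
Proof.
elim: M => [|M IH]; first by rewrite !big_geq.
rewrite [RHS]big_nat_recr// -IH succnK (@big_cat_nat _ _ _ (mu M).+1)//; last first.
  by rewrite ltnS; apply: mu_le.
congr (_ + _); rewrite muS.
have := big_addn 0 (mu M + bsize M.+1 + 1).+1 (mu M).+1 xpredT F.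
rewrite add0n => ->; rewrite (_ : (_ - _ = (bsize M.+1).+1)%N); last lia.
by rewrite big_mkord; apply: eq_bigr => i _; rewrite addnS addnC addnS.
Qed.

Lemma energy_window m1 m2 : (1 <= m1 <= m2)%N ->
  \sum_(1 <= i < (nu (mu m2.-1) + mu m2.-1).+1) a i ^+ 2 =
  \sum_(1 <= i < (nu (mu m1.-1) + mu m1.-1).+1) a i ^+ 2 +
  (\sum_(m1 <= s < m2) gam s ^+ 2 + wenergy m1 m2).
Proof.
move=> /andP[m11 m12]; have nn := nu_mu_le nu0_gt0 n_gt0 nuE m12.
rewrite !(energyE a nu0_gt0 n_gt0 nuE) !mu_blocks !prednK//; last lia.
rewrite [X in X + _ = _](@big_cat_nat _ _ _ m1)//= -[RHS]addrA -[LHS]addrA; congr (_ + _).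
rewrite [X in _ + X = _](@big_cat_nat _ _ _ (nu (mu m1.-1)).+1)//=.
rewrite [LHS]addrCA; congr (_ + _).
rewrite /wenergy addrA; congr (_ + _); rewrite -big_split /=.
by apply: eq_bigr => s _; rewrite block_energy.
Qed.

Lemma small_cell_all J0 l c : (0 < c < 2 ^ l)%N ->
  small_cell nu chi a z J0 l c (999 / 1000).
Proof.
move=> cl; pose s0 := (16 + rho k l + l + J0)%N.+1.
have big s : (s0 <= s)%N ->
    [/\ (16 <= s)%N, (rho k l < s)%N, (l <= glevel k s)%N & (J0 <= mu s.-1)%N].
  move=> s0s; rewrite /s0 in s0s; split; try lia.
    have := k_ge k1_gt0 k_growth (_ : (0 < s.-1)%N); rewrite /glevel; lia.
  by have := mu_ge s.-1; lia.
have [[s ss bs]|nbig] := pselect (exists2 s, (s0 <= s)%N & 1 <= \sum_(j < bsize s) bet s j ^+ 2).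
  have [s16 ls lL Js] := big s ss.
  have s2 : (2 <= s)%N by lia.
  by apply: (spread_one_block hxi hUpsilon hchi nu0_gt0 n_gt0 nuE k1_gt0 k_growth cZ gz Zg Zpsi
    hpsi cl s2 ls lL Js bs).
have eta1 s : (s0 <= s)%N -> \sum_(j < bsize s) bet s j ^+ 2 <= 1.
  by move=> ss; rewrite leNgt; apply/negP => h; apply: nbig; exists s => //; exact: ltW.
have [[mb w4]|small] := pselect (exists mb, 4 <= \sum_(s0 <= s < mb) osc_weight nu a s).
  have [s16 ls lL Js] := big s0 (leqnn _).
  have smb : (16 <= s0 < mb)%N.
    rewrite s16 ltnNge /=; apply/negP => h; move: w4; rewrite big_geq//; lra.
  by apply: (menshov_case hxi hUpsilon hchi nu0_gt0 n_gt0 nuE k1_gt0 k_growth cZ gz Zf Zg Zpsi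
    ZU Ublock hpsi cl smb ls lL Js eta1 w4).
pose u s : R := Num.min (gam s ^+ 2) 1.
have u0 s : 0 <= u s by rewrite le_min sqr_ge0 ler01.
have P0 : 0 < (2 : R) ^- l by rewrite invr_gt0 exprn_gt0.
have P1 : (2 : R) ^- l <= 1 by rewrite invf_le1 ?exprn_gt0// exprn_ege1//; lra.
(* In the bound, [5 = 4 + 1]: the weights sum to at most 4 and the errors [1 / s^2] to at most 1.
   The target is the one of [spread_many_blocks], divided by [2 ^+ l]. *)
have [||m1 sm1 tail] := @small_tail _ u s0 (896 * 16 * 5) (2 ^- l / 1000 / 100) u0.
- move=> m'; have w4 : \sum_(s0 <= s < m') osc_weight nu a s <= 4.
    by rewrite leNgt; apply/negP => h; apply: small; exists m'; exact: ltW.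
  have := @sum_inv_sqr R s0 m' (isT : (2 <= s0)%N).
  have : \sum_(s0 <= s < m') osc_weight nu a s =
      (\sum_(s0 <= s < m') u s) / (896 * 16) - \sum_(s0 <= s < m') (s%:R ^+ 2)^-1.
    by rewrite sumrB -mulr_suml.
  by move: w4; lra.
- by move: P0; lra.
(* The tail is so small that the truncation at 1 is inactive. *)
have gu s : (m1 <= s)%N -> gam s ^+ 2 = u s.
  move=> ms; have := tail s.+1; rewrite (big_cat_nat ms)//= big_nat1 => h.
  have us : u s <= 1 / 2.
    have : 0 <= \sum_(m1 <= i < s) u i by apply: sumr_ge0.
    by move: h P1; move: (\sum_(_ <= _ < _) _) (u s) (2 ^- l) => x y v; lra.
  by move: us; rewrite /u; case: (leP (gam s ^+ 2) 1) => //; lra.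
have tailg m2 : \sum_(m1 <= s < m2) gam s ^+ 2 <= 2 ^- l / 1000 / 100.
  by apply: le_trans (tail m2); rewrite !big_nat; apply: ler_sum => s /andP[ms _]; rewrite gu.
have [s16 ls lL Js] := big m1 sm1.
(* Of the surplus 2, the [gam]-part of the window takes at most 1, leaving at least 1 for
   [wenergy]. *)
have [N NP] := unbounded_partial_sums
  (\sum_(1 <= i < (nu (mu m1.-1) + mu m1.-1).+1) a i ^+ 2 + 2) (fun i => sqr_ge0 (a i)) ha.
pose m2 := (m1 + N).+1.
have m12 : (2 <= m1 <= m2)%N by rewrite /m2; lia.
have m12' : (1 <= m1 <= m2)%N by lia.
have := NP (nu (mu m2.-1) + mu m2.-1)%N; rewrite (energy_window m12') => E.
have {}E : 1 <= wenergy m1 m2.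
  have : (N <= nu (mu m2.-1) + mu m2.-1)%N by have := mu_ge m2.-1; rewrite /m2; lia.
  move=> /E; have := tailg m2; move: P1.
  by move: (\sum_(_ <= _ < m2) _) (2 ^- l) (wenergy _ _) => x y v; lra.
have gs : 2 ^+ l * \sum_(m1 <= s < m2) gam s ^+ 2 <= 1 / 1000 / 100.
  rewrite mulrC -ler_pdivlMr ?exprn_gt0//; apply: (le_trans (tailg m2)).
  by rewrite le_eqVlt; apply/orP; left; apply/eqP; field; rewrite gt_eqF ?exprn_gt0.
by apply: (spread_many_blocks hxi hUpsilon hchi nu0_gt0 n_gt0 nuE k1_gt0 k_growth cZ gz Zg Zpsi
    hpsi cl m12 ls lL Js gs E).
Qed.

End SmallCells.

(** * Iteration over finer and finer cells *)

Section Iteration.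
Context {R : realType}.
Variables (nu : nat -> nat) (chi : nat -> R -> R) (a : nat -> R) (Z : set R) (z : R).
Local Notation quiet := (quiet nu chi a).
Local Notation psum := (psum nu chi a).
Hypothesis cZ : countable Z.
Hypothesis gz : generic Z z.
Hypothesis small : forall J0 l c, (0 < c < 2 ^ l)%N ->
  small_cell nu chi a z J0 l c (999 / 1000).
Hypothesis quiet_cell : forall J0 J1, exists L, forall K i x, (L <= K)%N -> (i < 2 ^ K)%N ->
  dcell K i x -> ~ Z x -> quiet J0 J1 x <-> quiet J0 J1 (pt z K i).

Lemma quiet_le J0 J1 J1' x : (J1 <= J1')%N -> quiet J0 J1' x -> quiet J0 J1 x.
Proof. by move=> JJ q j j' jJ j'J; apply: q; lia. Qed.

Lemma exists_pow_lt (e : R) : 0 < e -> exists K0, 2 ^- K0 <= e.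
Proof.
move=> e0; have [K] := ltr_add_invr e0; rewrite add0r => Ke; exists K.
by apply: le_trans (ltW Ke); rewrite lef_pV2 ?posrE ?exprn_gt0// -natrX ler_nat ltn_expl.
Qed.

Lemma avg_first_cell L : avg L 0 0 (fun c => (c == 0)%:R) = 2 ^- L :> R.
Proof.
rewrite /avg subn0; have L0 : (0 < 2 ^ L)%N by rewrite expn_gt0.
rewrite (bigD1 (Ordinal L0))//= big1 ?addr0 ?mul1r// => t t0.
rewrite mul0n add0n (_ : (t == 0 :> nat) = false)//; apply/negbTE/negP => /eqP tE.
by move/eqP: t0; apply; apply/val_inj.
Qed.

(* The cell [0] escapes [small]; its contribution is absorbed by [e]. *)
Lemma quiet_rare J0 N (e : R) : 0 < e -> exists J1 K1, forall K, (K1 <= K)%N ->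
  avg K 0 0 (fun i => (`[< quiet J0 J1 (pt z K i) >])%:R) <= (999 / 1000) ^+ N + e.
Proof.
elim: N e => [|N IH] e e0.
  exists 0%N, 0%N => K _; rewrite expr0 -[leRHS](avg_cst K 0 0); apply: avg_le => i _.
  by case: asbool => /=; lra.
have e2 : 0 < e / 2 by lra.
have [J1 [K1 JK]] := IH (e / 2) e2; have [K0 K0e] := exists_pow_lt e2.
have [Lq Lqc] := quiet_cell J0 J1.
have [L [K1L K0L LqL]] : exists L, [/\ (K1 <= L)%N, (K0 <= L)%N & (Lq <= L)%N].
  by exists (maxn K1 (maxn K0 Lq)); rewrite !leq_max !leqnn !orbT.
have /choice[JK2 JK2P] : forall c : nat, exists jk : nat * nat, (0 < c < 2 ^ L)%N ->
    forall K, (jk.2 <= K)%N ->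
    avg K L c (fun i => (`[< quiet J0 jk.1 (pt z K i) >])%:R) <= 999 / 1000 :> R.
  move=> c; have [cl|_] := boolP (0 < c < 2 ^ L)%N; last by exists (0%N, 0%N).
  by have [j [kk jk]] := small J0 cl; exists (j, kk) => _.
(* The sums over all cells serve as common upper bounds for the finitely many choices. *)
exists (J1 + \sum_(c < 2 ^ L) (JK2 c).1)%N, (L + \sum_(c < 2 ^ L) (JK2 c).2)%N => K LK.
set J := (J1 + _)%N.
have LleK : (L <= K)%N := leq_trans (leq_addr _ _) LK.
have lLK : (0 <= L <= K)%N by [].
rewrite (avg_tower 0 _ lLK).
apply: (@le_trans _ _ (avg L 0 0 (fun c => 999 / 1000 * (`[< quiet J0 J1 (pt z L c) >])%:R +
    (c == 0)%:R))).
  apply: avg_le => c; rewrite subn0 => /eqP; rewrite -leqn0 leqNgt divn_gt0 ?expn_gt0// -ltnNge => cL.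
  have avg1 : avg K L c (fun i => (`[< quiet J0 J (pt z K i) >])%:R) <= 1 :> R.
    by rewrite -[leRHS](avg_cst K L c); apply: avg_le => i _; case: asbool.
  have [->|c0] := posnP c.
    apply: (le_trans (_ : _ <= 1)).
      by rewrite -[leRHS](avg_cst K L 0); apply: avg_le => i _; case: asbool.
    by rewrite lerDr; apply: mulr_ge0; [lra|rewrite ler0n].
  rewrite addr0.
  case: (asboolP (quiet J0 J1 (pt z L c))) => qc.
    rewrite mulr1; have cl : (0 < c < 2 ^ L)%N by rewrite c0.
    have Jc : ((JK2 c).1 <= J)%N.
      by rewrite /J (bigD1 (Ordinal cL))//= addnCA leq_addr.
    have Kc : ((JK2 c).2 <= K)%N.
      by apply: leq_trans LK; rewrite (bigD1 (Ordinal cL))//= addnCA leq_addr.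
    apply: (le_trans _ (JK2P c cl K Kc)); apply: avg_le => i _.
    rewrite ler_nat; case: (asboolP (quiet J0 J _)) => // q.
    by case: asboolP => // nq; case: nq; exact: quiet_le q.
  rewrite mulr0 -(avg_cst K L c 0); apply: avg_le => i ic.
  case: asboolP => //= q; exfalso; apply: qc.
  have xi : dcell L c (pt z K i).
    by rewrite /dcell /= in_itv /= -ic; exact: (pt_cell gz.1 _ LleK).
  apply/(Lqc L c _ LqL cL xi); first exact: generic_pt.
  exact: (quiet_le (leq_addr _ _) q).
have -> : avg L 0 0 (fun c => 999 / 1000 * (`[< quiet J0 J1 (pt z L c) >])%:R + (c == 0)%:R) =
   999 / 1000 * avg L 0 0 (fun c => (`[< quiet J0 J1 (pt z L c) >])%:R) + 2 ^- L :> R.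
  by rewrite -avgZ -avg_first_cell -avgD.
have := JK L K1L; have : (2 : R) ^- L <= 2 ^- K0.
  by rewrite lef_pV2 ?posrE ?exprn_gt0// ler_weXn2l//; lra.
rewrite exprS; move: K0e e0; clear.
by move: (avg _ _ _ _) (2 ^- _) (2 ^- _) (_ ^+ N) => x y v w; lra.
Qed.

Lemma oscillation_ae J0 : (@lebesgue_measure R).-negligible
  [set x | 0 <= x <= 1 /\ forall j j', (J0 <= j)%N -> (J0 <= j')%N ->
    `|psum j x - psum j' x| <= 1 / 10].
Proof.
apply: (null_of_small_averages gz.1 cZ) => [x [x01 _]|e e0]; first by rewrite /= in_itv.
have e2 : 0 < e / 2 by lra.
have [N Ne] : exists N, (999 / 1000 : R) ^+ N <= e / 2.
  have lt1 : `|999 / 1000 : R| < 1 by rewrite ger0_norm; lra.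
  have /cvgrPdist_le /(_ _ e2)[N _ NP] := cvg_expr lt1.
  have q0 : 0 <= (999 / 1000 : R) ^+ N by apply: exprn_ge0; lra.
  exists N; have := NP N (leqnn N); rewrite /= sub0r normrN (ger0_norm q0).
  exact.
have [J1 [K1 JK]] := quiet_rare J0 N e2; have [L Lq] := quiet_cell J0 J1.
exists (K1 + L)%N, (quiet J0 J1); split.
- by apply: (le_trans (JK _ (leq_addr _ _))); lra.
- by move=> x [[_ xq] _] j j' /andP[jJ _] /andP[j'J _]; exact: xq.
- by move=> i x iK xi nZ; apply: (Lq _ _ _ _ iK xi nZ).1; exact: leq_addl.
Qed.

(** A finite limit would confine all sums beyond some [J0] to variation 1/10, and the countably many
    sets of such points are null. *)
Lemma divergence_ae : {ae (@lebesgue_measure R), forall x : R, `[0, 1]%classic x ->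
  ~ cvgn (fun j : nat => psum j x)}.
Proof.
apply: (negligibleS _ (negligible_bigcup oscillation_ae)) => x /=.
move=> /existsNP[x01 /contrapT cx]; rewrite /= in_itv /= in x01.
have e0 : 0 < 1 / 20 :> R by lra.
have /cvgrPdist_le /(_ _ e0)[J0 _ JP] := cx.
exists J0 => //; split=> // j j' Jj Jj'.
have := JP j Jj; have := JP j' Jj'; rewrite /=.
move: (lim _) (psum j x) (psum j' x) => l u v; rewrite !ler_norml.
by move=> /andP[? ?] /andP[? ?]; apply/andP; split; lra.
Qed.

End Iteration.

Lemma dcell_pt {R : realType} K i (x : R) : dcell K i x ->
  exists2 w, 0 < w < 1 & x = pt w K i.
Proof.
rewrite /dcell /= in_itv /= ltr_pdivrMr ?exprn_gt0// ltr_pdivlMr ?exprn_gt0//.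
rewrite -natr1 => /andP[x1 x2]; exists (x * 2 ^+ K - i%:R); first by apply/andP; split; lra.
by rewrite /pt addrC subrK mulfK// gt_eqF ?exprn_gt0.
Qed.

(** * Partial sums are constant on fine cells *)

Section QuietCells.
Context {R : realType}.
Variables (k : nat -> nat) (Upsilon : nat -> R -> R).
Variables (n nu : nat -> nat) (chi : nat -> R -> R) (a : nat -> R) (Z : set R) (z : R).
Hypothesis hchi : chi_system k Upsilon n nu chi.
Hypothesis nu0_gt0 : (0 < nu 0)%N.
Hypothesis n_gt0 : forall j, (1 <= j)%N -> (0 < n j)%N.
Hypothesis nuE : forall j, (1 <= j)%N -> nu j = (nu j.-1 + 2 ^ n j - 1)%N.
Hypothesis k1_gt0 : (0 < k 1)%N.
Hypothesis k_mono : forall s t, (1 <= s <= t)%N -> (k s <= k t)%N.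
Hypothesis gz : generic Z z.
Hypothesis ZU : forall j, step_off Z (k (nu j)) (Upsilon j.+1).

Lemma psum_cell j K i x : (k (nu j) < K)%N -> (i < 2 ^ K)%N -> dcell K i x -> ~ Z x ->
  psum nu chi a j x = psum nu chi a j (pt z K i).
Proof.
move=> kK iK xi nZ; have nu_mono := nu_le nu0_gt0 n_gt0 nuE.
rewrite !(psumE a hchi nu0_gt0 n_gt0 nuE k1_gt0); congr (_ + _); rewrite !big_nat.
  apply: eq_bigr => -[//|l] /andP[_ lj]; congr (_ * _).
  have nl := nu_gt nu0_gt0 n_gt0 nuE l; have nlj : (nu l <= nu j)%N by apply: nu_mono; lia.
  have lK : (k (nu l) <= K)%N.
    by apply: ltnW; apply: leq_ltn_trans kK; apply: k_mono; rewrite nlj andbT; lia.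
  have [w w01 xE] := dcell_pt xi.
  apply: (@ZU l (i %/ 2 ^ (K - k (nu l)))%N) => //.
  - by rewrite ltn_divLR ?expn_gt0// -expnD subnKC.
  - by rewrite xE; exact: pt_cell.
  - by apply: pt_cell => //; exact: gz.1.
  - exact: generic_pt.
apply: eq_bigr => s /andP[s1 sj]; congr (_ * _).
have sK : (k s < K)%N by apply: leq_ltn_trans kK; apply: k_mono; lia.
by have [w w01 ->] := dcell_pt xi; rewrite !rademacher_pt//; exact: gz.1.
Qed.

Lemma quiet_cell J0 J1 : exists L, forall K i x, (L <= K)%N -> (i < 2 ^ K)%N ->
  dcell K i x -> ~ Z x -> quiet nu chi a J0 J1 x <-> quiet nu chi a J0 J1 (pt z K i).
Proof.
exists (k (nu J1)).+1 => K i x LK iK xi nZ.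
have E j : (j <= J1)%N -> psum nu chi a j x = psum nu chi a j (pt z K i).
  move=> jJ; apply: psum_cell => //; apply: leq_ltn_trans LK; apply: k_mono.
  rewrite (nu_le nu0_gt0 n_gt0 nuE jJ) andbT.
  by have := nu_gt nu0_gt0 n_gt0 nuE j; lia.
split=> q j j' jJ j'J; have := q j j' jJ j'J; rewrite !E//; lia.
Qed.

End QuietCells.

Lemma menshov_exceptions {R : realType} (f : nat -> nat -> R -> R) :
  (forall k, (2 <= k)%N -> menshov_extension k (f k)) ->
  exists2 Z : set R, countable Z & forall n i u, (2 <= n)%N -> (i < 2 ^ n)%N ->
    -1 <= u <= 1 -> ~ Z u -> f n i u = menshov_shift n i u.
Proof.
move=> hf; pose A n i : set R := [set u | [/\ (2 <= n)%N, (i < 2 ^ n)%N, -1 <= u <= 1 &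
  f n i u <> menshov_shift n i u]].
exists (\bigcup_n \bigcup_i A n i) => [|n i u n2 iN u1 nZ]; last first.
  by apply: contrapT => ne; apply: nZ; exists n => //; exists i.
apply: bigcup_countable => // n _; apply: bigcup_countable => // i _.
have [[n2 iN]|ne] := pselect ((2 <= n)%N /\ (i < 2 ^ n)%N); last first.
  by rewrite (_ : A n i = set0)// -subset0 => u [n2 iN _ _]; apply: ne.
apply: finite_set_countable; apply: sub_finite_set (mext_menshov (hf n n2) iN).
by move=> u [_ _ u1 ne]; split => //=; rewrite in_itv.
Qed.

Theorem theorem13 (R : realType)
    (f : nat -> nat -> R -> R)
    (hf : forall k : nat, (2 <= k)%N -> menshov_extension k (f k))
    (k : nat -> nat)
    (hk : forall n : nat, (1 <= n)%N -> smallest_level f k n)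
    (psi : nat -> R -> R) (hpsi : psi_system f k psi)
    (xi : nat -> R -> R) (hxi : xi_system k psi xi)
    (Upsilon : nat -> R -> R) (hUpsilon : Upsilon_system f k xi Upsilon)
    (M : R) (l0 : nat) (n nu : nat -> nat)
    (hpar : chi_parameters M l0 k Upsilon n nu)
    (chi : nat -> R -> R) (hchi : chi_system k Upsilon n nu chi)
    (a : nat -> R)
    (ha : ~ cvgn (fun N : nat => \sum_(1 <= i < N.+1) a i ^+ 2)) :
  {ae (@lebesgue_measure R), forall x : R, `[0, 1]%classic x ->
    ~ cvgn (fun j : nat => \sum_(1 <= i < (nu j + j).+1) a i * chi i x)}.
Proof.
have [Z1 cZ1 ZfP] := menshov_exceptions hf.
have [Z2 [cZ2 ZUP]] := dyadic_step_excs Upsilon.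
have [Z3 [cZ3 ZpsiP]] := dyadic_step_excs psi.
have /choice[Z4 Z4P] := fun s => dyadic_step_excs (g f k s).
(* One countable set collects the exceptions of all functions, so that a single offset [z] can be
   used at every level. *)
pose Z := Z1 `|` Z2 `|` Z3 `|` \bigcup_s Z4 s.
have cZ : countable Z.
  do 3?[apply: countable_setU => //].
  by apply: bigcup_countable => // s _; have [] := Z4P s.
have [z gz] := exists_generic cZ.
have sub (Z' : set R) (F : R -> R) l : Z' `<=` Z -> step_off Z' l F -> step_off Z l F.
  by move=> ZZ st i x y il ix iy nx ny; apply: (st i) => // /ZZ.
have Zf m i u : (2 <= m)%N -> (i < 2 ^ m)%N -> -1 <= u <= 1 -> ~ Z u -> f m i u = menshov_shift m i u.
  by move=> m2 iN u1 nZ; apply: ZfP => // Zu; apply: nZ; do 3!left.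
have ZU j l : dyadic_step 0 1 l (Upsilon j) -> step_off Z l (Upsilon j).
  by move=> /ZUP; apply: sub => x Zx; do 2!left; right.
have Zpsi v l : dyadic_step 0 1 l (psi v) -> step_off Z l (psi v).
  by move=> /ZpsiP; apply: sub => x Zx; left; right.
have Zg s j : (1 <= s)%N -> (j < 2 ^ (2 * s))%N -> step_off Z (k s) (g f k s j).
  move=> s1 js; have [_ /(_ j _ (level_step (hk s s1) js))] := Z4P s.
  by apply: sub => x Zx; right; exists s.
have k1_gt0 := level_gt0 (hk 1%N isT).
(* This is [gkap_lt] for the largest index [j = 2 ^ (2 * s) - 1]. *)
have k_growth s : (2 <= s)%N -> (glevel k s + k s.-1 + 4 + 2 ^ (2 * s) <= k s)%N.
  move=> s2; have p0 : (0 < 2 ^ (2 * s))%N by rewrite expn_gt0.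
  have := @gkap_lt _ f k Z z gz Zg s (2 ^ (2 * s)).-1 s2; rewrite /gkap; lia.
have [_ _ _ nu0_gt0 n_gt0 nuE _ Ustep Ublock] := hpar.
apply: (divergence_ae cZ gz).
  exact: (small_cell_all hxi hUpsilon hchi nu0_gt0 n_gt0 nuE k1_gt0 k_growth cZ gz Zf Zg Zpsi
    ZU Ublock hpsi ha).
apply: (quiet_cell a hchi nu0_gt0 n_gt0 nuE k1_gt0 _ gz) => [s t st|j].
  exact: (k_le k1_gt0 k_growth).
exact/ZU/Ustep.
Qed.
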